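(* Let $\mathcal{C}_1$ and $\mathcal{C}_2$ be two $H^{\infty}$ critical sets such that $\overline{\mathcal{C}_1}\cap\overline{\mathcal{C}_2}\cap\partial\mathbb{D}=\emptyset$. Then $\mathcal{C}_1\cup\mathcal{C}_2$ is an $H^{\infty}$ critical set.
   Context: Let $\mathbb{D}=\{z\in\mathbb{C}:|z|<1\}$ and let $H^{\infty}$ be the space of bounded analytic functions on $\mathbb{D}$. Sequences of points in $\mathbb{D}$ may be empty, finite or infinite, and are regarded as sets of points with multiplicities. A nonconstant $f\in H^\infty$ has critical set $\mathcal{C}$ if the zeros of $f'$ are precisely the points of the sequence $\mathcal{C}$ counting multiplicities: if a point occurs $m$ times in $\mathcal{C}$, then $f'$ has a zero of precise order $m$ there, and $f'(z)\ne0$ for $z\in\mathbb{D}\setminus\mathcal{C}$. A sequence $\mathcal{C}$ in $\mathbb{D}$ is an $H^{\infty}$ critical set if it is the critical set of some nonconstant $f\in H^{\infty}$. The union $\mathcal{C}_1\cup\mathcal{C}_2$ is taken counting multiplicities, i.e. the multiplicity of a point in $\mathcal{C}_1\cup\mathcal{C}_2$ is the sum of its multiplicities in $\mathcal{C}_1$ and $\mathcal{C}_2$. Closures are taken in $\mathbb{C}$. *)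

(* Defs.v *)
From Stdlib Require Import Reals Lra Lia.
From Coquelicot Require Import Coquelicot.
Open Scope R_scope.
Open Scope C_scope.

Definition unit_disc (z : C) : Prop := (Cmod z < 1)%R.

Definition unit_circle (z : C) : Prop := Cmod z = 1%R.

Definition Cclosure (A : C -> Prop) (z : C) : Prop :=
  forall eps : R, (0 < eps)%R -> exists w : C, A w /\ (Cmod (w - z) < eps)%R.

Definition C_differentiable (f : C -> C) (z : C) : Prop :=
  @ex_derive C_AbsRing C_NormedModule f z.

(* Membership in H^infty: only the values of [f] on the disc are relevant. *)
Definition Hinfty (f : C -> C) : Prop :=
  (forall z : C, unit_disc z -> C_differentiable f z) /\
  (exists M : R, forall z : C, unit_disc z -> (Cmod (f z) <= M)%R).

Definition nonconstant_on_disc (f : C -> C) : Prop :=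
  ~ exists c : C, forall z : C, unit_disc z -> f z = c.

(* [h] is analytic near [a] with a zero of precise order [m] at [a];
   for [m = 0] this says that [h] is analytic near [a] and [h a <> 0]. *)
Definition zero_of_order (h : C -> C) (a : C) (m : nat) : Prop :=
  exists g : C -> C,
    locally a (fun z : C => C_differentiable g z /\ h z = Cpow (z - a) m * g z) /\
    g a <> 0.

(* A (possibly empty, finite or infinite) sequence in the disc up to order,
   encoded by the number of occurrences of each point. *)
Record disc_sequence : Type := DiscSequence {
  mult :> C -> nat;
  mult_disc : forall z : C, mult z <> 0%nat -> unit_disc z;
  mult_countable : exists e : nat -> C,
    forall z : C, mult z <> 0%nat -> exists n : nat, e n = z }.

Definition points (A : disc_sequence) (z : C) : Prop := A z <> 0%nat.

Lemma union_disc (A B : disc_sequence) (z : C) :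
  (A z + B z)%nat <> 0%nat -> unit_disc z.
Proof.
intros H; destruct (Nat.eq_dec (A z) 0) as [HS|HS].
- apply (mult_disc B); lia.
- now apply (mult_disc A).
Qed.

Lemma union_countable (A B : disc_sequence) :
  exists e : nat -> C,
    forall z : C, (A z + B z)%nat <> 0%nat -> exists n : nat, e n = z.
Proof.
destruct (mult_countable A) as [s Hs], (mult_countable B) as [t Ht].
exists (fun n => if Nat.even n then s (Nat.div2 n) else t (Nat.div2 n)).
intros z H; destruct (Nat.eq_dec (A z) 0) as [HS|HS].
- destruct (Ht z) as [n Hn]; [lia|].
  exists (S (2 * n)).
  now rewrite Nat.even_succ, Nat.odd_even, Nat.div2_succ_double.
- destruct (Hs z HS) as [n Hn].
  exists (2 * n)%nat.
  now rewrite Nat.even_even, Nat.div2_double.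
Qed.

Definition sequence_union (A B : disc_sequence) : disc_sequence :=
  DiscSequence (fun z : C => (A z + B z)%nat)
    (union_disc A B) (union_countable A B).

(* [C_derive f] is built from horizontal difference quotients; on the disc it is
   the complex derivative of any [f] in H^infty, by [is_C_derive_unique]. *)
Definition has_critical_set (f : C -> C) (A : disc_sequence) : Prop :=
  forall z : C, unit_disc z -> zero_of_order (C_derive f) z (A z).

Definition Hinfty_critical_set (A : disc_sequence) : Prop :=
  exists f : C -> C,
    Hinfty f /\ nonconstant_on_disc f /\ has_critical_set f A.

(* Main.v *)
Require Import Defs.
From Stdlib Require Import Reals Lra Lia ClassicalEpsilon.
From Coquelicot Require Import Coquelicot.
Local Open Scope R_scope.

(** Write F' = f1' f2' E_1 ... E_N with nonvanishing holomorphic factors E_k, one for each of N short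
    arcs of the circle; then F has the required critical points and only the boundedness of F is at
    stake. By the separation hypothesis one of f1', f2', say g_k, has no zeros near the k-th arc.
    Split L = log g_k additively by Cauchy transforms along a path joining the end points of the arc
    through the disc: this gives E_k such that both E_k, away from the arc, and g_k E_k, near the arc,
    are bounded with bounded derivative. Near the arc F' is then h b where h is the derivative of
    the other function and b, b' are bounded, and integrating by parts bounds F.

    The splitting blows up at the end points p of the arcs. If |L(z)| = O(|z - p|^(-3/4))
    nontangentially at p, this is cured by a factor exp(-(1 - z/p)^(-15/16)). Such p are dense: g_k is a
    derivative of a bounded function, so Re L = O(log 1/(1 - |z|)) from above, and the mean value
    property over circles nearly touching the boundary allows one to descend to the boundary along
    points z_n with - Re L(z_n) = O((1 - |z_n|)^(-3/4)), which Harnack's inequality extends to Stolz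
    angles. *)

(** * Complex continuity and differentiability *)

(** The exponents fit together as [3/4 < 7/8 < 15/16 < 1]. A logarithm of size [d^(-3/4)], [d] being
    the distance to the end points of the arc, has Cauchy transforms of size at most [d^(-7/8)]. A
    barrier of order [15/16] dominates these, and its order below 1 keeps its real part positive on
    the whole disc. The exponent [3/4] is also what the descent to the boundary can afford: a step
    divides the height [1 - |z|] by at least [65536 = 4^8], hence multiplies its power [-3/4] by at
    least [4096], whereas the mean value property loses only a factor [1600]. Powers are written as
    natural powers of an 8th or 16th root ([q], [sg]) of a distance.

    Off all the arc regions there is no bounded factor to integrate against: [f1' f2'] is only
    [O((1 - |z|)^(-2))]. But such a point lies in the sector of some arc, and the rest of that
    sector touches the circle only at the two end points, nontangentially. There the damped factor
    of that arc is [O((1 - |z|)^2)], so F' is bounded, and F is bounded by integrating along radii.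
    The integration by parts starts from these points. *)

Notation ccont := (@continuous _ C_UniformSpace).

Lemma Cmod_sub_sym (a b : C) : Cmod (a - b) = Cmod (b - a).
Proof. rewrite <- Cmod_opp; f_equal; ring. Qed.

Lemma Im_le_Cmod (c : C) : Rabs (Im c) <= Cmod c.
Proof. eapply Rle_trans; [apply Rmax_r | apply (Rmax_Cmod c)]. Qed.

Lemma Cmod_le_Re_Im (c : C) : Cmod c <= Rabs (Re c) + Rabs (Im c).
Proof.
rewrite <- (Rabs_pos_eq (Rabs (Re c) + Rabs (Im c))) by (pose proof (Rabs_pos (Re c)); pose proof (Rabs_pos (Im c)); lra).
rewrite <- (Rabs_pos_eq (Cmod c)) by apply Cmod_ge_0.
apply Rsqr_le_abs_0; unfold Rsqr.
pose proof (Cmod2_alt c) as H.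
pose proof (Rabs_pos (Re c)); pose proof (Rabs_pos (Im c)).
pose proof (pow2_abs (Re c)); pose proof (pow2_abs (Im c)). nra.
Qed.

Lemma Cmod_diag (a : C) : Cmod (a - a) = 0.
Proof. replace (a - a)%C with (RtoC 0) by ring. apply Cmod_0. Qed.

Lemma Cmod_triangle_sub (a b : C) : Cmod (a - b) <= Cmod a + Cmod b.
Proof. unfold Cminus. rewrite <- (Cmod_opp b). apply Cmod_triangle. Qed.

Lemma Cmod_triangle_rev (a b : C) : Cmod a - Cmod b <= Cmod (a - b).
Proof.
pose proof (Cmod_triangle (a - b) b) as H. replace (a - b + b)%C with a in H by ring. lra.
Qed.

Lemma Cmod_dist_triangle (a b c : C) : Cmod (a - c) <= Cmod (a - b) + Cmod (b - c).
Proof. replace (a - c)%C with ((a - b) + (b - c))%C by ring; apply Cmod_triangle. Qed.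

Section Continuity.
Context {T : UniformSpace}.

Lemma ccont_pair (f : T -> C) (x : T) :
  continuous (fun t => Re (f t)) x -> continuous (fun t => Im (f t)) x -> ccont f x.
Proof.
intros H1 H2.
apply continuous_ext with (fun t => (Re (f t), Im (f t))).
- intros t; now destruct (f t).
- apply (continuous_comp_2 (fun t => Re (f t)) (fun t => Im (f t)) (fun a b => (a, b) : C_UniformSpace)); trivial.
  intros P HP; apply (filter_imp (F := locally (Re (f x), Im (f x))) P); [now intros [a b]|exact HP].
Qed.

Lemma ccont_Re (f : T -> C) (x : T) : ccont f x -> continuous (fun t => Re (f t)) x.
Proof.
intros H; apply (continuous_comp f Re x H). destruct (f x) as [a b]; apply (continuous_fst a b).
Qed.

Lemma ccont_Im (f : T -> C) (x : T) : ccont f x -> continuous (fun t => Im (f t)) x.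
Proof.
intros H; apply (continuous_comp f Im x H). destruct (f x) as [a b]; apply (continuous_snd a b).
Qed.

Lemma ccont_const (c : C) (x : T) : ccont (fun _ : T => c) x.
Proof. apply continuous_const. Qed.

Lemma ccont_plus (f g : T -> C) (x : T) :
  ccont f x -> ccont g x -> ccont (fun t => f t + g t)%C x.
Proof.
intros Hf Hg; apply ccont_pair; simpl.
- apply (continuous_plus (fun t => Re (f t)) (fun t => Re (g t))); now apply ccont_Re.
- apply (continuous_plus (fun t => Im (f t)) (fun t => Im (g t))); now apply ccont_Im.
Qed.

Lemma ccont_opp (f : T -> C) (x : T) : ccont f x -> ccont (fun t => - f t)%C x.
Proof.
intros Hf; apply ccont_pair; simpl.
- apply (continuous_opp (fun t => Re (f t))); now apply ccont_Re.
- apply (continuous_opp (fun t => Im (f t))); now apply ccont_Im.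
Qed.

Lemma ccont_minus (f g : T -> C) (x : T) :
  ccont f x -> ccont g x -> ccont (fun t => f t - g t)%C x.
Proof. intros Hf Hg; apply ccont_plus; [trivial|now apply ccont_opp]. Qed.

Lemma ccont_mult (f g : T -> C) (x : T) :
  ccont f x -> ccont g x -> ccont (fun t => f t * g t)%C x.
Proof.
intros Hf Hg.
pose proof (ccont_Re f x Hf); pose proof (ccont_Im f x Hf).
pose proof (ccont_Re g x Hg); pose proof (ccont_Im g x Hg).
apply ccont_pair; simpl.
- apply (continuous_minus (fun t => Re (f t) * Re (g t)) (fun t => Im (f t) * Im (g t)));
  apply (continuous_mult (K := R_AbsRing)); trivial.
- apply (continuous_plus (fun t => Re (f t) * Im (g t)) (fun t => Im (f t) * Re (g t)));
  apply (continuous_mult (K := R_AbsRing)); trivial.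
Qed.

Lemma ccont_RtoC (f : T -> R) (x : T) : continuous f x -> ccont (fun t => RtoC (f t)) x.
Proof. intros Hf; apply ccont_pair; simpl; trivial. apply continuous_const. Qed.

Lemma ccont_Cmod (f : T -> C) (x : T) : ccont f x -> continuous (fun t => Cmod (f t)) x.
Proof.
intros Hf; unfold Cmod.
apply (continuous_comp (fun t => fst (f t) ^ 2 + snd (f t) ^ 2) sqrt).
- apply (continuous_plus (fun t => fst (f t) ^ 2) (fun t => snd (f t) ^ 2));
  apply (continuous_comp _ (fun u : R => u ^ 2)).
  + now apply ccont_Re.
  + apply (ex_derive_continuous (fun u : R => u ^ 2)); auto_derive; trivial.
  + now apply ccont_Im.
  + apply (ex_derive_continuous (fun u : R => u ^ 2)); auto_derive; trivial.
- apply continuity_pt_filterlim, continuity_pt_sqrt.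
  generalize (pow2_ge_0 (fst (f x))) (pow2_ge_0 (snd (f x))); lra.
Qed.

Lemma ccont_inv (f : T -> C) (x : T) : ccont f x -> f x <> 0%C -> ccont (fun t => / f t)%C x.
Proof.
intros Hf Hx.
pose proof (ccont_Re f x Hf) as Hr; pose proof (ccont_Im f x Hf) as Hi.
assert (Hn : fst (f x) ^ 2 + snd (f x) ^ 2 <> 0).
{ intros E; apply Hx, Cmod_eq_0; unfold Cmod; rewrite E; apply sqrt_0. }
assert (Hs : forall u : T -> R, continuous u x -> continuous (fun t => u t ^ 2) x).
{ intros u Hu; apply (continuous_comp u (fun v : R => v ^ 2)); trivial.
  apply (ex_derive_continuous (fun u : R => u ^ 2)); auto_derive; trivial. }
assert (HN : continuous (fun t => / (fst (f t) ^ 2 + snd (f t) ^ 2)) x).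
{ apply (continuous_comp (fun t => fst (f t) ^ 2 + snd (f t) ^ 2) Rinv).
  - apply (continuous_plus (fun t => fst (f t) ^ 2) (fun t => snd (f t) ^ 2)); now apply Hs.
  - apply (ex_derive_continuous Rinv); auto_derive; trivial. }
apply ccont_pair; simpl; apply (continuous_mult (K := R_AbsRing)); trivial.
apply (continuous_opp (fun t => Im (f t))); trivial.
Qed.

Lemma ccont_pow (f : T -> C) (n : nat) (x : T) : ccont f x -> ccont (fun t => Cpow (f t) n) x.
Proof.
intros Hf; induction n as [|n IH]; simpl; [apply ccont_const|now apply ccont_mult].
Qed.
End Continuity.

Lemma ccont_id (z : C) : ccont (fun w : C => w) z.
Proof. apply continuous_id. Qed.

(** Balls of [C_UniformSpace] are squares. A disc lies in the square of the same size, and the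
    square lies in the disc enlarged by [sqrt 2]. *)
Lemma ccont_eps (f : C -> C) (z : C) :
  ccont f z <-> (forall eps, 0 < eps -> exists del, 0 < del /\
    forall w, Cmod (w - z) < del -> Cmod (f w - f z) < eps).
Proof.
split.
- intros H eps He.
  assert (Hs : 0 < sqrt 2) by (apply sqrt_lt_R0; lra).
  assert (He2 : 0 < eps / sqrt 2) by (apply Rdiv_lt_0_compat; lra).
  destruct (H (ball (f z) (mkposreal _ He2)) (locally_ball _ _)) as [d Hd].
  exists d; split; [apply cond_pos|].
  intros w Hw.
  assert (Hb : @ball C_UniformSpace z d w) by now apply C_NormedModule_mixin_compat1.
  specialize (Hd w Hb).
  replace eps with (sqrt 2 * (eps / sqrt 2)) by (field; lra).
  now apply (C_NormedModule_mixin_compat2 (f z) (f w) (mkposreal _ He2)).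
- intros H P [eps HP].
  destruct (H eps (cond_pos eps)) as [d [Hd0 Hd]].
  assert (Hs : 0 < sqrt 2) by (apply sqrt_lt_R0; lra).
  assert (He2 : 0 < d / sqrt 2) by (apply Rdiv_lt_0_compat; lra).
  exists (mkposreal _ He2); intros w Hw.
  apply HP, C_NormedModule_mixin_compat1, Hd.
  replace d with (sqrt 2 * (d / sqrt 2)) by (field; lra).
  now apply (C_NormedModule_mixin_compat2 z w (mkposreal _ He2)).
Qed.

Lemma locally_C_eps (z : C) (P : C -> Prop) :
  @locally C_UniformSpace z P <-> exists del, 0 < del /\ forall w, Cmod (w - z) < del -> P w.
Proof.
split.
- intros [eps HP]; exists eps; split; [apply cond_pos|].
  intros w Hw; apply HP, C_NormedModule_mixin_compat1, Hw.
- intros [d [Hd0 Hd]].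
  assert (Hs : 0 < sqrt 2) by (apply sqrt_lt_R0; lra).
  assert (He2 : 0 < d / sqrt 2) by (apply Rdiv_lt_0_compat; lra).
  exists (mkposreal _ He2); intros w Hw; apply Hd.
  replace d with (sqrt 2 * (d / sqrt 2)) by (field; lra).
  now apply (C_NormedModule_mixin_compat2 z w (mkposreal _ He2)).
Qed.

(** The derivative over [C_AbsRing] written out with [Cmod], as [is_Cderive_iff] confirms. The
    estimates below produce remainder bounds of exactly this shape. *)
Definition is_Cderive (f : C -> C) (z l : C) : Prop :=
  forall eps, 0 < eps -> exists del, 0 < del /\
    forall w, Cmod (w - z) < del -> Cmod (f w - f z - l * (w - z)) <= eps * Cmod (w - z).

Lemma is_Cderive_iff (f : C -> C) (z l : C) :
  is_Cderive f z l <-> @is_derive C_AbsRing C_NormedModule f z l.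
Proof.
split.
- intros H; split; [apply is_linear_scal_l|].
  intros x Hx eps.
  apply (is_filter_lim_locally_unique (V := AbsRing_NormedModule C_AbsRing)) in Hx; subst x.
  destruct (H eps (cond_pos eps)) as [d [Hd0 Hd]].
  exists (mkposreal _ Hd0); intros w Hw.
  specialize (Hd w Hw).
  change (Cmod (f w - f z - (w - z) * l) <= eps * Cmod (w - z)).
  now rewrite (Cmult_comm (w - z)).
- intros [_ H] eps He.
  destruct (H z (fun P HP => HP) (mkposreal _ He)) as [d Hd].
  exists d; split; [apply cond_pos|]; intros w Hw.
  specialize (Hd w Hw).
  change (Cmod (f w - f z - (w - z) * l) <= eps * Cmod (w - z)) in Hd.
  now rewrite (Cmult_comm (w - z)) in Hd.
Qed.

Lemma is_Cderive_cont (f : C -> C) (z l : C) : is_Cderive f z l -> ccont f z.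
Proof.
intros H; apply ccont_eps; intros eps He.
destruct (H 1 Rlt_0_1) as [d [Hd0 Hd]].
pose proof (Cmod_ge_0 l) as Hl.
exists (Rmin d (eps / (2 + Cmod l))); split.
- apply Rmin_pos; trivial; apply Rdiv_lt_0_compat; lra.
- intros w Hw.
  assert (H1 := Hd w (Rlt_le_trans _ _ _ Hw (Rmin_l _ _))).
  assert (H2 := Rlt_le_trans _ _ _ Hw (Rmin_r _ _)).
  replace (f w - f z)%C with ((f w - f z - l * (w - z)) + l * (w - z))%C by ring.
  eapply Rle_lt_trans; [apply Cmod_triangle|rewrite Cmod_mult].
  apply (Rmult_lt_compat_r (2 + Cmod l)) in H2; [|lra].
  replace (eps / (2 + Cmod l) * (2 + Cmod l)) with eps in H2 by (field; lra).
  pose proof (Cmod_ge_0 (w - z)); nra.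
Qed.

Lemma is_Cderive_ext_loc (f g : C -> C) (z l : C) (r : R) :
  0 < r -> (forall w, Cmod (w - z) < r -> f w = g w) -> is_Cderive f z l -> is_Cderive g z l.
Proof.
intros Hr He H eps Heps; destruct (H eps Heps) as [d [Hd0 Hd]].
exists (Rmin d r); split; [now apply Rmin_pos|].
intros w Hw; rewrite <- (He w), <- (He z).
- apply Hd; eapply Rlt_le_trans; [exact Hw|apply Rmin_l].
- now rewrite Cmod_diag.
- eapply Rlt_le_trans; [exact Hw|apply Rmin_r].
Qed.

Lemma ccont_ext_loc (f g : C -> C) (z : C) (r : R) :
  0 < r -> (forall w, Cmod (w - z) < r -> f w = g w) -> ccont f z -> ccont g z.
Proof.
intros Hr He H; apply ccont_eps; intros eps Heps.
destruct (proj1 (ccont_eps f z) H eps Heps) as [d [Hd0 Hd]].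
exists (Rmin d r); split; [now apply Rmin_pos|].
intros w Hw; rewrite <- (He w), <- (He z).
- apply Hd; eapply Rlt_le_trans; [exact Hw|apply Rmin_l].
- now rewrite Cmod_diag.
- eapply Rlt_le_trans; [exact Hw|apply Rmin_r].
Qed.

Lemma is_Cderive_eq (f : C -> C) (z l m : C) : is_Cderive f z l -> l = m -> is_Cderive f z m.
Proof. now intros H <-. Qed.

Lemma is_Cderive_const (c z : C) : is_Cderive (fun _ => c) z 0%C.
Proof. apply is_Cderive_iff, (is_derive_const (K := C_AbsRing) (V := C_NormedModule)). Qed.

Lemma is_Cderive_id (z : C) : is_Cderive (fun w => w) z 1%C.
Proof.
intros eps He; exists 1; split; [lra|]; intros w _.
replace (w - z - 1 * (w - z))%C with (RtoC 0) by ring.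
rewrite Cmod_0; pose proof (Cmod_ge_0 (w - z)); nra.
Qed.

Lemma is_Cderive_plus (f g : C -> C) (z l m : C) :
  is_Cderive f z l -> is_Cderive g z m -> is_Cderive (fun w => f w + g w)%C z (l + m)%C.
Proof.
rewrite !is_Cderive_iff; intros Hf Hg.
exact (is_derive_plus (K := C_AbsRing) (V := C_NormedModule) f g z l m Hf Hg).
Qed.

Lemma is_Cderive_mult (f g : C -> C) (z l m : C) :
  is_Cderive f z l -> is_Cderive g z m -> is_Cderive (fun w => f w * g w)%C z (l * g z + f z * m)%C.
Proof.
intros Hf Hg eps He.
pose proof (Cmod_ge_0 (f z)) as Hfz. pose proof (Cmod_ge_0 (g z)) as Hgz.
pose proof (Cmod_ge_0 l) as Hl.
set (e := eps / (3 * (1 + Cmod (f z) + Cmod (g z)))).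
assert (He0 : 0 < e) by (apply Rdiv_lt_0_compat; lra).
assert (He1 : e * (1 + Cmod (f z) + Cmod (g z)) = eps / 3) by (unfold e; field; lra).
destruct (Hf e He0) as [d1 [Hd1 H1]].
destruct (Hg e He0) as [d2 [Hd2 H2]].
destruct (proj1 (ccont_eps g z) (is_Cderive_cont g z m Hg) (Rmin 1 (eps / (3 * (1 + Cmod l))))) as [d3 [Hd3 H3]].
{ apply Rmin_pos; [lra|apply Rdiv_lt_0_compat; lra]. }
exists (Rmin d1 (Rmin d2 d3)); split; [repeat apply Rmin_pos; trivial|].
intros w Hw.
assert (W1 : Cmod (w - z) < d1) by (eapply Rlt_le_trans; [exact Hw|apply Rmin_l]).
assert (W23 : Cmod (w - z) < Rmin d2 d3) by (eapply Rlt_le_trans; [exact Hw|apply Rmin_r]).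
assert (W2 : Cmod (w - z) < d2) by (eapply Rlt_le_trans; [exact W23|apply Rmin_l]).
assert (W3 : Cmod (w - z) < d3) by (eapply Rlt_le_trans; [exact W23|apply Rmin_r]).
specialize (H1 w W1); specialize (H2 w W2); specialize (H3 w W3).
replace (f w * g w - f z * g z - (l * g z + f z * m) * (w - z))%C with
  ((f w - f z - l * (w - z)) * g w + (f z * (g w - g z - m * (w - z)) + l * (w - z) * (g w - g z)))%C by ring.
eapply Rle_trans; [apply Cmod_triangle|].
eapply Rle_trans; [apply Rplus_le_compat_l, Cmod_triangle|].
rewrite !Cmod_mult.
assert (Hgw : Cmod (g w) <= 1 + Cmod (g z)).
{ pose proof (Cmod_triangle_rev (g w) (g z)). pose proof (Rmin_l 1 (eps / (3 * (1 + Cmod l)))). lra. }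
assert (Hlg : Cmod l * Cmod (g w - g z) <= eps / 3).
{ pose proof (Rmin_r 1 (eps / (3 * (1 + Cmod l)))) as Hm.
  assert (Hq : eps / (3 * (1 + Cmod l)) * (1 + Cmod l) = eps / 3) by (field; lra).
  pose proof (Cmod_ge_0 (g w - g z)). nra. }
pose proof (Cmod_ge_0 (w - z)) as Hz. pose proof (Cmod_ge_0 (g w)).
set (x := Cmod (w - z)) in *.
assert (T1 : Cmod (f w - f z - l * (w - z)) * Cmod (g w) <= (e * x) * (1 + Cmod (g z))).
{ apply Rmult_le_compat; trivial; apply Cmod_ge_0. }
assert (T2 : Cmod (f z) * Cmod (g w - g z - m * (w - z)) <= Cmod (f z) * (e * x)).
{ apply Rmult_le_compat_l; trivial. }
assert (T3 : Cmod l * x * Cmod (g w - g z) <= eps / 3 * x) by nra.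
nra.
Qed.

Lemma is_Cderive_comp (f g : C -> C) (z l m : C) :
  is_Cderive f (g z) l -> is_Cderive g z m -> is_Cderive (fun w => f (g w)) z (l * m)%C.
Proof.
intros Hf Hg eps He.
pose proof (Cmod_ge_0 l) as Hl. pose proof (Cmod_ge_0 m) as Hm.
set (e1 := eps / (2 * (1 + Cmod m))).
set (e2 := Rmin 1 (eps / (2 * (1 + Cmod l)))).
assert (He1 : 0 < e1) by (apply Rdiv_lt_0_compat; lra).
assert (He2 : 0 < e2) by (apply Rmin_pos; [lra|apply Rdiv_lt_0_compat; lra]).
destruct (Hf e1 He1) as [d1 [Hd1 H1]].
destruct (Hg e2 He2) as [d2 [Hd2 H2]].
destruct (proj1 (ccont_eps g z) (is_Cderive_cont g z m Hg) d1 Hd1) as [d3 [Hd3 H3]].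
exists (Rmin d2 d3); split; [now apply Rmin_pos|].
intros w Hw.
specialize (H2 w (Rlt_le_trans _ _ _ Hw (Rmin_l _ _))).
specialize (H3 w (Rlt_le_trans _ _ _ Hw (Rmin_r _ _))).
specialize (H1 (g w) H3).
replace (f (g w) - f (g z) - l * m * (w - z))%C with
 ((f (g w) - f (g z) - l * (g w - g z)) + l * (g w - g z - m * (w - z)))%C by ring.
eapply Rle_trans; [apply Cmod_triangle|rewrite Cmod_mult].
pose proof (Cmod_ge_0 (w - z)) as Hx.
assert (Hgw : Cmod (g w - g z) <= (1 + Cmod m) * Cmod (w - z)).
{ replace (g w - g z)%C with ((g w - g z - m * (w - z)) + m * (w - z))%C by ring.
  eapply Rle_trans; [apply Cmod_triangle|rewrite Cmod_mult].
  pose proof (Rmin_l 1 (eps / (2 * (1 + Cmod l)))). fold e2 in H. nra. }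
assert (E1 : e1 * (1 + Cmod m) = eps / 2) by (unfold e1; field; lra).
assert (E2 : e2 * (1 + Cmod l) <= eps / 2).
{ replace (eps / 2) with (eps / (2 * (1 + Cmod l)) * (1 + Cmod l)) by (field; lra).
  apply Rmult_le_compat_r; [lra|apply Rmin_r]. }
assert (Cmod l * Cmod (g w - g z - m * (w - z)) <= Cmod l * (e2 * Cmod (w - z))) by (apply Rmult_le_compat_l; trivial).
assert (e1 * Cmod (g w - g z) <= e1 * ((1 + Cmod m) * Cmod (w - z))) by (apply Rmult_le_compat_l; lra).
nra.
Qed.

Lemma is_Cderive_inv (z : C) : z <> 0%C -> is_Cderive Cinv z (- / (z * z))%C.
Proof.
intros Hz eps He.
pose proof (proj1 (Cmod_gt_0 z) Hz) as Hm.
set (d := Cmod z / 2).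
assert (Hd : 0 < eps * (Cmod z) ^ 3 / 2) by (apply Rdiv_lt_0_compat; [apply Rmult_lt_0_compat; trivial; now apply pow_lt|lra]).
exists (Rmin (Cmod z / 2) (eps * (Cmod z) ^ 3 / 2)); split; [apply Rmin_pos; lra|].
intros w Hw.
assert (W1 := Rlt_le_trans _ _ _ Hw (Rmin_l _ _)).
assert (W2 := Rlt_le_trans _ _ _ Hw (Rmin_r _ _)).
assert (Hwm : Cmod z / 2 < Cmod w).
{ pose proof (Cmod_triangle_rev z w) as Q. rewrite Cmod_sub_sym in Q. lra. }
assert (Hw0 : w <> 0%C) by (apply Cmod_gt_0; lra).
replace (/ w - / z - - / (z * z) * (w - z))%C with ((w - z) * (w - z) / (w * z * z))%C by (field; now split).
assert (Hwzz : (w * z * z)%C <> 0%C) by (repeat apply Cmult_neq_0; trivial).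
rewrite Cmod_div by trivial. rewrite !Cmod_mult.
pose proof (Cmod_ge_0 (w - z)).
apply Rle_div_l.
- apply Rmult_lt_0_compat; [apply Rmult_lt_0_compat|]; lra.
- assert (Cmod (w - z) <= eps * (Cmod w * Cmod z * Cmod z)).
  { apply Rlt_le, (Rlt_le_trans _ _ _ W2).
    replace (eps * Cmod z ^ 3 / 2) with (eps * (Cmod z / 2 * Cmod z * Cmod z)) by (simpl; field).
    apply Rmult_le_compat_l; [lra|]. repeat apply Rmult_le_compat_r; lra. }
  nra.
Qed.

Lemma is_Cderive_unique (f : C -> C) (z l m : C) : is_Cderive f z l -> is_Cderive f z m -> l = m.
Proof.
rewrite !is_Cderive_iff; intros H1 H2.
now rewrite <- (is_C_derive_unique f z l H1), (is_C_derive_unique f z m H2).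
Qed.

(** * Paths and integrals of complex functions of a real variable *)

(** Taken by components, so that the real mean value theorem and [RInt] apply. [path_derive_eps]
    recovers the modulus form, which suits composition. *)
Definition path_derive (f : R -> C) (t : R) (l : C) : Prop :=
  is_derive (fun s => Re (f s)) t (Re l) /\ is_derive (fun s => Im (f s)) t (Im l).

Lemma is_derive_eps (f : R -> R) (t l : R) :
  is_derive f t l <-> (forall eps, 0 < eps -> exists del, 0 < del /\
    forall s, Rabs (s - t) < del -> Rabs (f s - f t - l * (s - t)) <= eps * Rabs (s - t)).
Proof.
split.
- intros [_ H] eps He.
  destruct (H t (fun P HP => HP) (mkposreal _ He)) as [d Hd].
  exists d; split; [apply cond_pos|]; intros s Hs.
  specialize (Hd s Hs).
  change (Rabs (f s - f t - (s - t) * l) <= eps * Rabs (s - t)) in Hd.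
  now rewrite (Rmult_comm (s - t)) in Hd.
- intros H; split; [apply is_linear_scal_l|].
  intros x Hx eps.
  apply (is_filter_lim_locally_unique (V := R_NormedModule)) in Hx; subst x.
  destruct (H eps (cond_pos eps)) as [d [Hd0 Hd]].
  exists (mkposreal _ Hd0); intros s Hs.
  specialize (Hd s Hs).
  change (Rabs (f s - f t - (s - t) * l) <= eps * Rabs (s - t)).
  now rewrite (Rmult_comm (s - t)).
Qed.

Lemma path_derive_eps (f : R -> C) (t : R) (l : C) :
  path_derive f t l <-> (forall eps, 0 < eps -> exists del, 0 < del /\
    forall s, Rabs (s - t) < del -> Cmod (f s - f t - l * (s - t)%R) <= eps * Rabs (s - t)).
Proof.
assert (Er : forall s, Re (f s - f t - l * (s - t)%R) = Re (f s) - Re (f t) - Re l * (s - t)).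
{ intros s; unfold Re, Im; simpl; ring. }
assert (Ei : forall s, Im (f s - f t - l * (s - t)%R) = Im (f s) - Im (f t) - Im l * (s - t)).
{ intros s; unfold Re, Im; simpl; ring. }
unfold path_derive; rewrite !is_derive_eps; split.
- intros [H1 H2] eps He.
  destruct (H1 (eps / 2)) as [d1 [Hd1 K1]]; [lra|].
  destruct (H2 (eps / 2)) as [d2 [Hd2 K2]]; [lra|].
  exists (Rmin d1 d2); split; [now apply Rmin_pos|]; intros s Hs.
  specialize (K1 s (Rlt_le_trans _ _ _ Hs (Rmin_l _ _))).
  specialize (K2 s (Rlt_le_trans _ _ _ Hs (Rmin_r _ _))).
  eapply Rle_trans; [apply Cmod_le_Re_Im|rewrite Er, Ei; lra].
- intros H; split; intros eps He; destruct (H eps He) as [d [Hd K]];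
  exists d; split; trivial; intros s Hs; (eapply Rle_trans; [|apply (K s Hs)]).
  + rewrite <- Er; apply re_le_Cmod.
  + rewrite <- Ei; apply Im_le_Cmod.
Qed.

Lemma path_derive_eq (f : R -> C) (t : R) (l m : C) : path_derive f t l -> l = m -> path_derive f t m.
Proof. now intros H <-. Qed.

Lemma path_derive_cont (f : R -> C) (t : R) (l : C) : path_derive f t l -> ccont f t.
Proof.
intros [H1 H2]; apply ccont_pair.
- apply (ex_derive_continuous (fun s => Re (f s))); now exists (Re l).
- apply (ex_derive_continuous (fun s => Im (f s))); now exists (Im l).
Qed.

Lemma ccont_R_eps (f : R -> C) (t : R) : ccont f t ->
  forall eps, 0 < eps -> exists del, 0 < del /\
    forall s, Rabs (s - t) < del -> Cmod (f s - f t) < eps.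
Proof.
intros H eps He.
assert (Hs : 0 < sqrt 2) by (apply sqrt_lt_R0; lra).
assert (He2 : 0 < eps / sqrt 2) by (apply Rdiv_lt_0_compat; lra).
destruct (H (ball (f t) (mkposreal _ He2)) (locally_ball _ _)) as [d Hd].
exists d; split; [apply cond_pos|].
intros w Hw.
specialize (Hd w Hw).
replace eps with (sqrt 2 * (eps / sqrt 2)) by (field; lra).
now apply (C_NormedModule_mixin_compat2 (f t) (f w) (mkposreal _ He2)).
Qed.

Lemma path_derive_comp (f : C -> C) (g : R -> C) (t : R) (l m : C) :
  is_Cderive f (g t) l -> path_derive g t m -> path_derive (fun s => f (g s)) t (l * m)%C.
Proof.
intros Hf Hg0; apply path_derive_eps; intros eps He.
assert (Hg := proj1 (path_derive_eps g t m) Hg0).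
pose proof (Cmod_ge_0 l) as Hl. pose proof (Cmod_ge_0 m) as Hm.
set (e1 := eps / (2 * (1 + Cmod m))).
set (e2 := Rmin 1 (eps / (2 * (1 + Cmod l)))).
assert (He1 : 0 < e1) by (apply Rdiv_lt_0_compat; lra).
assert (He2 : 0 < e2) by (apply Rmin_pos; [lra|apply Rdiv_lt_0_compat; lra]).
destruct (Hf e1 He1) as [d1 [Hd1 H1]].
destruct (Hg e2 He2) as [d2 [Hd2 H2]].
destruct (ccont_R_eps g t (path_derive_cont g t m Hg0) d1 Hd1) as [d3 [Hd3 H3]].
exists (Rmin d2 d3); split; [now apply Rmin_pos|].
intros w Hw.
specialize (H2 w (Rlt_le_trans _ _ _ Hw (Rmin_l _ _))).
specialize (H3 w (Rlt_le_trans _ _ _ Hw (Rmin_r _ _))).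
specialize (H1 (g w) H3).
replace (f (g w) - f (g t) - l * m * (w - t)%R)%C with
 ((f (g w) - f (g t) - l * (g w - g t)) + l * (g w - g t - m * (w - t)%R))%C by ring.
eapply Rle_trans; [apply Cmod_triangle|rewrite Cmod_mult].
pose proof (Rabs_pos (w - t)) as Hx.
assert (Hgw : Cmod (g w - g t) <= (1 + Cmod m) * Rabs (w - t)).
{ replace (g w - g t)%C with ((g w - g t - m * (w - t)%R) + m * (w - t)%R)%C by ring.
  eapply Rle_trans; [apply Cmod_triangle|rewrite Cmod_mult, Cmod_R].
  pose proof (Rmin_l 1 (eps / (2 * (1 + Cmod l)))). fold e2 in H. nra. }
assert (E1 : e1 * (1 + Cmod m) = eps / 2) by (unfold e1; field; lra).
assert (E2 : e2 * (1 + Cmod l) <= eps / 2).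
{ replace (eps / 2) with (eps / (2 * (1 + Cmod l)) * (1 + Cmod l)) by (field; lra).
  apply Rmult_le_compat_r; [lra|apply Rmin_r]. }
assert (Cmod l * Cmod (g w - g t - m * (w - t)%R) <= Cmod l * (e2 * Rabs (w - t))) by (apply Rmult_le_compat_l; trivial).
assert (e1 * Cmod (g w - g t) <= e1 * ((1 + Cmod m) * Rabs (w - t))) by (apply Rmult_le_compat_l; lra).
nra.
Qed.

Lemma path_derive_const (c : C) (t : R) : path_derive (fun _ => c) t 0%C.
Proof. split; apply (is_derive_const (K := R_AbsRing) (V := R_NormedModule)). Qed.

Lemma path_derive_RtoC (f : R -> R) (t l : R) : is_derive f t l -> path_derive (fun s => RtoC (f s)) t l.
Proof. intros H; split; simpl; trivial. apply (is_derive_const (K := R_AbsRing) (V := R_NormedModule)). Qed.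

Lemma path_derive_plus (f g : R -> C) (t : R) (l m : C) :
  path_derive f t l -> path_derive g t m -> path_derive (fun s => f s + g s)%C t (l + m)%C.
Proof.
intros [F1 F2] [G1 G2]; split; simpl.
- apply (is_derive_plus (fun s => Re (f s)) (fun s => Re (g s)) t _ _ F1 G1).
- apply (is_derive_plus (fun s => Im (f s)) (fun s => Im (g s)) t _ _ F2 G2).
Qed.

Lemma path_derive_mult (f g : R -> C) (t : R) (l m : C) :
  path_derive f t l -> path_derive g t m -> path_derive (fun s => f s * g s)%C t (l * g t + f t * m)%C.
Proof.
intros [F1 F2] [G1 G2].
assert (M : forall u v (du dv : R), is_derive u t du -> is_derive v t dv ->
  is_derive (fun s : R => u s * v s) t (du * v t + u t * dv)).
{ intros u v du dv Hu Hv; apply (is_derive_mult (K := R_AbsRing) u v t du dv Hu Hv); intros; apply Rmult_comm. }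
split; simpl.
- replace (fst l * fst (g t) - snd l * snd (g t) + (fst (f t) * fst m - snd (f t) * snd m))
   with ((Re l * Re (g t) + Re (f t) * Re m) - (Im l * Im (g t) + Im (f t) * Im m)) by (unfold Re, Im; ring).
  apply (is_derive_minus (fun s => Re (f s) * Re (g s)) (fun s => Im (f s) * Im (g s)));
  [exact (M _ _ _ _ F1 G1)|exact (M _ _ _ _ F2 G2)].
- replace (fst l * snd (g t) + snd l * fst (g t) + (fst (f t) * snd m + snd (f t) * fst m))
   with ((Re l * Im (g t) + Re (f t) * Im m) + (Im l * Re (g t) + Im (f t) * Re m)) by (unfold Re, Im; ring).
  apply (is_derive_plus (fun s => Re (f s) * Im (g s)) (fun s => Im (f s) * Re (g s)));
  [exact (M _ _ _ _ F1 G2)|exact (M _ _ _ _ F2 G1)].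
Qed.

Lemma path_derive_affine (a b : C) (t : R) : path_derive (fun s => a + s * b)%C t b.
Proof.
apply (path_derive_eq _ _ (0 + (RtoC 1 * b + RtoC t * 0))%C); [|ring].
apply (path_derive_plus (fun _ => a) (fun s => s * b)%C); [apply path_derive_const|].
apply (path_derive_mult (fun s => RtoC s) (fun _ => b)); [|apply path_derive_const].
apply path_derive_RtoC, (is_derive_id (K := R_AbsRing)).
Qed.

(** The mean value theorem is applied to the real and to the imaginary part; the factor 2 is the sum
    of the two estimates. *)
Lemma path_derive_mvt (g g' : R -> C) (a b M : R) : a <= b ->
  (forall t, a <= t <= b -> path_derive g t (g' t) /\ Cmod (g' t) <= M) ->
  Cmod (g b - g a) <= 2 * M * (b - a).
Proof.
intros Hab H.
assert (HM : 0 <= M) by (destruct (H a) as [_ K]; [lra|]; pose proof (Cmod_ge_0 (g' a)); lra).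
assert (Gen : forall (u u' : R -> R), (forall t, a <= t <= b -> is_derive u t (u' t) /\ Rabs (u' t) <= M) ->
   Rabs (u b - u a) <= M * (b - a)).
{ intros u u' Hu.
  destruct (MVT_gen u a b u') as [c [Hc ->]].
  - intros x Hx; rewrite Rmin_left, Rmax_right in Hx by lra. apply Hu; lra.
  - intros x Hx; rewrite Rmin_left, Rmax_right in Hx by lra.
    apply continuity_pt_filterlim, (ex_derive_continuous u). exists (u' x); apply Hu; lra.
  - rewrite Rmin_left, Rmax_right in Hc by lra.
    rewrite Rabs_mult, (Rabs_pos_eq (b - a)) by lra.
    apply Rmult_le_compat_r; [lra|apply Hu; lra]. }
eapply Rle_trans; [apply Cmod_le_Re_Im|].
assert (K1 := Gen (fun t => Re (g t)) (fun t => Re (g' t))).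
assert (K2 := Gen (fun t => Im (g t)) (fun t => Im (g' t))).
change (Rabs (Re (g b) - Re (g a)) + Rabs (Im (g b) - Im (g a)) <= 2 * M * (b - a)).
enough (Rabs (Re (g b) - Re (g a)) <= M * (b - a) /\ Rabs (Im (g b) - Im (g a)) <= M * (b - a)) by lra.
split; [apply K1|apply K2]; intros t Ht; destruct (H t Ht) as [[D1 D2] B]; split; trivial.
- eapply Rle_trans; [apply re_le_Cmod|trivial].
- eapply Rle_trans; [apply Im_le_Cmod|trivial].
Qed.

Lemma is_Cderive_mvt (f f' : C -> C) (a b : C) (M : R) :
  (forall t : R, 0 <= t <= 1 -> is_Cderive f (a + t * (b - a))%C (f' (a + t * (b - a))%C) /\
     Cmod (f' (a + t * (b - a))%C) <= M) ->
  Cmod (f b - f a) <= 2 * M * Cmod (b - a).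
Proof.
intros H.
assert (K := path_derive_mvt (fun t => f (a + t * (b - a))%C) (fun t => f' (a + t * (b - a)) * (b - a))%C 0 1
  (M * Cmod (b - a)) Rle_0_1).
cbv beta in K.
replace (a + RtoC 1 * (b - a))%C with b in K by ring.
replace (a + RtoC 0 * (b - a))%C with a in K by ring.
replace (2 * M * Cmod (b - a)) with (2 * (M * Cmod (b - a)) * (1 - 0)) by ring.
apply K; intros t Ht; destruct (H t Ht) as [D B]; split.
- apply path_derive_comp; [trivial|apply path_derive_affine].
- rewrite Cmod_mult; apply Rmult_le_compat_r; [apply Cmod_ge_0|trivial].
Qed.

Definition CInt (f : R -> C) (a b : R) : C :=
  (RInt (fun t => Re (f t)) a b, RInt (fun t => Im (f t)) a b).

Definition ccont_on (f : R -> C) (a b : R) : Prop := forall t, a <= t <= b -> ccont f t.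

Lemma ccont_on_Re (f : R -> C) (a b : R) : a <= b -> ccont_on f a b -> ex_RInt (fun t => Re (f t)) a b.
Proof.
intros Hab H; apply (ex_RInt_continuous (V := R_CompleteNormedModule)); intros t Ht.
rewrite Rmin_left, Rmax_right in Ht by lra; now apply ccont_Re, H.
Qed.

Lemma ccont_on_Im (f : R -> C) (a b : R) : a <= b -> ccont_on f a b -> ex_RInt (fun t => Im (f t)) a b.
Proof.
intros Hab H; apply (ex_RInt_continuous (V := R_CompleteNormedModule)); intros t Ht.
rewrite Rmin_left, Rmax_right in Ht by lra; now apply ccont_Im, H.
Qed.

Lemma CInt_ext (f g : R -> C) (a b : R) : a <= b -> (forall t, a <= t <= b -> f t = g t) -> CInt f a b = CInt g a b.
Proof.
intros Hab H; unfold CInt; f_equal; apply RInt_ext; intros t Ht;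
rewrite Rmin_left, Rmax_right in Ht by lra; rewrite H; trivial; lra.
Qed.

Lemma CInt_plus (f g : R -> C) (a b : R) : a <= b -> ccont_on f a b -> ccont_on g a b ->
  CInt (fun t => f t + g t)%C a b = (CInt f a b + CInt g a b)%C.
Proof.
intros Hab Hf Hg; unfold CInt, Cplus; simpl; f_equal.
- apply (RInt_plus (fun t => Re (f t)) (fun t => Re (g t))); now apply ccont_on_Re.
- apply (RInt_plus (fun t => Im (f t)) (fun t => Im (g t))); now apply ccont_on_Im.
Qed.

Lemma CInt_scal (c : C) (f : R -> C) (a b : R) : a <= b -> ccont_on f a b ->
  CInt (fun t => c * f t)%C a b = (c * CInt f a b)%C.
Proof.
intros Hab Hf.
assert (Hr := ccont_on_Re f a b Hab Hf); assert (Hi := ccont_on_Im f a b Hab Hf).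
assert (S : forall k u, ex_RInt u a b -> RInt (fun t : R => k * u t) a b = k * RInt u a b).
{ intros k u Hu; exact (RInt_scal u a b k Hu). }
assert (E : forall k u, ex_RInt u a b -> ex_RInt (fun t : R => k * u t) a b).
{ intros k u Hu; exact (ex_RInt_scal u a b k Hu). }
unfold CInt, Cmult; simpl; f_equal.
- rewrite <- !S by trivial.
  apply (RInt_minus (fun t => fst c * Re (f t)) (fun t => snd c * Im (f t))); now apply E.
- rewrite <- !S by trivial.
  apply (RInt_plus (fun t => fst c * Im (f t)) (fun t => snd c * Re (f t))); now apply E.
Qed.

Lemma CInt_minus (f g : R -> C) (a b : R) : a <= b -> ccont_on f a b -> ccont_on g a b ->
  CInt (fun t => f t - g t)%C a b = (CInt f a b - CInt g a b)%C.
Proof.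
intros Hab Hf Hg.
rewrite (CInt_ext _ (fun t => f t + (-(1)) * g t)%C) by (trivial; intros; ring).
rewrite CInt_plus, CInt_scal; trivial; [ring|].
intros t Ht; apply ccont_mult; [apply ccont_const|now apply Hg].
Qed.

Lemma CInt_bound (f : R -> C) (a b M : R) : a <= b -> ccont_on f a b ->
  (forall t, a <= t <= b -> Cmod (f t) <= M) -> Cmod (CInt f a b) <= 2 * (b - a) * M.
Proof.
intros Hab Hf HM.
eapply Rle_trans; [apply Cmod_le_Re_Im|simpl].
assert (Rabs (RInt (fun t => Re (f t)) a b) <= (b - a) * M).
{ apply abs_RInt_le_const; [trivial|now apply ccont_on_Re|]. intros t Ht.
  eapply Rle_trans; [apply re_le_Cmod|auto]. }
assert (Rabs (RInt (fun t => Im (f t)) a b) <= (b - a) * M).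
{ apply abs_RInt_le_const; [trivial|now apply ccont_on_Im|]. intros t Ht.
  eapply Rle_trans; [apply Im_le_Cmod|auto]. }
lra.
Qed.

Lemma CInt_FTC (F f : R -> C) (a b : R) : a <= b ->
  (forall t, a <= t <= b -> path_derive F t (f t)) -> ccont_on f a b -> CInt f a b = (F b - F a)%C.
Proof.
intros Hab HF Hf; unfold CInt.
change (F b - F a)%C with (Re (F b) - Re (F a), Im (F b) - Im (F a)); f_equal;
apply is_RInt_unique.
- apply (is_RInt_derive (fun t => Re (F t)) (fun t => Re (f t)));
  rewrite Rmin_left, Rmax_right by trivial; intros t Ht; [now apply HF|now apply ccont_Re, Hf].
- apply (is_RInt_derive (fun t => Im (F t)) (fun t => Im (f t)));
  rewrite Rmin_left, Rmax_right by trivial; intros t Ht; [now apply HF|now apply ccont_Im, Hf].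
Qed.

Lemma CInt_Chasles (f : R -> C) (a b c : R) : a <= b -> b <= c -> ccont_on f a c ->
  (CInt f a b + CInt f b c)%C = CInt f a c.
Proof.
intros Hab Hbc Hf.
assert (H1 : ccont_on f a b) by (intros t Ht; apply Hf; lra).
assert (H2 : ccont_on f b c) by (intros t Ht; apply Hf; lra).
unfold CInt, Cplus; simpl; f_equal.
- apply (RInt_Chasles (fun t => Re (f t))); now apply ccont_on_Re.
- apply (RInt_Chasles (fun t => Im (f t))); now apply ccont_on_Im.
Qed.

Lemma CInt_const (c : C) (a b : R) : CInt (fun _ => c) a b = ((b - a)%R * c)%C.
Proof.
unfold CInt; rewrite !RInt_const; unfold scal; simpl; unfold mult; simpl.
unfold Cmult; simpl; unfold Re, Im; f_equal; ring.
Qed.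

(** Differentiation under the integral sign, by components. The derivative is required on a whole
    neighbourhood of each [(x, t)] because the real theorem asks for continuity of [Derive] in both
    variables, and [Derive] is identified with [Psi] only where a derivative is exhibited. *)
Lemma CInt_param (Phi Psi : R -> R -> C) (a b x r : R) : a <= b -> 0 < r ->
  (forall s t, Rabs (s - x) < r -> a <= t <= b -> path_derive (fun s => Phi s t) s (Psi s t)) ->
  (forall t, a <= t <= b -> locally (x, t) (fun p : R * R =>
      path_derive (fun s => Phi s (snd p)) (fst p) (Psi (fst p) (snd p)))) ->
  (forall t, a <= t <= b -> @continuous (prod_UniformSpace R_UniformSpace R_UniformSpace) C_UniformSpace
      (fun p : R * R => Psi (fst p) (snd p)) (x, t)) ->
  (forall s, Rabs (s - x) < r -> ccont_on (Phi s) a b) ->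
  path_derive (fun s => CInt (Phi s) a b) x (CInt (Psi x) a b).
Proof.
intros Hab Hr H1 H2 H3 H4.
assert (Gen : forall (u v : R -> R -> R),
  (forall s t, Rabs (s - x) < r -> a <= t <= b -> is_derive (fun s => u s t) s (v s t)) ->
  (forall t, a <= t <= b -> locally (x, t) (fun p : R * R =>
      is_derive (fun s => u s (snd p)) (fst p) (v (fst p) (snd p)))) ->
  (forall t, a <= t <= b -> @continuous (prod_UniformSpace R_UniformSpace R_UniformSpace) R_UniformSpace
      (fun p : R * R => v (fst p) (snd p)) (x, t)) ->
  (forall s, Rabs (s - x) < r -> ex_RInt (u s) a b) ->
  is_derive (fun s => RInt (u s) a b) x (RInt (v x) a b)).
{ intros u v K1 K2 K3 K4.
  rewrite (RInt_ext (v x) (fun t => Derive (fun s => u s t) x)).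
  2:{ intros t Ht; rewrite Rmin_left, Rmax_right in Ht by lra.
      symmetry; apply is_derive_unique, K1; [|lra].
      rewrite Rminus_diag, Rabs_R0; trivial. }
  apply (is_derive_RInt_param u a b x).
  - exists (mkposreal _ Hr); intros s Hs t Ht; rewrite Rmin_left, Rmax_right in Ht by lra.
    exists (v s t); now apply K1.
  - intros t Ht; rewrite Rmin_left, Rmax_right in Ht by lra.
    apply continuity_2d_pt_ext_loc with v.
    + apply locally_2d_locally; eapply filter_imp; [|apply (K2 t Ht)].
      intros [p q] Hpq; simpl in *. symmetry; now apply is_derive_unique.
    + apply continuity_2d_pt_filterlim, (K3 t Ht).
  - exists (mkposreal _ Hr); intros s Hs; now apply K4. }
split; simpl.
- apply (Gen (fun s t => Re (Phi s t)) (fun s t => Re (Psi s t))).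
  + intros s t Hs Ht; now apply H1.
  + intros t Ht; eapply filter_imp; [|apply (H2 t Ht)]. intros p Hp; apply Hp.
  + intros t Ht; apply (ccont_Re (fun p : R * R => Psi (fst p) (snd p))), H3, Ht.
  + intros s Hs; apply ccont_on_Re; trivial; now apply H4.
- apply (Gen (fun s t => Im (Phi s t)) (fun s t => Im (Psi s t))).
  + intros s t Hs Ht; now apply H1.
  + intros t Ht; eapply filter_imp; [|apply (H2 t Ht)]. intros p Hp; apply Hp.
  + intros t Ht; apply (ccont_Im (fun p : R * R => Psi (fst p) (snd p))), H3, Ht.
  + intros s Hs; apply ccont_on_Im; trivial; now apply H4.
Qed.

Lemma ccont_on_bounded (f : R -> C) (a b : R) : a <= b -> ccont_on f a b ->
  exists M, 0 < M /\ forall t, a <= t <= b -> Cmod (f t) <= M.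
Proof.
intros Hab Hf.
destruct (continuity_ab_maj (fun t => Cmod (f t)) a b Hab) as [m [Hm _]].
- intros t Ht; apply continuity_pt_filterlim, ccont_Cmod, Hf, Ht.
- exists (Cmod (f m) + 1); split; [pose proof (Cmod_ge_0 (f m)); lra|].
  intros t Ht; specialize (Hm t Ht); lra.
Qed.

(** * Primitives and Cauchy transforms *)

Definition openC (U : C -> Prop) : Prop :=
  forall z, U z -> exists r, 0 < r /\ forall w, Cmod (w - z) < r -> U w.

Definition convexC (U : C -> Prop) : Prop :=
  forall (a b : C) (t : R), U a -> U b -> 0 <= t <= 1 -> U (a + t * (b - a))%C.

(* Continuity of the derivative is included, so that Cauchy's theorem needs no Goursat argument. *)
Definition holo (U : C -> Prop) (f f' : C -> C) : Prop :=
  forall z, U z -> is_Cderive f z (f' z) /\ ccont f' z.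

Lemma holo_cont (U : C -> Prop) (f f' : C -> C) (z : C) : holo U f f' -> U z -> ccont f z.
Proof. intros H Hz; exact (is_Cderive_cont f z (f' z) (proj1 (H z Hz))). Qed.

Lemma holo_sub (U V : C -> Prop) (f f' : C -> C) :
  (forall z, V z -> U z) -> holo U f f' -> holo V f f'.
Proof. intros S H z Hz; now apply H, S. Qed.

(** The primitive is the integral along the segment from [a]. Its derivative in the direction [h] is
    found by differentiating under the integral sign; path independence is hidden in the fact that
    the result is an exact derivative in [t]. *)
Lemma primitive_convex (U : C -> Prop) (k k' : C -> C) (a : C) :
  openC U -> convexC U -> U a -> holo U k k' ->
  exists K, forall z, U z -> is_Cderive K z (k z).
Proof.
intros HO HC Ha Hk.
exists (fun z => CInt (fun t => k (a + t * (z - a)) * (z - a))%C 0 1).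
intros z Hz.
destruct (HO z Hz) as [r [Hr Hball]].
assert (Hk1 : forall w, Cmod (w - z) < r -> forall t : R, 0 <= t <= 1 -> U (a + t * (w - a))%C).
{ intros w Hw t Ht; apply HC; auto. }
assert (Key : forall h, Cmod h < r / 2 -> forall s : R, 0 <= s <= 1 ->
  path_derive (fun s : R => CInt (fun t : R => k (a + t * (z + s * h - a)) * (z + s * h - a))%C 0 1) s (k (z + s * h) * h)%C).
{ intros h Hh s Hs.
  set (Phi := fun (s t : R) => (k (a + t * (z + s * h - a)) * (z + s * h - a))%C).
  set (Psi := fun (s t : R) => (k' (a + t * (z + s * h - a)) * (t * h) * (z + s * h - a)
                              + k (a + t * (z + s * h - a)) * h)%C).
  (* Differentiation at [s] in [[0, 1]] needs room on both sides. Here [Rabs s' < 2], and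
     [Cmod h < r / 2] keeps the end of the segment in the ball. *)
  assert (Hin : forall s', Rabs (s' - s) < 1 -> Cmod (z + s' * h - z) < r).
  { intros s' Hs'. replace (z + s' * h - z)%C with (s' * h)%C by ring.
    rewrite Cmod_mult, Cmod_R.
    assert (Rabs s' < 2). { apply Rabs_def2 in Hs'. apply Rabs_def1; lra. }
    pose proof (Cmod_ge_0 h). pose proof (Rabs_pos s'). nra. }
  assert (Hd : forall s t : R, U (a + t * (z + s * h - a))%C -> path_derive (fun s => Phi s t) s (Psi s t)).
  { intros s' t HU. unfold Phi, Psi.
    assert (A : path_derive (fun s0 : R => z + s0 * h - a)%C s' h).
    { eapply path_derive_eq; [apply (path_derive_plus (fun s0 : R => z + s0 * h)%C (fun _ => (- a)%C) s' h 0%C)|ring].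
      - apply path_derive_affine.
      - apply path_derive_const. }
    apply (path_derive_mult (fun s0 => k (a + t * (z + s0 * h - a))%C) (fun s0 => (z + s0 * h - a)%C)); trivial.
    apply (path_derive_comp k (fun s0 => a + t * (z + s0 * h - a))%C); [now apply Hk|].
    eapply path_derive_eq; [apply (path_derive_plus (fun _ => a) (fun s0 : R => t * (z + s0 * h - a))%C s' 0%C (0 * (z + s' * h - a) + t * h)%C)|ring].
    - apply path_derive_const.
    - apply (path_derive_mult (fun _ => RtoC t) (fun s0 : R => z + s0 * h - a)%C); trivial; apply path_derive_const. }
  assert (Cz : forall (s0 t0 : R), @continuous (prod_UniformSpace R_UniformSpace R_UniformSpace) C_UniformSpace
     (fun p : R * R => a + (snd p) * (z + (fst p) * h - a))%C (s0, t0)).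
  { intros s0 t0. apply ccont_plus; [apply ccont_const|].
    apply ccont_mult; [apply ccont_RtoC, continuous_snd|].
    apply ccont_minus; [|apply ccont_const].
    apply ccont_plus; [apply ccont_const|].
    apply ccont_mult; [apply ccont_RtoC, continuous_fst|apply ccont_const]. }
  assert (HR : path_derive (fun s => CInt (Phi s) 0 1) s (CInt (Psi s) 0 1)).
  { apply (CInt_param Phi Psi 0 1 s 1); try lra.
    - intros s' t Hs' Ht; apply Hd, Hk1; trivial; now apply Hin.
    - intros t Ht.
      assert (HU : U (a + t * (z + s * h - a))%C).
      { apply Hk1; trivial. apply Hin. rewrite Rminus_diag, Rabs_R0; lra. }
      destruct (HO _ HU) as [r2 [Hr2 Hb2]].
      assert (L := Cz s t _ (proj2 (locally_C_eps _ _) (ex_intro _ r2 (conj Hr2 Hb2)))).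
      eapply filter_imp; [|exact L]. intros [p q] Hpq; simpl in *. now apply Hd.
    - intros t Ht; unfold Psi.
      assert (HU : U (a + t * (z + s * h - a))%C).
      { apply Hk1; trivial. apply Hin. rewrite Rminus_diag, Rabs_R0; lra. }
      assert (Ck : forall g : C -> C, ccont g (a + t * (z + s * h - a))%C ->
        @continuous (prod_UniformSpace R_UniformSpace R_UniformSpace) C_UniformSpace
     (fun p : R * R => g (a + (snd p) * (z + (fst p) * h - a)))%C (s, t)).
      { intros g Hg. apply (continuous_comp (fun p : R * R => a + (snd p) * (z + (fst p) * h - a))%C g); trivial. }
      apply ccont_plus; apply ccont_mult.
      + apply ccont_mult; [apply Ck; now apply Hk|].
        apply ccont_mult; [apply ccont_RtoC, continuous_snd|apply ccont_const].
      + apply ccont_minus; [|apply ccont_const].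
        apply ccont_plus; [apply ccont_const|].
        apply ccont_mult; [apply ccont_RtoC, continuous_fst|apply ccont_const].
      + apply Ck; now apply (holo_cont U k k').
      + apply ccont_const.
    - intros s' Hs' t Ht; unfold Phi.
      apply ccont_mult; [|apply ccont_const].
      apply (continuous_comp (fun t : R => a + t * (z + s' * h - a))%C k).
      + apply (path_derive_cont _ _ _ (path_derive_affine _ _ _)).
      + apply (holo_cont U k k'); trivial. apply Hk1; trivial. now apply Hin. }
  apply (path_derive_eq _ _ _ _ HR).
  assert (HUs : forall t : R, 0 <= t <= 1 -> U (a + t * (z + s * h - a))%C).
  { intros t Ht; apply Hk1; trivial. apply Hin. rewrite Rminus_diag, Rabs_R0; lra. }
  (* The [s]-derivative of the integrand is the [t]-derivative of [t k(...) h], so only the end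
     value [k (z + s h) h] remains. *)
  rewrite (CInt_FTC (fun t : R => t * (k (a + t * (z + s * h - a)) * h))%C).
  - replace (a + RtoC 1 * (z + s * h - a))%C with (z + s * h)%C by ring. ring.
  - lra.
  - intros t Ht; unfold Psi.
    eapply path_derive_eq; [apply (path_derive_mult (fun t => RtoC t) (fun t : R => k (a + t * (z + s * h - a)) * h)%C)|].
    + apply path_derive_RtoC, (is_derive_id (K := R_AbsRing)).
    + apply (path_derive_mult (fun t : R => k (a + t * (z + s * h - a))%C) (fun _ => h)); [|apply path_derive_const].
      apply (path_derive_comp k (fun t : R => a + t * (z + s * h - a))%C); [apply Hk; auto|apply path_derive_affine].
    + unfold one; simpl; ring.
  - intros t Ht; unfold Psi.
    assert (A : ccont (fun t : R => a + t * (z + s * h - a))%C t) by apply (path_derive_cont _ _ _ (path_derive_affine _ _ _)).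
    apply ccont_plus; apply ccont_mult; try apply ccont_const.
    + apply ccont_mult.
      * apply (continuous_comp (fun t : R => a + t * (z + s * h - a))%C k'); trivial. now apply Hk, HUs.
      * apply ccont_mult; [apply ccont_RtoC, continuous_id|apply ccont_const].
    + apply (continuous_comp (fun t : R => a + t * (z + s * h - a))%C k); trivial.
      apply (holo_cont U k k'); auto. }
intros eps He.
destruct (proj1 (ccont_eps k z) (holo_cont U k k' z Hk Hz) (eps / 2)) as [d [Hd0 Hd]]; [lra|].
exists (Rmin (r / 2) d); split; [apply Rmin_pos; lra|].
intros w Hw.
assert (W1 := Rlt_le_trans _ _ _ Hw (Rmin_l _ _)).
assert (W2 := Rlt_le_trans _ _ _ Hw (Rmin_r _ _)).
set (h := (w - z)%C) in *.
(* Subtracting the linear term leaves the derivative [(k (z + s h) - k z) h], which is small by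
   continuity of [k] alone. *)
assert (B := path_derive_mvt (fun s : R => CInt (fun t : R => k (a + t * (z + s * h - a)) * (z + s * h - a))%C 0 1 + s * - (k z * h))%C
  (fun s : R => (k (z + s * h) - k z) * h)%C 0 1 (eps / 2 * Cmod h) Rle_0_1).
cbv beta in B.
replace (z + RtoC 1 * h)%C with w in B by (unfold h; ring).
replace (z + RtoC 0 * h)%C with z in B by ring.
replace (CInt (fun t : R => k (a + t * (w - a)) * (w - a))%C 0 1 -
 CInt (fun t : R => k (a + t * (z - a)) * (z - a))%C 0 1 - k z * h)%C with
 (CInt (fun t : R => k (a + t * (w - a)) * (w - a))%C 0 1 + 1 * - (k z * h)
   - (CInt (fun t : R => k (a + t * (z - a)) * (z - a))%C 0 1 + 0 * - (k z * h)))%C by ring.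
replace (eps * Cmod h) with (2 * (eps / 2 * Cmod h) * (1 - 0)) by field.
apply B; intros t Ht; split.
- eapply path_derive_eq; [apply (path_derive_plus (fun s : R => CInt (fun t : R => k (a + t * (z + s * h - a)) * (z + s * h - a))%C 0 1) (fun s : R => s * - (k z * h))%C)|].
  + apply Key; [trivial|lra].
  + apply (path_derive_mult (fun s : R => RtoC s) (fun _ => (- (k z * h))%C)); [apply path_derive_RtoC, (is_derive_id (K := R_AbsRing))|apply path_derive_const].
  + unfold one; simpl; ring.
- rewrite Cmod_mult; apply Rmult_le_compat_r; [apply Cmod_ge_0|].
  apply Rlt_le, Hd. replace (z + t * h - z)%C with (t * h)%C by ring.
  rewrite Cmod_mult, Cmod_R, Rabs_pos_eq by lra.
  pose proof (Cmod_ge_0 h). nra.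
Qed.

(** A remainder that is quadratic in [w - z], uniformly in [t], can simply be integrated; no
    interchange of limits occurs. *)
Lemma CInt_holo (Phi : R -> C -> C) (Phi' : R -> C) (a b : R) (z : C) (r K : R) :
  a <= b -> 0 < r -> ccont_on Phi' a b ->
  (forall w, Cmod (w - z) < r -> ccont_on (fun t => Phi t w) a b) ->
  (forall t w, a <= t <= b -> Cmod (w - z) < r ->
     Cmod (Phi t w - Phi t z - (w - z) * Phi' t) <= K * Cmod (w - z) ^ 2) ->
  is_Cderive (fun w => CInt (fun t => Phi t w) a b) z (CInt Phi' a b).
Proof.
intros Hab Hr H' HP HK eps He.
set (B := 2 * (b - a) * Rabs K + 1).
assert (HB : 0 < B).
{ unfold B; pose proof (Rabs_pos K). assert (0 <= 2 * (b - a) * Rabs K) by (apply Rmult_le_pos; lra). lra. }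
exists (Rmin r (eps / B)); split; [apply Rmin_pos; trivial; now apply Rdiv_lt_0_compat|].
intros w Hw.
assert (W1 := Rlt_le_trans _ _ _ Hw (Rmin_l _ _)).
assert (W2 := Rlt_le_trans _ _ _ Hw (Rmin_r _ _)).
assert (Z0 : Cmod (z - z) < r) by (now rewrite Cmod_diag).
rewrite <- CInt_minus by auto.
rewrite (Cmult_comm (CInt Phi' a b)), <- CInt_scal by trivial.
assert (Q1 : ccont_on (fun t => Phi t w - Phi t z)%C a b).
{ intros t Ht; apply ccont_minus; [now apply HP|now apply HP]. }
assert (Q2 : ccont_on (fun t => (w - z) * Phi' t)%C a b).
{ intros t Ht; apply ccont_mult; [apply ccont_const|now apply H']. }
rewrite <- CInt_minus by trivial.
eapply Rle_trans; [apply (CInt_bound _ a b (K * Cmod (w - z) ^ 2)); trivial|].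
- intros t Ht; apply ccont_minus; auto.
- intros t Ht; now apply HK.
- pose proof (Cmod_ge_0 (w - z)) as Hx. set (x := Cmod (w - z)) in *.
  assert (B * x <= eps).
  { apply Rlt_le. apply (Rmult_lt_compat_l B) in W2; trivial. replace (B * (eps / B)) with eps in W2 by (field; lra). trivial. }
  pose proof (Rle_abs K).
  assert (2 * (b - a) * K <= B).
  { unfold B. assert (2 * (b - a) * K <= 2 * (b - a) * Rabs K) by (apply Rmult_le_compat_l; lra). lra. }
  simpl. assert (2 * (b - a) * K * x <= B * x) by (apply Rmult_le_compat_r; trivial). nra.
Qed.

(** The density [phi] contains the differential of the path. [n = 1] is the Cauchy transform itself;
    [n = 2, 3] give its derivatives up to factorials. *)
Definition cauchy_transform (n : nat) (phi zeta : R -> C) (a b : R) (z : C) : C :=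
  CInt (fun t => phi t * Cpow (/ (zeta t - z)) n)%C a b.

Section CauchyTransform.
Context (phi zeta : R -> C) (a b : R) (Hab : a <= b).
Context (Hphi : ccont_on phi a b) (Hzeta : ccont_on zeta a b).

Lemma cauchy_transform_conton (n : nat) (z : C) :
  (forall t, a <= t <= b -> zeta t <> z) -> ccont_on (fun t => phi t * Cpow (/ (zeta t - z)) n)%C a b.
Proof.
intros Hz t Ht. apply ccont_mult; [now apply Hphi|].
apply ccont_pow, ccont_inv.
- apply ccont_minus; [now apply Hzeta|apply ccont_const].
- intros E; apply (Hz t Ht). replace (zeta t) with ((zeta t - z) + z)%C by ring. rewrite E; ring.
Qed.

Context (z : C) (r : R) (Hr : 0 < r) (Hfar : forall t, a <= t <= b -> r <= Cmod (zeta t - z)).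

Lemma cauchy_transform_near (w : C) (t : R) : Cmod (w - z) < r / 2 -> a <= t <= b -> r / 2 <= Cmod (zeta t - w).
Proof.
intros Hw Ht. pose proof (Cmod_dist_triangle (zeta t) w z). specialize (Hfar t Ht). lra.
Qed.

Lemma cauchy_transform_ne (w : C) (t : R) : Cmod (w - z) < r / 2 -> a <= t <= b -> zeta t <> w.
Proof.
intros Hw Ht E. pose proof (cauchy_transform_near w t Hw Ht) as H. rewrite E in H.
rewrite Cmod_diag in H; lra.
Qed.

(** The resolvent identity [q - p = (w - z) p q] for the two kernels. Applied repeatedly, it
    extracts the required powers of [w - z] from each remainder below. *)
Lemma cauchy_transform_aux (w : C) (t : R) : Cmod (w - z) < r / 2 -> a <= t <= b ->
  exists p q, (/ (zeta t - z))%C = p /\ (/ (zeta t - w))%C = q /\ (q - p = (w - z) * p * q)%C /\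
   Cmod p <= 2 / r /\ Cmod q <= 2 / r.
Proof.
intros Hw Ht. exists (/ (zeta t - z))%C, (/ (zeta t - w))%C.
assert (Z : Cmod (z - z) < r / 2) by (rewrite Cmod_diag; lra).
assert (N : forall v, Cmod (v - z) < r / 2 -> (zeta t - v)%C <> 0%C).
{ intros v Hv; apply Cmod_gt_0. pose proof (cauchy_transform_near v t Hv Ht); lra. }
assert (I : forall v, Cmod (v - z) < r / 2 -> Cmod (/ (zeta t - v)) <= 2 / r).
{ intros v Hv. rewrite Cmod_inv by auto. replace (2 / r) with (/ (r / 2)) by (field; lra).
  apply Rinv_le_contravar; [lra|now apply cauchy_transform_near]. }
repeat split; auto. field; split; auto.
Qed.

Lemma cauchy_transform1_derive : is_Cderive (cauchy_transform 1 phi zeta a b) z (cauchy_transform 2 phi zeta a b z).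
Proof.
destruct (ccont_on_bounded phi a b Hab Hphi) as [M [HM HMb]].
assert (Z : Cmod (z - z) < r / 2) by (rewrite Cmod_diag; lra).
apply (CInt_holo (fun t w => phi t * Cpow (/ (zeta t - w)) 1)%C _ a b z (r / 2) (M * (2 / r) ^ 3)); trivial; try lra.
- apply cauchy_transform_conton; intros t Ht; now apply cauchy_transform_ne.
- intros w Hw; apply cauchy_transform_conton; intros t Ht; now apply cauchy_transform_ne.
- intros t w Ht Hw. destruct (cauchy_transform_aux w t Hw Ht) as [p [q [-> [-> [E [Hp Hq]]]]]]. simpl.
  replace (phi t * (q * 1) - phi t * (p * 1) - (w - z) * (phi t * (p * (p * 1))))%C
    with (phi t * ((w - z) * (w - z) * (p * p * q)))%C.
  2:{ replace (phi t * (q * 1) - phi t * (p * 1) - (w - z) * (phi t * (p * (p * 1))))%C with (phi t * ((q - p) - (w - z) * p * p))%C by ring.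
      rewrite E. replace ((w - z) * p * q - (w - z) * p * p)%C with ((w - z) * p * (q - p))%C by ring. rewrite E; ring. }
  rewrite !Cmod_mult.
  specialize (HMb t Ht). pose proof (Cmod_ge_0 (w - z)); pose proof (Cmod_ge_0 p); pose proof (Cmod_ge_0 q); pose proof (Cmod_ge_0 (phi t)).
  assert (Cmod p * Cmod p * Cmod q <= (2 / r) * (2 / r) * (2 / r)).
  { apply Rmult_le_compat; trivial; [apply Rmult_le_pos; trivial|]. apply Rmult_le_compat; trivial. }
  assert (Cmod (phi t) * (Cmod p * Cmod p * Cmod q) <= M * ((2 / r) * (2 / r) * (2 / r))).
  { apply Rmult_le_compat; trivial. repeat apply Rmult_le_pos; trivial. }
  replace (Cmod (phi t) * (Cmod (w - z) * Cmod (w - z) * (Cmod p * Cmod p * Cmod q))) with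
    (Cmod (phi t) * (Cmod p * Cmod p * Cmod q) * (Cmod (w - z) * (Cmod (w - z) * 1))) by ring.
  replace (M * (2 / r * (2 / r * (2 / r * 1)))) with (M * ((2 / r) * (2 / r) * (2 / r))) by ring.
  apply Rmult_le_compat_r; trivial. nra.
Qed.

Lemma cauchy_transform2_derive : is_Cderive (cauchy_transform 2 phi zeta a b) z (2 * cauchy_transform 3 phi zeta a b z)%C.
Proof.
destruct (ccont_on_bounded phi a b Hab Hphi) as [M [HM HMb]].
assert (Z : Cmod (z - z) < r / 2) by (rewrite Cmod_diag; lra).
assert (C3 : ccont_on (fun t => phi t * Cpow (/ (zeta t - z)) 3)%C a b).
{ apply cauchy_transform_conton; intros t Ht; now apply cauchy_transform_ne. }
unfold cauchy_transform at 2; rewrite <- CInt_scal by trivial.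
apply (CInt_holo (fun t w => phi t * Cpow (/ (zeta t - w)) 2)%C _ a b z (r / 2) (M * (3 * (2 / r) ^ 4))); trivial; try lra.
- intros t Ht; apply ccont_mult; [apply ccont_const|now apply C3].
- intros w Hw; apply cauchy_transform_conton; intros t Ht; now apply cauchy_transform_ne.
- intros t w Ht Hw. destruct (cauchy_transform_aux w t Hw Ht) as [p [q [-> [-> [E [Hp Hq]]]]]]. simpl.
  replace (phi t * (q * (q * 1)) - phi t * (p * (p * 1)) - (w - z) * (2 * (phi t * (p * (p * (p * 1))))))%C
    with (phi t * ((w - z) * (w - z) * (p * p * q * (q + 2 * p))))%C.
  2:{ replace (phi t * (q * (q * 1)) - phi t * (p * (p * 1)) - (w - z) * (2 * (phi t * (p * (p * (p * 1))))))%C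
       with (phi t * ((q - p) * (q + p) - 2 * (w - z) * p * p * p))%C by ring.
      rewrite E. replace ((w - z) * p * q * (q + p) - 2 * (w - z) * p * p * p)%C with ((w - z) * p * ((q - p) * (q + 2 * p)))%C by ring. rewrite E; ring. }
  rewrite !Cmod_mult.
  specialize (HMb t Ht). pose proof (Cmod_ge_0 (w - z)); pose proof (Cmod_ge_0 p); pose proof (Cmod_ge_0 q); pose proof (Cmod_ge_0 (phi t)).
  assert (Q : Cmod (q + 2 * p) <= 3 * (2 / r)).
  { eapply Rle_trans; [apply Cmod_triangle|]. rewrite Cmod_mult, Cmod_R, Rabs_pos_eq by lra. lra. }
  pose proof (Cmod_ge_0 (q + 2 * p)).
  assert (Cmod p * Cmod p * Cmod q <= (2 / r) * (2 / r) * (2 / r)).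
  { apply Rmult_le_compat; trivial; [apply Rmult_le_pos; trivial|]. apply Rmult_le_compat; trivial. }
  assert (Cmod p * Cmod p * Cmod q * Cmod (q + 2 * p) <= (2 / r) * (2 / r) * (2 / r) * (3 * (2 / r))).
  { apply Rmult_le_compat; trivial. repeat apply Rmult_le_pos; trivial. }
  assert (Cmod (phi t) * (Cmod p * Cmod p * Cmod q * Cmod (q + 2 * p)) <= M * ((2 / r) * (2 / r) * (2 / r) * (3 * (2 / r)))).
  { apply Rmult_le_compat; trivial. repeat apply Rmult_le_pos; trivial. }
  replace (Cmod (phi t) * (Cmod (w - z) * Cmod (w - z) * (Cmod p * Cmod p * Cmod q * Cmod (q + 2 * p)))) with
    (Cmod (phi t) * (Cmod p * Cmod p * Cmod q * Cmod (q + 2 * p)) * (Cmod (w - z) * (Cmod (w - z) * 1))) by ring.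
  replace (M * (3 * (2 / r * (2 / r * (2 / r * (2 / r * 1)))))) with (M * ((2 / r) * (2 / r) * (2 / r) * (3 * (2 / r)))) by ring.
  apply Rmult_le_compat_r; trivial. nra.
Qed.

Lemma cauchy_transform3_cont : ccont (cauchy_transform 3 phi zeta a b) z.
Proof.
destruct (ccont_on_bounded phi a b Hab Hphi) as [M [HM HMb]].
assert (Z : Cmod (z - z) < r / 2) by (rewrite Cmod_diag; lra).
set (B := 2 * (b - a) * (M * (3 * (2 / r) ^ 4)) + 1).
assert (H2r : 0 < 2 / r) by (apply Rdiv_lt_0_compat; lra).
assert (HB : 0 < B).
{ unfold B. assert (0 <= 2 * (b - a) * (M * (3 * (2 / r) ^ 4))); [|lra].
  assert (0 < (2 / r) ^ 4) by (apply pow_lt; lra). repeat apply Rmult_le_pos; lra. }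
apply ccont_eps; intros eps He.
exists (Rmin (r / 2) (eps / B)); split; [apply Rmin_pos; [lra|now apply Rdiv_lt_0_compat]|].
intros w Hw.
assert (W1 := Rlt_le_trans _ _ _ Hw (Rmin_l _ _)).
assert (W2 := Rlt_le_trans _ _ _ Hw (Rmin_r _ _)).
assert (Cw : forall v, Cmod (v - z) < r / 2 -> ccont_on (fun t => phi t * Cpow (/ (zeta t - v)) 3)%C a b).
{ intros v Hv; apply cauchy_transform_conton; intros t Ht; now apply cauchy_transform_ne. }
unfold cauchy_transform; rewrite <- CInt_minus by auto.
apply Rle_lt_trans with (2 * (b - a) * (M * (3 * (2 / r) ^ 4) * Cmod (w - z))).
- apply CInt_bound; trivial.
  + intros t Ht; apply ccont_minus; apply Cw; trivial.
  + intros t Ht. destruct (cauchy_transform_aux w t W1 Ht) as [p [q [-> [-> [E [Hp Hq]]]]]]. simpl.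
    replace (phi t * (q * (q * (q * 1))) - phi t * (p * (p * (p * 1))))%C
      with (phi t * ((w - z) * (p * q * (q * q + q * p + p * p))))%C.
    2:{ replace (phi t * (q * (q * (q * 1))) - phi t * (p * (p * (p * 1))))%C with (phi t * ((q - p) * (q * q + q * p + p * p)))%C by ring. rewrite E; ring. }
    rewrite !Cmod_mult.
    specialize (HMb t Ht). pose proof (Cmod_ge_0 (w - z)); pose proof (Cmod_ge_0 p); pose proof (Cmod_ge_0 q); pose proof (Cmod_ge_0 (phi t)).
    assert (PP : forall x y, Cmod x <= 2 / r -> Cmod y <= 2 / r -> Cmod (x * y) <= 2 / r * (2 / r)).
    { intros x y Hx Hy; rewrite Cmod_mult; apply Rmult_le_compat; trivial; apply Cmod_ge_0. }
    assert (Q : Cmod (q * q + q * p + p * p) <= 3 * ((2 / r) * (2 / r))).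
    { eapply Rle_trans; [apply Cmod_triangle|].
      pose proof (Cmod_triangle (q * q) (q * p)). pose proof (PP q q Hq Hq). pose proof (PP q p Hq Hp). pose proof (PP p p Hp Hp). lra. }
    pose proof (Cmod_ge_0 (q * q + q * p + p * p)).
    assert (Cmod p * Cmod q <= (2 / r) * (2 / r)) by (apply Rmult_le_compat; trivial).
    assert (Cmod p * Cmod q * Cmod (q * q + q * p + p * p) <= (2 / r) * (2 / r) * (3 * ((2 / r) * (2 / r)))).
    { apply Rmult_le_compat; trivial. apply Rmult_le_pos; trivial. }
    assert (Cmod (phi t) * (Cmod p * Cmod q * Cmod (q * q + q * p + p * p)) <= M * ((2 / r) * (2 / r) * (3 * ((2 / r) * (2 / r))))).
    { apply Rmult_le_compat; trivial. repeat apply Rmult_le_pos; trivial. }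
    replace (Cmod (phi t) * (Cmod (w - z) * (Cmod p * Cmod q * Cmod (q * q + q * p + p * p)))) with
     (Cmod (phi t) * (Cmod p * Cmod q * Cmod (q * q + q * p + p * p)) * Cmod (w - z)) by ring.
    apply Rmult_le_compat_r; trivial.
    replace (M * (3 * (2 / r * (2 / r * (2 / r * (2 / r * 1)))))) with (M * (2 / r * (2 / r) * (3 * (2 / r * (2 / r))))) by ring. trivial.
- apply (Rmult_lt_compat_l B) in W2; trivial. replace (B * (eps / B)) with eps in W2 by (field; lra).
  replace (2 * (b - a) * (M * (3 * (2 / r) ^ 4) * Cmod (w - z))) with ((B - 1) * Cmod (w - z)) by (unfold B; ring).
  pose proof (Cmod_ge_0 (w - z)). lra.
Qed.
End CauchyTransform.

(** * Cauchy's formula on circles *)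

Lemma Ci_sqr : (Ci * Ci)%C = (- (1))%C.
Proof. unfold Ci, Cmult, Copp; simpl; f_equal; ring. Qed.

Definition eit (t : R) : C := (cos t, sin t).

Lemma Cmod_eit (t : R) : Cmod (eit t) = 1.
Proof.
unfold Cmod, eit; simpl. replace (cos t * (cos t * 1) + sin t * (sin t * 1)) with 1.
- apply sqrt_1.
- pose proof (sin2_cos2 t) as H; unfold Rsqr in H; lra.
Qed.

Lemma path_derive_eit (t : R) : path_derive eit t (Ci * eit t)%C.
Proof.
split; simpl.
- replace (0 * cos t - 1 * sin t) with (- sin t) by ring. apply is_derive_Reals, derivable_pt_lim_cos.
- replace (0 * sin t + 1 * cos t) with (cos t) by ring. apply is_derive_Reals, derivable_pt_lim_sin.
Qed.

Lemma eit_ne0 (t : R) : eit t <> 0%C.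
Proof. apply Cmod_gt_0; rewrite Cmod_eit; lra. Qed.

Lemma eit_2PI : eit (2 * PI) = eit 0.
Proof. unfold eit. rewrite cos_2PI, sin_2PI, cos_0, sin_0; trivial. Qed.

Definition circ (c : C) (r t : R) : C := (c + r * eit t)%C.

Lemma path_derive_circ (c : C) (r t : R) : path_derive (circ c r) t (Ci * (circ c r t - c))%C.
Proof.
unfold circ. eapply path_derive_eq; [apply (path_derive_plus (fun _ => c) (fun t => r * eit t)%C t 0%C (0 * eit t + r * (Ci * eit t))%C)|ring].
- apply path_derive_const.
- apply (path_derive_mult (fun _ => RtoC r) eit); [apply path_derive_const|apply path_derive_eit].
Qed.

Lemma circ_2PI (c : C) (r : R) : circ c r (2 * PI) = circ c r 0.
Proof. unfold circ; now rewrite eit_2PI. Qed.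

Lemma ccont_circ (c : C) (r t : R) : ccont (circ c r) t.
Proof. exact (path_derive_cont _ _ _ (path_derive_circ c r t)). Qed.

Lemma Cmod_circ (c : C) (r t : R) : 0 <= r -> Cmod (circ c r t - c) = r.
Proof.
intros Hr; unfold circ. replace (c + r * eit t - c)%C with (r * eit t)%C by ring.
rewrite Cmod_mult, Cmod_eit, Cmod_R, Rabs_pos_eq; lra.
Qed.

Section Circle.
Context (c : C) (r : R) (Hr : 0 < r).
Let w := circ c r.

Lemma PI2_pos : 0 <= 2 * PI.
Proof. pose proof PI_RGT_0; lra. Qed.

Lemma circ_far (z : C) (t : R) : Cmod (z - c) < r -> r - Cmod (z - c) <= Cmod (w t - z).
Proof.
intros Hz. pose proof (Cmod_dist_triangle (w t) z c) as H. unfold w in *; rewrite Cmod_circ in H by lra. lra.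
Qed.

Lemma circ_ne (z : C) (t : R) : Cmod (z - c) < r -> (w t - z)%C <> 0%C.
Proof. intros Hz; apply Cmod_gt_0. pose proof (circ_far z t Hz); lra. Qed.

(** The derivative in [z] is the integral of the exact derivative of [i / (w t - z)] over a closed
    path, hence zero; so the value is that at the centre. The density lacks the factor [i] of
    [dw = i (w - c) dt], whence [2 PI] and not [2 PI i]. *)
Lemma circ_index (z : C) : Cmod (z - c) < r ->
  cauchy_transform 1 (fun t => w t - c)%C w 0 (2 * PI) z = (2 * PI)%R.
Proof.
intros Hz.
assert (Cphi : ccont_on (fun t => w t - c)%C 0 (2 * PI)).
{ intros t _; apply ccont_minus; [apply ccont_circ|apply ccont_const]. }
assert (Cw : ccont_on w 0 (2 * PI)) by (intros t _; apply ccont_circ).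
assert (D : forall v, Cmod (v - c) < r -> is_Cderive (cauchy_transform 1 (fun t => w t - c)%C w 0 (2 * PI)) v 0%C).
{ intros v Hv.
  eapply is_Cderive_eq; [apply (cauchy_transform1_derive _ _ _ _ PI2_pos Cphi Cw v (r - Cmod (v - c)))|].
  - lra.
  - intros t _; now apply circ_far.
  - unfold cauchy_transform.
    rewrite (CInt_FTC (fun t => Ci * / (w t - v))%C).
    + unfold w; rewrite circ_2PI; ring.
    + apply PI2_pos.
    + intros t _.
      eapply path_derive_eq; [apply (path_derive_mult (fun _ => Ci) (fun t => / (w t - v))%C); [apply path_derive_const|]|].
      * apply (path_derive_comp Cinv (fun t => w t - v)%C).
        -- apply is_Cderive_inv, circ_ne, Hv.
        -- apply (path_derive_plus w (fun _ => - v)%C); [apply path_derive_circ|apply path_derive_const].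
      * fold w. simpl. set (q := (w t - v)%C).
        assert (q <> 0%C) by now apply circ_ne.
        transitivity (- (Ci * Ci) * (w t - c) * / (q * q))%C; [field; trivial|].
        rewrite Ci_sqr.
        field; trivial.
    + intros t Ht. apply cauchy_transform_conton with (a := 0) (b := 2 * PI); trivial.
      intros s _ E. apply (circ_ne v s Hv). rewrite E; ring. }
assert (E : cauchy_transform 1 (fun t => w t - c)%C w 0 (2 * PI) c = (2 * PI)%R).
{ unfold cauchy_transform. rewrite (CInt_ext _ (fun _ => 1%C)).
  - rewrite CInt_const. rewrite Rminus_0_r; ring.
  - apply PI2_pos.
  - intros t _. simpl. field. apply circ_ne.
    now rewrite Cmod_diag. }
rewrite <- E.
assert (B : Cmod (cauchy_transform 1 (fun t => w t - c)%C w 0 (2 * PI) z - cauchy_transform 1 (fun t => w t - c)%C w 0 (2 * PI) c) <= 2 * 0 * Cmod (z - c)).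
{ apply (is_Cderive_mvt _ (fun _ => 0%C)). intros t Ht; split; [apply D|rewrite Cmod_0; lra].
  replace (c + t * (z - c) - c)%C with (t * (z - c))%C by ring.
  rewrite Cmod_mult, Cmod_R, Rabs_pos_eq by lra. pose proof (Cmod_ge_0 (z - c)). nra. }
assert (Z : (cauchy_transform 1 (fun t => w t - c)%C w 0 (2 * PI) z - cauchy_transform 1 (fun t => w t - c)%C w 0 (2 * PI) c)%C = 0%C).
{ apply Cmod_eq_0, Rle_antisym; [lra|apply Cmod_ge_0]. }
rewrite <- (Cplus_0_l (cauchy_transform 1 _ _ _ _ c)), <- Z. ring.
Qed.

Context (r' : R) (Hr' : r < r') (f f' : C -> C) (Hf : holo (fun z => Cmod (z - c) < r') f f').

(* Contracting the circle to [z]: the integral of [f (z + s (w - z))] against the Cauchy kernel does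
   not depend on [s], since its derivative in [s] is the integral of an exact derivative in [t]. *)
Lemma cauchy_homotopy (z : C) : Cmod (z - c) < r ->
  CInt (fun t => f (w t) * ((w t - c) * / (w t - z)))%C 0 (2 * PI) =
  (f z * CInt (fun t => (w t - c) * / (w t - z))%C 0 (2 * PI))%C.
Proof.
intros Hz.
set (q := fun t => ((w t - c) * / (w t - z))%C).
assert (Cq : ccont_on q 0 (2 * PI)).
{ intros t _; apply ccont_mult.
  - apply ccont_minus; [apply ccont_circ|apply ccont_const].
  - apply ccont_inv; [apply ccont_minus; [apply ccont_circ|apply ccont_const]|now apply circ_ne]. }
set (Phi := fun s t : R => (f (z + s * (w t - z)) * q t)%C).
set (Psi := fun s t : R => (f' (z + s * (w t - z)) * (w t - c))%C).
(* Moving [s] by less than [eta] moves the point by less than [2 r eta], so it stays in the disc of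
   radius [r'] even when [s] leaves [[0, 1]]. *)
set (eta := Rmin 1 ((r' - r) / (2 * r))).
assert (Heta : 0 < eta) by (apply Rmin_pos; [lra|apply Rdiv_lt_0_compat; lra]).
assert (Heta2 : eta * (2 * r) <= r' - r).
{ replace (r' - r) with ((r' - r) / (2 * r) * (2 * r)) by (field; lra).
  apply Rmult_le_compat_r; [lra|apply Rmin_r]. }
assert (Hin : forall x s t : R, 0 <= x <= 1 -> Rabs (s - x) < eta -> Cmod (z + s * (w t - z) - c) < r').
{ intros x s t Hx Hs.
  replace (z + s * (w t - z) - c)%C with ((z + x * (w t - z) - c) + (s - x)%R * (w t - z))%C by (rewrite RtoC_minus; ring).
  eapply Rle_lt_trans; [apply Cmod_triangle|].
  replace (z + x * (w t - z) - c)%C with ((1 - x)%R * (z - c) + x * (w t - c))%C by (rewrite RtoC_minus; ring).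
  assert (A := Cmod_triangle ((1 - x)%R * (z - c)) (x * (w t - c))).
  rewrite !Cmod_mult, !Cmod_R in *. unfold w in A at 2; rewrite Cmod_circ in A by lra. fold w in A.
  rewrite (Rabs_pos_eq (1 - x)), (Rabs_pos_eq x) in A by lra.
  assert (B : Cmod (w t - z) < 2 * r).
  { eapply Rle_lt_trans; [apply (Cmod_dist_triangle _ c)|]. unfold w; rewrite Cmod_circ by lra. rewrite (Cmod_sub_sym c z). lra. }
  pose proof (Cmod_ge_0 (w t - z)). pose proof (Rabs_pos (s - x)). pose proof (Cmod_ge_0 (z - c)).
  assert (Rabs (s - x) * Cmod (w t - z) < eta * (2 * r)) by (apply Rmult_le_0_lt_compat; trivial).
  nra. }
assert (Cz : forall (s0 t0 : R), @continuous (prod_UniformSpace R_UniformSpace R_UniformSpace) C_UniformSpace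
   (fun p : R * R => z + (fst p) * (w (snd p) - z))%C (s0, t0)).
{ intros s0 t0. apply ccont_plus; [apply ccont_const|].
  apply ccont_mult; [apply ccont_RtoC, continuous_fst|].
  apply ccont_minus; [|apply ccont_const].
  apply (continuous_comp (fun p : R * R => snd p) w); [apply continuous_snd|apply ccont_circ]. }
assert (Hd : forall x s t : R, 0 <= x <= 1 -> Rabs (s - x) < eta -> path_derive (fun s => Phi s t) s (Psi s t)).
{ intros x s t Hx Hs; unfold Phi, Psi.
  eapply path_derive_eq; [apply (path_derive_mult (fun s : R => f (z + s * (w t - z)))%C (fun _ => q t)); [|apply path_derive_const]|].
  - apply (path_derive_comp f (fun s : R => z + s * (w t - z))%C); [|apply path_derive_affine]. apply Hf. now apply (Hin x).
  - unfold q. field. now apply circ_ne. }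
assert (HR : forall x, 0 <= x <= 1 -> path_derive (fun s => CInt (Phi s) 0 (2 * PI)) x (CInt (Psi x) 0 (2 * PI))).
{ intros x Hx.
  assert (X0 : Rabs (x - x) < eta) by (rewrite Rminus_diag, Rabs_R0; trivial).
  apply (CInt_param Phi Psi 0 (2 * PI) x eta); [apply PI2_pos|trivial|..].
  - intros s t Hs _; now apply (Hd x).
  - intros t _; exists (mkposreal _ Heta). intros [p q'] [Hp _]; simpl in *. apply (Hd x); trivial.
  - intros t _; unfold Psi; apply ccont_mult.
    + apply (continuous_comp (fun p : R * R => z + fst p * (w (snd p) - z))%C f'); [apply Cz|].
      apply Hf, (Hin x); trivial.
    + apply ccont_minus; [|apply ccont_const].
      apply (continuous_comp (fun p : R * R => snd p) w); [apply continuous_snd|apply ccont_circ].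
  - intros s Hs t Ht; unfold Phi; apply ccont_mult; [|now apply Cq].
    apply (continuous_comp (fun t => z + s * (w t - z))%C f).
    + apply ccont_plus; [apply ccont_const|]. apply ccont_mult; [apply ccont_const|].
      apply ccont_minus; [apply ccont_circ|apply ccont_const].
    + apply (holo_cont _ f f' _ Hf), (Hin x); trivial. }
assert (Z0 : CInt (fun t => w t - c)%C 0 (2 * PI) = 0%C).
{ rewrite (CInt_FTC (fun t => - Ci * (w t - c))%C).
  - unfold w; rewrite circ_2PI; ring.
  - apply PI2_pos.
  - intros t _. eapply path_derive_eq; [apply (path_derive_mult (fun _ => - Ci)%C (fun t => w t - c)%C); [apply path_derive_const|]|].
    + apply (path_derive_plus w (fun _ => - c)%C); [apply path_derive_circ|apply path_derive_const].
    + fold w. transitivity (- (Ci * Ci) * (w t - c))%C; [ring|].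
      rewrite Ci_sqr. ring.
  - intros t _; apply ccont_minus; [apply ccont_circ|apply ccont_const]. }
assert (Z : forall x, 0 <= x <= 1 -> CInt (Psi x) 0 (2 * PI) = 0%C).
{ intros x Hx.
  assert (X0 : Rabs (x - x) < eta) by (rewrite Rminus_diag, Rabs_R0; trivial).
  (* The primitive in [t] carries a factor [1 / x]. At [x = 0] the integrand is [f' z (w t - c)]
     instead, whose integral is zero by [Z0]. *)
  destruct (Req_dec x 0) as [->|Hx0].
  - rewrite (CInt_ext _ (fun t => f' z * (w t - c))%C).
    + rewrite CInt_scal, Z0; [ring|apply PI2_pos|].
      intros t _; apply ccont_minus; [apply ccont_circ|apply ccont_const].
    + apply PI2_pos.
    + intros t _; unfold Psi. replace (z + 0 * (w t - z))%C with z by ring; trivial.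
  - rewrite (CInt_FTC (fun t => (- Ci * / x) * f (z + x * (w t - z)))%C).
    + unfold w; rewrite circ_2PI; ring.
    + apply PI2_pos.
    + intros t _. eapply path_derive_eq; [apply (path_derive_mult (fun _ => - Ci * / x)%C (fun t => f (z + x * (w t - z)))%C); [apply path_derive_const|]|].
      * apply (path_derive_comp f (fun t => z + x * (w t - z))%C).
        -- apply Hf. now apply (Hin x).
        -- apply (path_derive_plus (fun _ => z) (fun t => x * (w t - z))%C); [apply path_derive_const|].
           apply (path_derive_mult (fun _ => RtoC x) (fun t => w t - z)%C); [apply path_derive_const|].
           apply (path_derive_plus w (fun _ => - z)%C); [apply path_derive_circ|apply path_derive_const].
      * fold w. unfold Psi.
        transitivity (- (Ci * Ci) * (f' (z + x * (w t - z)) * (w t - c)))%C.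
        -- field. intros E; apply Hx0. now apply RtoC_inj.
        -- rewrite Ci_sqr. ring.
    + intros t _; unfold Psi; apply ccont_mult.
      * apply (continuous_comp (fun t => z + x * (w t - z))%C f').
        -- apply ccont_plus; [apply ccont_const|]. apply ccont_mult; [apply ccont_const|].
           apply ccont_minus; [apply ccont_circ|apply ccont_const].
        -- apply Hf, (Hin x); trivial.
      * apply ccont_minus; [apply ccont_circ|apply ccont_const]. }
assert (B := path_derive_mvt (fun s => CInt (Phi s) 0 (2 * PI)) (fun _ => 0%C) 0 1 0 Rle_0_1).
cbv beta in B.
assert (E : (CInt (Phi 1) 0 (2 * PI) - CInt (Phi 0) 0 (2 * PI))%C = 0%C).
{ apply Cmod_eq_0, Rle_antisym; [|apply Cmod_ge_0].
  eapply Rle_trans; [apply B|lra].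
  intros t Ht; split; [|rewrite Cmod_0; lra]. apply (path_derive_eq _ _ _ _ (HR t Ht)), Z, Ht. }
assert (E1 : CInt (Phi 1) 0 (2 * PI) = CInt (fun t => f (w t) * q t)%C 0 (2 * PI)).
{ apply CInt_ext; [apply PI2_pos|]. intros t _; unfold Phi. replace (z + 1 * (w t - z))%C with (w t) by ring; trivial. }
assert (E0 : CInt (Phi 0) 0 (2 * PI) = (f z * CInt q 0 (2 * PI))%C).
{ rewrite <- CInt_scal; [|apply PI2_pos|trivial].
  apply CInt_ext; [apply PI2_pos|]. intros t _; unfold Phi. replace (z + 0 * (w t - z))%C with z by ring; trivial. }
transitivity (CInt (Phi 1) 0 (2 * PI)); [now symmetry|].
transitivity (CInt (Phi 0) 0 (2 * PI)); [|exact E0].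
rewrite <- (Cplus_0_l (CInt (Phi 0) _ _)), <- E. ring.
Qed.

(** This is [f(w) dw / (2 PI i)] with [dw = i (w - c) dt]. *)
Definition cauchy_density (t : R) : C := (f (w t) * (w t - c) * / (2 * PI)%R)%C.

Lemma circ_in (t : R) : Cmod (w t - c) < r'.
Proof. unfold w; rewrite Cmod_circ; lra. Qed.

Lemma cauchy_density_cont : ccont_on cauchy_density 0 (2 * PI).
Proof.
intros t _; apply ccont_mult; [|apply ccont_const]. apply ccont_mult.
- apply (continuous_comp w f); [apply ccont_circ|].
  apply (holo_cont _ f f' _ Hf), circ_in.
- apply ccont_minus; [apply ccont_circ|apply ccont_const].
Qed.

Lemma two_PI_ne : RtoC (2 * PI)%R <> 0%C.
Proof. intros E; apply RtoC_inj in E; pose proof PI_RGT_0; lra. Qed.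

Lemma cauchy_formula (z : C) : Cmod (z - c) < r -> f z = cauchy_transform 1 cauchy_density w 0 (2 * PI) z.
Proof.
intros Hz.
assert (H := cauchy_homotopy z Hz).
assert (I := circ_index z Hz). unfold cauchy_transform in I.
rewrite (CInt_ext _ (fun t => (w t - c) * / (w t - z))%C) in I by (try apply PI2_pos; intros; simpl; ring).
rewrite I in H.
unfold cauchy_transform.
rewrite (CInt_ext _ (fun t => / (2 * PI)%R * (f (w t) * ((w t - c) * / (w t - z))))%C).
- rewrite CInt_scal, H; [field; apply two_PI_ne|apply PI2_pos|].
  intros t _; apply ccont_mult.
  + apply (continuous_comp w f); [apply ccont_circ|].
    apply (holo_cont _ f f' _ Hf), circ_in.
  + apply ccont_mult.
    * apply ccont_minus; [apply ccont_circ|apply ccont_const].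
    * apply ccont_inv; [apply ccont_minus; [apply ccont_circ|apply ccont_const]|now apply circ_ne].
- apply PI2_pos.
- intros t _; unfold cauchy_density; simpl. field. split; [now apply circ_ne|apply two_PI_ne].
Qed.

Lemma ball_shrink (z : C) : Cmod (z - c) < r -> exists d, 0 < d /\ forall v, Cmod (v - z) < d -> Cmod (v - c) < r.
Proof.
intros Hz; exists (r - Cmod (z - c)); split; [lra|]; intros v Hv.
pose proof (Cmod_dist_triangle v z c); lra.
Qed.

Lemma cauchy_formula_derive (z : C) : Cmod (z - c) < r -> f' z = cauchy_transform 2 cauchy_density w 0 (2 * PI) z.
Proof.
intros Hz.
assert (Cw : ccont_on w 0 (2 * PI)) by (intros t _; apply ccont_circ).
apply (is_Cderive_unique f z); [apply Hf; lra|].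
destruct (ball_shrink z Hz) as [d [Hd Hb]].
apply (is_Cderive_ext_loc (cauchy_transform 1 cauchy_density w 0 (2 * PI)) f z _ d); trivial.
- intros v Hv; symmetry; apply cauchy_formula; auto.
- apply (cauchy_transform1_derive _ _ _ _ PI2_pos cauchy_density_cont Cw z (r - Cmod (z - c))); [lra|].
  intros t _; now apply circ_far.
Qed.

Lemma cauchy_derive_derive (z : C) : Cmod (z - c) < r ->
  is_Cderive f' z (2 * cauchy_transform 3 cauchy_density w 0 (2 * PI) z)%C.
Proof.
intros Hz.
assert (Cw : ccont_on w 0 (2 * PI)) by (intros t _; apply ccont_circ).
destruct (ball_shrink z Hz) as [d [Hd Hb]].
apply (is_Cderive_ext_loc (cauchy_transform 2 cauchy_density w 0 (2 * PI)) f' z _ d); trivial.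
- intros v Hv; symmetry; apply cauchy_formula_derive; auto.
- apply (cauchy_transform2_derive _ _ _ _ PI2_pos cauchy_density_cont Cw z (r - Cmod (z - c))); [lra|].
  intros t _; now apply circ_far.
Qed.

Lemma cauchy_derive_derive_cont (z : C) : Cmod (z - c) < r -> ccont (C_derive f') z.
Proof.
intros Hz.
assert (Cw : ccont_on w 0 (2 * PI)) by (intros t _; apply ccont_circ).
destruct (ball_shrink z Hz) as [d [Hd Hb]].
apply (ccont_ext_loc (fun v => 2 * cauchy_transform 3 cauchy_density w 0 (2 * PI) v)%C _ z d); trivial.
- intros v Hv; symmetry; apply is_C_derive_unique, is_Cderive_iff, cauchy_derive_derive; auto.
- apply ccont_mult; [apply ccont_const|].
  apply (cauchy_transform3_cont _ _ _ _ PI2_pos cauchy_density_cont Cw z (r - Cmod (z - c))); [lra|].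
  intros t _; now apply circ_far.
Qed.

Lemma mean_value : CInt (fun t => f (w t)) 0 (2 * PI) = ((2 * PI)%R * f c)%C.
Proof.
assert (Hc : Cmod (c - c) < r) by (now rewrite Cmod_diag).
assert (H := cauchy_homotopy c Hc).
rewrite (CInt_ext (fun t => (w t - c) * / (w t - c))%C (fun _ => 1%C)) in H.
- rewrite CInt_const, Rminus_0_r in H.
  rewrite (CInt_ext _ (fun t => f (w t) * ((w t - c) * / (w t - c)))%C).
  + rewrite H; ring.
  + apply PI2_pos.
  + intros t _; field; now apply circ_ne.
- apply PI2_pos.
- intros t _; field; now apply circ_ne.
Qed.

(** Cauchy's formula for [f'] at the centre, where the kernel [1 / (w - c)] is [Cconj (eit t) / r]:
    a Fourier coefficient of [f]. *)
Lemma mean_derive : CInt (fun t => f (w t) * Cconj (eit t))%C 0 (2 * PI) = ((2 * PI * r)%R * f' c)%C.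
Proof.
assert (Hc : Cmod (c - c) < r) by (now rewrite Cmod_diag).
rewrite (cauchy_formula_derive c Hc). unfold cauchy_transform.
assert (C2 : ccont_on (fun t => cauchy_density t * Cpow (/ (w t - c)) 2)%C 0 (2 * PI)).
{ apply cauchy_transform_conton; [apply cauchy_density_cont|intros t _; apply ccont_circ|].
  intros t _ E. apply (circ_ne c t Hc). rewrite E; ring. }
rewrite <- CInt_scal by (trivial; apply PI2_pos).
apply CInt_ext; [apply PI2_pos|]. intros t _.
unfold cauchy_density, w, circ; simpl.
replace (c + r * eit t - c)%C with (r * eit t)%C by ring.
assert (N : (eit t * Cconj (eit t))%C = 1%C).
{ unfold eit, Cconj, Cmult, RtoC; simpl. pose proof (sin2_cos2 t) as Hs; unfold Rsqr in Hs. f_equal; [lra|ring]. }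
assert (Q : Cconj (eit t) = (/ eit t)%C).
{ apply (f_equal (Cmult (/ eit t))) in N. rewrite Cmult_assoc, Cinv_l, Cmult_1_l, Cmult_1_r in N; trivial. apply eit_ne0. }
rewrite Q. rewrite RtoC_mult. field.
repeat split; try apply two_PI_ne; try apply eit_ne0.
intros E; apply RtoC_inj in E; lra.
Qed.
End Circle.

(** The mean value property of [f z (z - c)], which vanishes at the centre. *)
Lemma mean_conj (c : C) (r r' : R) (f f' : C -> C) : 0 < r -> r < r' ->
  holo (fun z => Cmod (z - c) < r') f f' ->
  CInt (fun t => f (circ c r t) * eit t)%C 0 (2 * PI) = 0%C.
Proof.
intros Hr Hr' Hf.
assert (Hg : holo (fun z => Cmod (z - c) < r') (fun z => f z * (z - c))%C (fun z => f' z * (z - c) + f z * 1)%C).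
{ intros z Hz; destruct (Hf z Hz) as [H1 H2]; split.
  - apply (is_Cderive_mult f (fun z => z - c)%C); trivial.
    eapply is_Cderive_eq; [apply (is_Cderive_plus (fun z => z) (fun _ => - c)%C); [apply is_Cderive_id|apply is_Cderive_const]|ring].
  - apply ccont_plus; apply ccont_mult; trivial.
    + apply ccont_minus; [apply ccont_id|apply ccont_const].
    + exact (is_Cderive_cont _ _ _ H1).
    + apply ccont_const. }
assert (M := mean_value c r Hr r' Hr' _ _ Hg).
cbv beta in M. replace ((2 * PI)%R * (f c * (c - c)))%C with (RtoC 0) in M by ring.
rewrite (CInt_ext _ (fun t => / r * (f (circ c r t) * (circ c r t - c)))%C).
- rewrite CInt_scal; [rewrite M; ring|pose proof PI_RGT_0; lra|].
  intros t _; apply ccont_mult.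
  + apply (continuous_comp (circ c r) f); [apply ccont_circ|].
    apply (holo_cont _ f f' _ Hf). rewrite Cmod_circ; lra.
  + apply ccont_minus; [apply ccont_circ|apply ccont_const].
- pose proof PI_RGT_0; lra.
- intros t _; unfold circ. field. intros E; apply RtoC_inj in E; lra.
Qed.

Lemma holo_derive (U : C -> Prop) (f f' : C -> C) : openC U -> holo U f f' -> holo U f' (C_derive f').
Proof.
intros HO Hf z Hz.
destruct (HO z Hz) as [r' [Hr' Hb]].
assert (Hf2 : holo (fun w => Cmod (w - z) < r') f f') by (now apply (holo_sub U)).
assert (Hzz : Cmod (z - z) < r' / 2) by (rewrite Cmod_diag; lra).
assert (H2 : 0 < r' / 2) by lra. assert (H3 : r' / 2 < r') by lra.
split.
- assert (D := cauchy_derive_derive z (r' / 2) H2 r' H3 f f' Hf2 z Hzz).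
  assert (E := proj1 (is_Cderive_iff _ _ _) D).
  now rewrite (is_C_derive_unique _ _ _ E).
- exact (cauchy_derive_derive_cont z (r' / 2) H2 r' H3 f f' Hf2 z Hzz).
Qed.

(* Adding the conjugate of the vanishing mean of [f e^(it)] to the formula for the derivative
   leaves only the real part of [f] in the integrand. *)
Lemma derive_bound_Re (c : C) (r r' M : R) (f f' : C -> C) : 0 < r -> r < r' ->
  holo (fun z => Cmod (z - c) < r') f f' ->
  (forall z, Cmod (z - c) < r' -> Re (f z) <= M) ->
  Cmod (f' c) <= 4 / r * (M - Re (f c)).
Proof.
intros Hr Hr' Hf HM.
assert (M0 := mean_value c r Hr r' Hr' f f' Hf).
assert (M1 := mean_derive c r Hr r' Hr' f f' Hf).
assert (M2 := mean_conj c r r' f f' Hr Hr' Hf).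
pose proof PI_RGT_0 as HPI.
assert (P2 : 0 <= 2 * PI) by lra.
set (u := fun t => Re (f (circ c r t))).
set (v := fun t => Im (f (circ c r t))).
assert (Cf : ccont_on (fun t => f (circ c r t)) 0 (2 * PI)).
{ intros t _; apply (continuous_comp (circ c r) f); [apply ccont_circ|].
  apply (holo_cont _ f f' _ Hf). rewrite Cmod_circ; lra. }
assert (Cu : forall t, 0 <= t <= 2 * PI -> continuous u t) by (intros t Ht; now apply (ccont_Re (fun t => f (circ c r t))), Cf).
assert (Cv : forall t, 0 <= t <= 2 * PI -> continuous v t) by (intros t Ht; now apply (ccont_Im (fun t => f (circ c r t))), Cf).
assert (Ccos : forall t, continuous cos t) by (intros t; apply continuity_pt_filterlim, continuity_cos).
assert (Csin : forall t, continuous sin t) by (intros t; apply continuity_pt_filterlim, continuity_sin).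
assert (Ex : forall g h : R -> R, (forall t, 0 <= t <= 2 * PI -> continuous g t) -> (forall t, continuous h t) ->
   ex_RInt (fun t => g t * h t) 0 (2 * PI)).
{ intros g h Hg Hh; apply (ex_RInt_continuous (V := R_CompleteNormedModule)); intros t Ht.
  rewrite Rmin_left, Rmax_right in Ht by lra.
  apply (continuous_mult (K := R_AbsRing) g h); auto. }
assert (E1 : RInt (fun t => u t * cos t) 0 (2 * PI) + RInt (fun t => v t * sin t) 0 (2 * PI) = 2 * PI * r * Re (f' c)).
{ rewrite <- (RInt_plus (V := R_CompleteNormedModule) (fun t => u t * cos t) (fun t => v t * sin t)) by auto.
  apply (f_equal Re) in M1. unfold CInt in M1; simpl in M1. rewrite Rmult_0_l, Rminus_0_r in M1.
  eapply eq_trans; [|exact M1]. apply RInt_ext. intros t _. unfold plus; simpl. unfold u, v, Re, Im; ring. }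
assert (E2 : RInt (fun t => v t * cos t) 0 (2 * PI) - RInt (fun t => u t * sin t) 0 (2 * PI) = 2 * PI * r * Im (f' c)).
{ rewrite <- (RInt_minus (V := R_CompleteNormedModule) (fun t => v t * cos t) (fun t => u t * sin t)) by auto.
  apply (f_equal Im) in M1. unfold CInt in M1; simpl in M1. rewrite Rmult_0_l, Rplus_0_r in M1.
  eapply eq_trans; [|exact M1]. apply RInt_ext. intros t _. unfold minus, plus, opp; simpl. unfold u, v, Re, Im; ring. }
assert (E3 : RInt (fun t => u t * cos t) 0 (2 * PI) - RInt (fun t => v t * sin t) 0 (2 * PI) = 0).
{ rewrite <- (RInt_minus (V := R_CompleteNormedModule) (fun t => u t * cos t) (fun t => v t * sin t)) by auto.
  apply (f_equal Re) in M2. unfold CInt in M2; simpl in M2.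
  eapply eq_trans; [|exact M2]. apply RInt_ext. intros t _. unfold minus, plus, opp; simpl. unfold u, v, Re, Im; ring. }
assert (E4 : RInt (fun t => v t * cos t) 0 (2 * PI) + RInt (fun t => u t * sin t) 0 (2 * PI) = 0).
{ rewrite <- (RInt_plus (V := R_CompleteNormedModule) (fun t => v t * cos t) (fun t => u t * sin t)) by auto.
  apply (f_equal Im) in M2. unfold CInt in M2; simpl in M2.
  eapply eq_trans; [|exact M2]. apply RInt_ext. intros t _. unfold plus; simpl. unfold u, v, Re, Im; ring. }
assert (E0 : RInt u 0 (2 * PI) = 2 * PI * Re (f c)).
{ apply (f_equal Re) in M0. unfold CInt in M0; simpl in M0. rewrite Rmult_0_l, Rminus_0_r in M0. exact M0. }
(* [M - u] is nonnegative with mean [M - Re (f c)]. Since [cos] and [sin] have mean zero, it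
   replaces [u] in the integrals up to sign, and its own integral then bounds them. *)
set (g := fun t => M - u t).
assert (Cg : forall t, 0 <= t <= 2 * PI -> continuous g t).
{ intros t Ht; apply (continuous_minus (fun _ => M) u); [apply continuous_const|auto]. }
assert (Eg : RInt g 0 (2 * PI) = 2 * PI * (M - Re (f c))).
{ unfold g. rewrite (RInt_minus (V := R_CompleteNormedModule) (fun _ => M) u).
  - rewrite E0, RInt_const. unfold minus, plus, opp, scal; simpl. unfold mult; simpl. ring.
  - apply ex_RInt_const.
  - apply (ex_RInt_continuous (V := R_CompleteNormedModule)); intros t Ht. rewrite Rmin_left, Rmax_right in Ht by lra. auto. }
assert (Gb : forall h, (forall t, continuous h t) -> RInt h 0 (2 * PI) = 0 -> (forall t, -1 <= h t <= 1) ->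
   Rabs (RInt (fun t => u t * h t) 0 (2 * PI)) <= 2 * PI * (M - Re (f c))).
{ intros h Ch Ih Bh.
  replace (RInt (fun t => u t * h t) 0 (2 * PI)) with (- RInt (fun t => g t * h t) 0 (2 * PI)).
  - rewrite Rabs_Ropp. eapply Rle_trans; [apply abs_RInt_le; auto|].
    rewrite <- Eg. apply RInt_le; trivial.
    + apply (ex_RInt_continuous (V := R_CompleteNormedModule)); intros t Ht. rewrite Rmin_left, Rmax_right in Ht by lra.
      apply (continuous_comp (fun t => g t * h t) Rabs); [|apply continuous_Rabs].
      apply (continuous_mult (K := R_AbsRing) g h); auto.
    + apply (ex_RInt_continuous (V := R_CompleteNormedModule)); intros t Ht. rewrite Rmin_left, Rmax_right in Ht by lra. auto.
    + intros t Ht. assert (0 <= g t).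
      { unfold g, u. assert (Re (f (circ c r t)) <= M); [|lra]. apply HM. rewrite Cmod_circ; lra. }
      rewrite Rabs_mult, (Rabs_pos_eq (g t)) by trivial.
      assert (Rabs (h t) <= 1) by (apply Rabs_le, Bh). pose proof (Rabs_pos (h t)). nra.
  - rewrite (RInt_ext (fun t => g t * h t) (fun t => minus (scal M (h t)) (u t * h t))).
    + assert (Eh : ex_RInt h 0 (2 * PI)).
      { apply (ex_RInt_continuous (V := R_CompleteNormedModule)); auto. }
      rewrite (RInt_minus (V := R_CompleteNormedModule) (fun t => scal M (h t)) (fun t => u t * h t)).
      * rewrite RInt_scal by trivial. rewrite Ih. unfold minus, plus, opp, scal; simpl. unfold mult; simpl. ring.
      * now apply (ex_RInt_scal (V := R_CompleteNormedModule)).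
      * auto.
    + intros t _. unfold g, minus, plus, opp, scal; simpl. unfold mult; simpl. ring. }
assert (Ic : RInt cos 0 (2 * PI) = 0).
{ apply is_RInt_unique. replace 0 with (minus (sin (2 * PI)) (sin 0)) at 2.
  - apply (is_RInt_derive sin cos); intros t _; trivial. apply is_derive_Reals, derivable_pt_lim_sin.
  - rewrite sin_2PI, sin_0. unfold minus, plus, opp; simpl. ring. }
assert (Is : RInt sin 0 (2 * PI) = 0).
{ apply is_RInt_unique. replace 0 with (minus (- cos (2 * PI)) (- cos 0)) at 2.
  - apply (is_RInt_derive (fun t => - cos t) sin); intros t _; trivial.
    rewrite <- (Ropp_involutive (sin t)). apply (is_derive_opp cos), is_derive_Reals, derivable_pt_lim_cos.
  - rewrite cos_2PI, cos_0. unfold minus, plus, opp; simpl. ring. }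
assert (G1 := Gb cos Ccos Ic COS_bound).
assert (G2 := Gb sin Csin Is SIN_bound).
apply Rmult_le_reg_l with (2 * PI * r); [apply Rmult_lt_0_compat; lra|].
replace (2 * PI * r * (4 / r * (M - Re (f c)))) with (4 * (2 * PI * (M - Re (f c)))) by (field; lra).
assert (P3 : 0 <= 2 * PI * r) by (apply Rmult_le_pos; lra).
eapply Rle_trans; [apply Rmult_le_compat_l; [trivial|apply Cmod_le_Re_Im]|].
rewrite Rmult_plus_distr_l. rewrite <- (Rabs_pos_eq (2 * PI * r)) by trivial.
rewrite <- !Rabs_mult, <- E1, <- E2.
(* By the vanishing mean, each of the real and the imaginary part of [f' c] is twice an integral of
   [u]. The two parts together give the factor 4. *)
replace (RInt (fun t => v t * sin t) 0 (2 * PI)) with (RInt (fun t => u t * cos t) 0 (2 * PI)) by lra.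
replace (RInt (fun t => v t * cos t) 0 (2 * PI)) with (- RInt (fun t => u t * sin t) 0 (2 * PI)) by lra.
pose proof (Rabs_triang (RInt (fun t => u t * cos t) 0 (2 * PI)) (RInt (fun t => u t * cos t) 0 (2 * PI))).
pose proof (Rabs_triang (- RInt (fun t => u t * sin t) 0 (2 * PI)) (- RInt (fun t => u t * sin t) 0 (2 * PI))) as Q.
rewrite Rabs_Ropp in Q. unfold Rminus. lra.
Qed.

(** * Exponential and logarithm *)

Section HoloRules.
Context (U : C -> Prop).

Lemma holo_ext (f f' g' : C -> C) : (forall z, f' z = g' z) -> holo U f f' -> holo U f g'.
Proof.
intros E H z Hz; destruct (H z Hz) as [H1 H2]; split; [now rewrite <- E|].
apply (ccont_ext_loc f' g' z 1); trivial; lra.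
Qed.

Lemma holo_const (c : C) : holo U (fun _ => c) (fun _ => 0%C).
Proof. intros z _; split; [apply is_Cderive_const|apply ccont_const]. Qed.

Lemma holo_id : holo U (fun z => z) (fun _ => 1%C).
Proof. intros z _; split; [apply is_Cderive_id|apply ccont_const]. Qed.

Lemma holo_plus (f f' g g' : C -> C) : holo U f f' -> holo U g g' ->
  holo U (fun z => f z + g z)%C (fun z => f' z + g' z)%C.
Proof.
intros Hf Hg z Hz; destruct (Hf z Hz), (Hg z Hz); split; [now apply is_Cderive_plus|now apply ccont_plus].
Qed.

Lemma holo_mult (f f' g g' : C -> C) : holo U f f' -> holo U g g' ->
  holo U (fun z => f z * g z)%C (fun z => f' z * g z + f z * g' z)%C.
Proof.
intros Hf Hg z Hz. pose proof (holo_cont U f f' z Hf Hz). pose proof (holo_cont U g g' z Hg Hz).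
destruct (Hf z Hz), (Hg z Hz); split; [now apply is_Cderive_mult|].
apply ccont_plus; now apply ccont_mult.
Qed.

Lemma holo_comp (V : C -> Prop) (f f' g g' : C -> C) : holo V f f' -> holo U g g' ->
  (forall z, U z -> V (g z)) -> holo U (fun z => f (g z)) (fun z => f' (g z) * g' z)%C.
Proof.
intros Hf Hg S z Hz. pose proof (holo_cont U g g' z Hg Hz).
destruct (Hf (g z) (S z Hz)), (Hg z Hz); split; [now apply is_Cderive_comp|].
apply ccont_mult; trivial. now apply (continuous_comp g f').
Qed.

Lemma holo_scal (c : C) (f f' : C -> C) : holo U f f' -> holo U (fun z => c * f z)%C (fun z => c * f' z)%C.
Proof.
intros H; eapply holo_ext; [|apply (holo_mult (fun _ => c) _ f f' (holo_const c) H)].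
intros z; simpl; ring.
Qed.

Lemma holo_minus (f f' g g' : C -> C) : holo U f f' -> holo U g g' ->
  holo U (fun z => f z - g z)%C (fun z => f' z - g' z)%C.
Proof.
intros Hf Hg z Hz. destruct (Hf z Hz) as [F1 F2], (Hg z Hz) as [G1 G2]; split; [|now apply ccont_minus].
eapply is_Cderive_eq; [apply (is_Cderive_plus f (fun z => - g z)%C); [exact F1|]|reflexivity].
apply (is_Cderive_ext_loc (fun z => (- (1)) * g z)%C _ _ _ 1); [lra|intros; ring|].
eapply is_Cderive_eq; [apply (is_Cderive_mult (fun _ => - (1))%C g); [apply is_Cderive_const|exact G1]|ring].
Qed.

Lemma holo_inv (f f' : C -> C) : holo U f f' -> (forall z, U z -> f z <> 0%C) ->
  holo U (fun z => / f z)%C (fun z => - / (f z * f z) * f' z)%C.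
Proof.
intros Hf N z Hz. pose proof (holo_cont U f f' z Hf Hz). pose proof (N z Hz).
destruct (Hf z Hz) as [F1 F2]; split; [apply (is_Cderive_comp Cinv f); trivial; now apply is_Cderive_inv|].
apply ccont_mult; trivial. apply ccont_opp, ccont_inv; [now apply ccont_mult|now apply Cmult_neq_0].
Qed.
End HoloRules.

Definition Cexp (z : C) : C := (exp (Re z) * cos (Im z), exp (Re z) * sin (Im z)).

Lemma Cexp_plus (a b : C) : Cexp (a + b)%C = (Cexp a * Cexp b)%C.
Proof.
unfold Cexp, Cmult; simpl. rewrite exp_plus, cos_plus, sin_plus. unfold Re, Im; f_equal; ring.
Qed.

Lemma Cexp_0 : Cexp 0%C = 1%C.
Proof. unfold Cexp; simpl. rewrite exp_0, cos_0, sin_0. unfold RtoC; f_equal; ring. Qed.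

Lemma Cmod_Cexp (z : C) : Cmod (Cexp z) = exp (Re z).
Proof.
replace (Cexp z) with (exp (Re z) * eit (Im z))%C.
- rewrite Cmod_mult, Cmod_eit, Cmod_R, Rabs_pos_eq; [ring|left; apply exp_pos].
- unfold Cexp, eit, Cmult, RtoC; simpl; f_equal; ring.
Qed.

Lemma Cexp_ne0 (z : C) : Cexp z <> 0%C.
Proof. apply Cmod_gt_0; rewrite Cmod_Cexp; apply exp_pos. Qed.

Lemma exp_near (x : R) : Rabs x <= 1 / 2 -> Rabs (exp x - 1 - x) <= 2 * x ^ 2 /\ exp x <= 2 /\ Rabs (exp x - 1) <= 2 * Rabs x.
Proof.
intros Hx. assert (H := proj1 (Rabs_le_between _ _) Hx).
pose proof (exp_ineq1_le x) as L. pose proof (exp_ineq1_le (- x)) as L2.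
rewrite exp_Ropp in L2. pose proof (exp_pos x) as P.
assert (B : exp x * (1 - x) <= 1).
{ apply (Rmult_le_compat_l (exp x)) in L2; [|lra]. rewrite Rinv_r in L2 by lra. lra. }
assert (E2 : exp x <= 2) by nra.
assert (E1 : exp x - 1 - x <= 2 * x ^ 2) by nra.
split; [rewrite Rabs_pos_eq; lra|]. split; [trivial|].
unfold Rabs. destruct (Rcase_abs (exp x - 1)); destruct (Rcase_abs x); nra.
Qed.

Lemma Rabs_sin_le (y : R) : Rabs (sin y) <= Rabs y.
Proof.
destruct (MVT_gen sin 0 y cos) as [c [_ E]].
- intros t _; apply is_derive_Reals, derivable_pt_lim_sin.
- intros t _; apply continuity_sin.
- rewrite sin_0, !Rminus_0_r in E. rewrite E, Rabs_mult.
  assert (Rabs (cos c) <= 1) by apply Rabs_le, COS_bound. pose proof (Rabs_pos y). nra.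
Qed.

Lemma cos_near (y : R) : Rabs (cos y - 1) <= y ^ 2 / 2.
Proof.
replace (cos y) with (1 - 2 * sin (y / 2) * sin (y / 2)).
- pose proof (Rabs_sin_le (y / 2)) as H. rewrite (Rabs_left1).
  + assert (H2 : sin (y / 2) ^ 2 <= (y / 2) ^ 2).
    { rewrite <- (pow2_abs (sin (y / 2))), <- (pow2_abs (y / 2)). apply pow_incr; split; [apply Rabs_pos|trivial]. }
    simpl in *; lra.
  + pose proof (pow2_ge_0 (sin (y / 2))). simpl in *; lra.
- rewrite <- cos_2a_sin. f_equal; field.
Qed.

Lemma sin_near (y : R) : Rabs y <= 1 -> Rabs (sin y - y) <= y ^ 2.
Proof.
intros Hy.
destruct (MVT_gen (fun t => sin t - t) 0 y (fun t => cos t - 1)) as [c [Hc E]].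
- intros t _; apply (is_derive_minus sin (fun t => t)); [apply is_derive_Reals, derivable_pt_lim_sin|apply (is_derive_id (K := R_AbsRing))].
- intros t _; apply continuity_pt_minus; [apply continuity_sin|apply derivable_continuous_pt, derivable_pt_id].
- rewrite sin_0, !Rminus_0_r in E. rewrite E, Rabs_mult.
  pose proof (cos_near c) as H.
  assert (Hcy : Rabs c <= Rabs y).
  { apply Rabs_le. destruct (Rle_dec 0 y).
    - rewrite Rmin_left, Rmax_right in Hc by lra. rewrite Rabs_pos_eq; lra.
    - rewrite Rmin_right, Rmax_left in Hc by lra. rewrite Rabs_left; lra. }
  assert (c ^ 2 <= y ^ 2).
  { rewrite <- (pow2_abs c), <- (pow2_abs y). apply pow_incr; split; [apply Rabs_pos|trivial]. }
  pose proof (Rabs_pos y). rewrite <- (pow2_abs y) in *. nra.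
Qed.

Lemma Cexp_near (h : C) : Cmod h <= 1 / 2 -> Cmod (Cexp h - 1 - h) <= 4 * Cmod h ^ 2.
Proof.
intros Hh. rewrite Cmod2_alt.
pose proof (re_le_Cmod h) as Hx. pose proof (Im_le_Cmod h) as Hy.
eapply Rle_trans; [apply Cmod_le_Re_Im|].
unfold Cexp; simpl. set (x := Re h) in *. set (y := Im h) in *.
change (fst h) with x; change (snd h) with y.
destruct (exp_near x) as [E1 [E2 E3]]; [lra|].
pose proof (cos_near y) as C1. assert (S1 := sin_near y ltac:(lra)).
pose proof (exp_pos x) as P.
assert (A : Rabs (exp x * cos y + - (1) + - x) <= 2 * x ^ 2 + y ^ 2).
{ replace (exp x * cos y + - (1) + - x) with ((exp x - 1 - x) + exp x * (cos y - 1)) by ring.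
  eapply Rle_trans; [apply Rabs_triang|]. rewrite (Rabs_mult (exp x)), (Rabs_pos_eq (exp x)) by lra.
  pose proof (Rabs_pos (cos y - 1)). nra. }
assert (B : Rabs (exp x * sin y + - 0 + - y) <= 2 * y ^ 2 + 2 * (Rabs x * Rabs y)).
{ replace (exp x * sin y + - 0 + - y) with (exp x * (sin y - y) + (exp x - 1) * y) by ring.
  eapply Rle_trans; [apply Rabs_triang|]. rewrite !Rabs_mult, (Rabs_pos_eq (exp x)) by lra.
  pose proof (Rabs_pos (sin y - y)). pose proof (Rabs_pos y). nra. }
assert (2 * (Rabs x * Rabs y) <= x ^ 2 + y ^ 2).
{ rewrite <- (pow2_abs x), <- (pow2_abs y). pose proof (pow2_ge_0 (Rabs x - Rabs y)). nra. }
pose proof (pow2_ge_0 x). pose proof (pow2_ge_0 y). simpl in *. lra.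
Qed.

Lemma is_Cderive_Cexp (z : C) : is_Cderive Cexp z (Cexp z).
Proof.
intros eps He.
pose proof (exp_pos (Re z)) as P.
exists (Rmin (1 / 2) (eps / (4 * exp (Re z)))); split; [apply Rmin_pos; [lra|apply Rdiv_lt_0_compat; lra]|].
intros w Hw.
assert (W1 := Rlt_le_trans _ _ _ Hw (Rmin_l _ _)).
assert (W2 := Rlt_le_trans _ _ _ Hw (Rmin_r _ _)).
replace (Cexp w - Cexp z - Cexp z * (w - z))%C with (Cexp z * (Cexp (w - z) - 1 - (w - z)))%C.
2:{ replace (Cexp w) with (Cexp z * Cexp (w - z))%C by (rewrite <- Cexp_plus; f_equal; ring). ring. }
rewrite Cmod_mult, Cmod_Cexp.
assert (H := Cexp_near (w - z) (Rlt_le _ _ W1)).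
apply (Rmult_lt_compat_r (4 * exp (Re z))) in W2; [|lra].
replace (eps / (4 * exp (Re z)) * (4 * exp (Re z))) with eps in W2 by (field; lra).
pose proof (Cmod_ge_0 (w - z)). set (x := Cmod (w - z)) in *.
apply Rle_trans with (exp (Re z) * (4 * x ^ 2)); [apply Rmult_le_compat_l; lra|]. simpl; nra.
Qed.

Lemma holo_Cexp (U : C -> Prop) (f f' : C -> C) : holo U f f' ->
  holo U (fun z => Cexp (f z)) (fun z => Cexp (f z) * f' z)%C.
Proof.
intros Hf; apply (holo_comp U (fun _ => True) Cexp Cexp f f'); trivial.
intros z _; split; [apply is_Cderive_Cexp|apply (is_Cderive_cont _ _ _ (is_Cderive_Cexp z))].
Qed.

(** The plane without the closed negative real axis. *)
Definition slit (w : C) : Prop := 0 < Cmod w + Re w.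

(** The principal branch. The half-angle formula [arg w = 2 atan (y / (|w| + x))] covers the whole
    slit plane with one expression. *)
Definition Clog (w : C) : C := (ln (Cmod w), 2 * atan (Im w / (Cmod w + Re w))).

Lemma slit_Cmod_pos (w : C) : slit w -> 0 < Cmod w.
Proof.
unfold slit; intros H. pose proof (re_le_Cmod w). pose proof (Rle_abs (Re w)).
pose proof (Cmod_ge_0 w). lra.
Qed.

Lemma Cexp_Clog (w : C) : slit w -> Cexp (Clog w) = w.
Proof.
intros H. pose proof (slit_Cmod_pos w H) as P.
unfold Cexp, Clog; simpl. rewrite exp_ln by trivial.
unfold slit in H. set (rho := Cmod w) in *. pose proof (Cmod2_alt w) as E. fold rho in E.
set (x := Re w) in *. set (y := Im w) in *.
set (t := y / (rho + x)).
assert (T : 1 + t ^ 2 = 2 * rho / (rho + x)).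
{ unfold t. apply Rmult_eq_reg_r with ((rho + x) ^ 2); [|apply pow_nonzero; lra].
  field_simplify; [|lra|lra]. rewrite E. nra. }
assert (T0 : 0 < 1 + t ^ 2) by (pose proof (pow2_ge_0 t); lra).
assert (Sq : sqrt (1 + t ^ 2) * sqrt (1 + t ^ 2) = 1 + t ^ 2) by (apply sqrt_sqrt; lra).
assert (S0 : 0 < sqrt (1 + t ^ 2)) by now apply sqrt_lt_R0.
assert (Cc : cos (atan t) = / sqrt (1 + t ^ 2)).
{ rewrite cos_atan. unfold Rsqr, Rdiv. rewrite Rmult_1_l. do 2 f_equal. ring. }
assert (Cs : sin (atan t) = t * / sqrt (1 + t ^ 2)).
{ rewrite sin_atan. unfold Rsqr, Rdiv. do 3 f_equal. ring. }
assert (I : / sqrt (1 + t ^ 2) * / sqrt (1 + t ^ 2) = (rho + x) / (2 * rho)).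
{ rewrite <- Rinv_mult, Sq, T. field. lra. }
rewrite (surjective_pairing w). change (fst w) with x; change (snd w) with y. f_equal.
- rewrite cos_2a_cos, Cc. replace (2 * / sqrt (1 + t ^ 2) * / sqrt (1 + t ^ 2)) with (2 * (/ sqrt (1 + t ^ 2) * / sqrt (1 + t ^ 2))) by ring.
  rewrite I. field; lra.
- rewrite sin_2a, Cc, Cs. replace (2 * (t * / sqrt (1 + t ^ 2)) * / sqrt (1 + t ^ 2)) with (2 * t * (/ sqrt (1 + t ^ 2) * / sqrt (1 + t ^ 2))) by ring.
  rewrite I. unfold t. field; lra.
Qed.

Lemma ccont_Clog (w : C) : slit w -> ccont Clog w.
Proof.
intros H. pose proof (slit_Cmod_pos w H) as P.
assert (Cm : continuous (fun w : C_UniformSpace => Cmod w) w) by apply (ccont_Cmod (fun w => w)), ccont_id.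
apply ccont_pair; simpl.
- apply (continuous_comp (fun w : C => Cmod w) ln); trivial.
  apply (ex_derive_continuous ln). exists (/ Cmod w). apply is_derive_Reals, derivable_pt_lim_ln; trivial.
- apply (continuous_mult (K := R_AbsRing) (fun _ => 2)); [apply continuous_const|].
  apply (continuous_comp (fun w : C => Im w / (Cmod w + Re w)) atan).
  + apply (continuous_mult (K := R_AbsRing) (fun w : C_UniformSpace => Im w)).
    * apply (ccont_Im (fun w => w)), ccont_id.
    * apply (continuous_comp (fun w : C => Cmod w + Re w) Rinv).
      -- apply (continuous_plus (fun w : C_UniformSpace => Cmod w) (fun w : C_UniformSpace => Re w)); trivial.
         apply (ccont_Re (fun w => w)), ccont_id.
      -- apply (ex_derive_continuous Rinv). auto_derive. unfold slit in H. lra.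
  + apply continuity_pt_filterlim, derivable_continuous_pt, derivable_pt_atan.
Qed.

Lemma slit_open (w : C) : slit w -> exists r, 0 < r /\ forall v, Cmod (v - w) < r -> slit v.
Proof.
unfold slit; intros H. exists ((Cmod w + Re w) / 2); split; [lra|]; intros v Hv.
pose proof (Cmod_triangle_rev w v) as A. rewrite Cmod_sub_sym in A.
pose proof (re_le_Cmod (v - w)) as B. pose proof (Rabs_maj2 (Re (v - w))) as B2.
replace (Re (v - w)) with (Re v - Re w) in B, B2 by (unfold Re; simpl; ring). lra.
Qed.

(** With [k = Clog v - Clog w] one has [v = w Cexp k], so [(v - w) / w - k] is the second order
    remainder of the exponential. Continuity makes [k] small, and then [Cmod k] is at most twice
    [Cmod (v - w) / Cmod w]. *)
Lemma is_Cderive_Clog (w : C) : slit w -> is_Cderive Clog w (/ w)%C.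
Proof.
intros H. pose proof (slit_Cmod_pos w H) as P.
assert (Hw0 : w <> 0%C) by now apply Cmod_gt_0.
intros eps He.
destruct (slit_open w H) as [r [Hr Hslit]].
destruct (proj1 (ccont_eps Clog w) (ccont_Clog w H) (Rmin (1 / 8) (eps * Cmod w / 8))) as [d [Hd0 Hd]].
{ apply Rmin_pos; [lra|]. apply Rdiv_lt_0_compat; [now apply Rmult_lt_0_compat|lra]. }
exists (Rmin r d); split; [now apply Rmin_pos|].
intros v Hv.
assert (V1 := Rlt_le_trans _ _ _ Hv (Rmin_l _ _)).
assert (V2 := Hd v (Rlt_le_trans _ _ _ Hv (Rmin_r _ _))).
set (k := (Clog v - Clog w)%C) in *.
assert (K1 := Rlt_le_trans _ _ _ V2 (Rmin_l _ _)).
assert (K2 := Rlt_le_trans _ _ _ V2 (Rmin_r _ _)).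
assert (Ev : v = (w * Cexp k)%C).
{ rewrite <- (Cexp_Clog w H) at 1. rewrite <- Cexp_plus. unfold k.
  replace (Clog w + (Clog v - Clog w))%C with (Clog v) by ring. now rewrite Cexp_Clog by auto. }
assert (N := Cexp_near k ltac:(lra)).
assert (D : (Cexp k - 1)%C = ((v - w) * / w)%C) by (rewrite Ev; field; trivial).
rewrite D in N.
replace (k - / w * (v - w))%C with (- ((v - w) * / w - k))%C by ring.
rewrite Cmod_opp.
assert (K3 : Cmod k <= 2 * (Cmod (v - w) / Cmod w)).
{ assert (T := Cmod_triangle_rev k ((v - w) * / w)). rewrite Cmod_sub_sym, Cmod_mult, Cmod_inv in T by trivial.
  pose proof (Cmod_ge_0 k). fold (Rdiv (Cmod (v - w)) (Cmod w)) in T. simpl in N. nra. }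
pose proof (Cmod_ge_0 k).
apply Rle_trans with (4 * (eps * Cmod w / 8) * (2 * (Cmod (v - w) / Cmod w))).
- eapply Rle_trans; [exact N|]. simpl. nra.
- right; field; lra.
Qed.

Lemma holo_Clog (U : C -> Prop) (f f' : C -> C) : holo U f f' -> (forall z, U z -> slit (f z)) ->
  holo U (fun z => Clog (f z)) (fun z => / f z * f' z)%C.
Proof.
intros Hf HS; apply (holo_comp U slit Clog Cinv f f'); trivial.
intros z Hz; split; [now apply is_Cderive_Clog|].
apply ccont_inv; [apply ccont_id|]. now apply Cmod_gt_0, slit_Cmod_pos.
Qed.

Lemma Cexp_onto (c : C) : c <> 0%C -> exists l, Cexp l = c.
Proof.
intros Hc. destruct (Rlt_dec 0 (Cmod c + Re c)) as [H|H]; [exists (Clog c); now apply Cexp_Clog|].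
assert (Hm := proj1 (Cmod_gt_0 c) Hc).
exists (Clog (- c) + (0, PI))%C. rewrite Cexp_plus, Cexp_Clog.
- unfold Cexp; simpl. rewrite exp_0, cos_PI, sin_PI. rewrite (surjective_pairing c). unfold Cmult, Copp; simpl. f_equal; ring.
- unfold slit. rewrite Cmod_opp. unfold Re in *; simpl. lra.
Qed.

Lemma is_Cderive_zero_const (U : C -> Prop) (f : C -> C) (a b : C) : convexC U -> U a -> U b ->
  (forall z, U z -> is_Cderive f z 0%C) -> f a = f b.
Proof.
intros HC Ha Hb H.
assert (B : Cmod (f b - f a) <= 2 * 0 * Cmod (b - a)).
{ apply (is_Cderive_mvt f (fun _ => 0%C)). intros t Ht; split; [apply H; now apply HC|rewrite Cmod_0; lra]. }
assert (Z : (f b - f a)%C = 0%C) by (apply Cmod_eq_0, Rle_antisym; [lra|apply Cmod_ge_0]).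
rewrite <- (Cplus_0_r (f a)), <- Z; ring.
Qed.

(** For a primitive [K] of [g' / g] the product [g Cexp (- K)] has derivative zero, hence is
    constant; a logarithm of this constant corrects [K]. *)
Lemma exists_log (U : C -> Prop) (g g' : C -> C) (a : C) : openC U -> convexC U -> U a ->
  holo U g g' -> (forall z, U z -> g z <> 0%C) ->
  exists L, holo U L (fun z => g' z * / g z)%C /\ forall z, U z -> Cexp (L z) = g z.
Proof.
intros HO HC Ha Hg Hn.
assert (Hg2 := holo_derive U g g' HO Hg).
assert (Hk := holo_mult U _ _ _ _ Hg2 (holo_inv U g g' Hg Hn)).
destruct (primitive_convex U _ _ a HO HC Ha Hk) as [K HK].
assert (HhK : holo U K (fun z => g' z * / g z)%C).
{ intros z Hz; split; [now apply HK|exact (holo_cont _ _ _ z Hk Hz)]. }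
assert (HM : holo U (fun z => g z * Cexp (- K z))%C
   (fun z => g' z * Cexp (- K z) + g z * (Cexp (- K z) * (- (1) * (g' z * / g z))))%C).
{ apply holo_mult; trivial. apply (holo_Cexp U (fun z => - K z)%C).
  intros z Hz; destruct (holo_scal U (- (1))%C K _ HhK z Hz) as [H1 H2]; split; trivial.
  apply (is_Cderive_ext_loc (fun z => - (1) * K z)%C _ _ _ 1); trivial; [lra|intros; ring]. }
assert (Cst : forall z, U z -> (g z * Cexp (- K z))%C = (g a * Cexp (- K a))%C).
{ intros z Hz. apply (is_Cderive_zero_const U (fun z => g z * Cexp (- K z))%C z a); trivial.
  intros v Hv. eapply is_Cderive_eq; [apply HM; trivial|]. field. now apply Hn. }
destruct (Cexp_onto (g a * Cexp (- K a))%C) as [l Hl].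
{ apply Cmult_neq_0; [now apply Hn|apply Cexp_ne0]. }
exists (fun z => K z + l)%C; split.
- eapply holo_ext; [|apply holo_plus; [exact HhK|apply (holo_const U l)]]. intros z; simpl; ring.
- intros z Hz. rewrite Cexp_plus, Hl, <- (Cst z Hz).
  replace (Cexp (K z) * (g z * Cexp (- K z)))%C with (g z * (Cexp (K z) * Cexp (- K z)))%C by ring.
  rewrite <- Cexp_plus. replace (K z + - K z)%C with (RtoC 0) by ring. rewrite Cexp_0; ring.
Qed.

(** Branches of the logarithm whose cuts run along the negative and the positive imaginary axis
    respectively. They agree on the right half-plane and differ by [2 PI i] on the left one. *)
Definition log_down (w : C) : C := (Clog (- Ci * w) + (0%R, (PI / 2)%R))%C.
Definition log_up (w : C) : C := (Clog (Ci * w) - (0%R, (PI / 2)%R))%C.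

Lemma log_down_up (w : C) : Re w <> 0 ->
  log_down w = (log_up w + (if Rlt_dec 0 (Re w) then RtoC 0 else (0%R, (2 * PI)%R)))%C.
Proof.
intros Hx. unfold log_down, log_up, Clog.
assert (E1 : Cmod (- Ci * w) = Cmod w) by (rewrite Cmod_mult, Cmod_opp, Cmod_Ci; ring).
assert (E2 : Cmod (Ci * w) = Cmod w) by (rewrite Cmod_mult, Cmod_Ci; ring).
rewrite E1, E2.
assert (P1 : Im (- Ci * w) = - Re w) by (unfold Re, Im; simpl; ring).
assert (P2 : Re (- Ci * w) = Im w) by (unfold Re, Im; simpl; ring).
assert (P3 : Im (Ci * w) = Re w) by (unfold Re, Im; simpl; ring).
assert (P4 : Re (Ci * w) = - Im w) by (unfold Re, Im; simpl; ring).
rewrite P1, P2, P3, P4.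
pose proof (Cmod2_alt w) as E.
set (rho := Cmod w) in *. set (x := Re w) in *. set (y := Im w) in *.
assert (R0 : 0 <= rho) by apply Cmod_ge_0.
assert (X2 : 0 < x ^ 2) by now apply pow2_gt_0.
assert (A1 : 0 < rho + y) by nra.
assert (A2 : 0 < rho + - y) by nra.
(* Since [(rho + y) (rho - y) = x^2], the two half-angle tangents are reciprocal up to sign, and
   [atan_inv] compares the angles. *)
set (t := x / (rho + y)).
assert (T1 : - x / (rho + y) = - t) by (unfold t; field; lra).
assert (T2 : x / (rho + - y) = / t).
{ unfold t. field_simplify_eq; [nra|]. repeat split; lra. }
rewrite T1, T2, atan_opp.
assert (Ht0 : t * (rho + y) = x) by (unfold t; field; lra).
destruct (Rlt_dec 0 x) as [Hp|Hp].
- assert (0 < t) by nra. rewrite atan_inv by trivial.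
  unfold Cplus, Cminus, Copp, RtoC; simpl. f_equal; lra.
- assert (t < 0) by nra.
  replace (/ t) with (- / (- t)) by (field; lra). rewrite atan_opp, atan_inv by lra. rewrite atan_opp.
  unfold Cplus, Cminus, Copp; simpl. f_equal; lra.
Qed.

Lemma is_Cderive_log_down (w : C) : slit (- Ci * w) -> is_Cderive log_down w (/ w)%C.
Proof.
intros H. unfold log_down.
assert (Hw : w <> 0%C).
{ intros ->. apply slit_Cmod_pos in H. rewrite Cmult_0_r, Cmod_0 in H. lra. }
eapply is_Cderive_eq; [apply (is_Cderive_plus (fun w => Clog (- Ci * w))%C (fun _ => (0%R, (PI / 2)%R))); [|apply is_Cderive_const]|].
- apply (is_Cderive_comp Clog (fun w => - Ci * w)%C); [now apply is_Cderive_Clog|].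
  apply (is_Cderive_mult (fun _ => - Ci)%C (fun w => w)); [apply is_Cderive_const|apply is_Cderive_id].
- field. split; trivial. intros E; apply (f_equal Im) in E; simpl in E; lra.
Qed.

Lemma is_Cderive_log_up (w : C) : slit (Ci * w) -> is_Cderive log_up w (/ w)%C.
Proof.
intros H. unfold log_up.
assert (Hw : w <> 0%C).
{ intros ->. apply slit_Cmod_pos in H. rewrite Cmult_0_r, Cmod_0 in H. lra. }
eapply is_Cderive_eq; [apply (is_Cderive_plus (fun w => Clog (Ci * w))%C (fun _ => - (0%R, (PI / 2)%R))%C); [|apply is_Cderive_const]|].
- apply (is_Cderive_comp Clog (fun w => Ci * w)%C); [now apply is_Cderive_Clog|].
  apply (is_Cderive_mult (fun _ => Ci)%C (fun w => w)); [apply is_Cderive_const|apply is_Cderive_id].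
- field. split; trivial. intros E; apply (f_equal Im) in E; simpl in E; lra.
Qed.

(** * Cauchy transforms along the legs of a triangle *)

(** A removable singularity: near [w] the quotient coincides, by Cauchy's formula, with a Cauchy
    transform, which is holomorphic at [w] as well. *)
Lemma diff_quotient_holo (U : C -> Prop) (f f' : C -> C) (w : C) : openC U -> U w -> holo U f f' ->
  exists g g', holo U g g' /\ forall z, z <> w -> g z = ((f z - f w) * / (z - w))%C.
Proof.
intros HO Hw Hf.
destruct (HO w Hw) as [r' [Hr' Hb]].
assert (H2 : 0 < r' / 2) by lra. assert (H3 : r' / 2 < r') by lra.
assert (Hf2 : holo (fun z => Cmod (z - w) < r') f f') by (now apply (holo_sub U)).
set (r := r' / 2) in *.
set (om := circ w r).
set (dens := fun t => (cauchy_density w r f t * / (om t - w))%C).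
assert (Hww : Cmod (w - w) < r) by (now rewrite Cmod_diag).
assert (Cdens0 := cauchy_density_cont w r H2 r' H3 f f' Hf2).
assert (Com : ccont_on om 0 (2 * PI)) by (intros t _; apply ccont_circ).
assert (Cdens : ccont_on dens 0 (2 * PI)).
{ intros t Ht; apply ccont_mult; [now apply Cdens0|].
  apply ccont_inv; [apply ccont_minus; [now apply Com|apply ccont_const]|now apply circ_ne]. }
set (c := cauchy_transform 1 dens om 0 (2 * PI)).
set (g := fun z => if excluded_middle_informative (z = w) then c w else ((f z - f w) * / (z - w))%C).
assert (Gc : forall z, Cmod (z - w) < r -> c z = g z).
{ intros z Hz; unfold g. destruct (excluded_middle_informative (z = w)) as [->|Hne]; trivial.
  rewrite (cauchy_formula w r H2 r' H3 f f' Hf2 z Hz), (cauchy_formula w r H2 r' H3 f f' Hf2 w Hww).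
  assert (Czw : forall v, Cmod (v - w) < r -> ccont_on (fun t => cauchy_density w r f t * Cpow (/ (om t - v)) 1)%C 0 (2 * PI)).
  { intros v Hv; apply cauchy_transform_conton; trivial. intros t _ E; apply (circ_ne w r H2 v t Hv). unfold om in E; rewrite E; ring. }
  unfold cauchy_transform; fold om. rewrite <- CInt_minus; try apply PI2_pos; try now apply Czw.
  rewrite Cmult_comm, <- CInt_scal; [|apply PI2_pos|].
  - unfold c, cauchy_transform. apply CInt_ext; [apply PI2_pos|]. intros t _. unfold dens; simpl.
    field. repeat split; try (now apply circ_ne).
    intros E; apply Hne. replace z with ((z - w) + w)%C by ring. rewrite E; ring.
  - intros t Ht; apply ccont_minus; now apply Czw. }
exists g, (C_derive g); split.
2:{ intros z Hz; unfold g. destruct (excluded_middle_informative (z = w)); [contradiction|trivial]. }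
assert (Sh : forall z, Cmod (z - w) < r -> exists d, 0 < d /\ forall v, Cmod (v - z) < d -> Cmod (v - w) < r) by apply ball_shrink.
intros z Hz. destruct (excluded_middle_informative (z = w)) as [->|Hne].
- assert (D : forall v, Cmod (v - w) < r -> is_Cderive g v (cauchy_transform 2 dens om 0 (2 * PI) v)).
  { intros v Hv. destruct (Sh v Hv) as [d [Hd Hd2]].
    apply (is_Cderive_ext_loc c g v _ d); trivial; [intros u Hu; now apply Gc, Hd2|].
    apply (cauchy_transform1_derive _ _ _ _ PI2_pos Cdens Com v (r - Cmod (v - w))); [lra|].
    intros t _; now apply circ_far. }
  assert (E : forall v, Cmod (v - w) < r -> cauchy_transform 2 dens om 0 (2 * PI) v = C_derive g v).
  { intros v Hv; symmetry; apply is_C_derive_unique, is_Cderive_iff, D, Hv. }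
  split; [rewrite <- E; auto|].
  apply (ccont_ext_loc _ _ w r H2 E).
  apply (is_Cderive_cont _ _ _ (cauchy_transform2_derive _ _ _ _ PI2_pos Cdens Com w (r - Cmod (w - w)) ltac:(lra) (fun t _ => circ_far w r H2 w t Hww))).
- assert (Hzw : 0 < Cmod (z - w)).
  { apply Cmod_gt_0. intros E; apply Hne. replace z with ((z - w) + w)%C by ring. rewrite E; ring. }
  assert (HV : holo (fun v => U v /\ v <> w) (fun v => (f v - f w) * / (v - w))%C
     (fun v => (f' v - 0) * / (v - w) + (f v - f w) * (- / ((v - w) * (v - w)) * (1 - 0)))%C).
  { apply holo_mult.
    - apply holo_minus; [|apply holo_const]. now apply (holo_sub U); [intros v [Hv _]|].
    - apply holo_inv; [apply holo_minus; [apply holo_id|apply holo_const]|].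
      intros v [_ Hv] E; apply Hv. replace v with ((v - w) + w)%C by ring. rewrite E; ring. }
  destruct (HO z Hz) as [rz [Hrz Hbz]].
  set (d := Rmin rz (Cmod (z - w))).
  assert (Hd : 0 < d) by (now apply Rmin_pos).
  assert (In : forall v, Cmod (v - z) < d -> U v /\ v <> w).
  { intros v Hv; split; [apply Hbz; eapply Rlt_le_trans; [exact Hv|apply Rmin_l]|].
    intros ->. assert (Cmod (w - z) < Cmod (z - w)) by (eapply Rlt_le_trans; [exact Hv|apply Rmin_r]).
    rewrite Cmod_sub_sym in H; lra. }
  assert (G : forall v, Cmod (v - z) < d -> ((f v - f w) * / (v - w))%C = g v).
  { intros v Hv; unfold g. destruct (excluded_middle_informative (v = w)) as [E|]; trivial.
    exfalso; now apply (In v). }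
  assert (D : forall v, Cmod (v - z) < d -> is_Cderive g v ((f' v - 0) * / (v - w) + (f v - f w) * (- / ((v - w) * (v - w)) * (1 - 0)))%C).
  { intros v Hv. apply (is_Cderive_ext_loc (fun v => (f v - f w) * / (v - w))%C g v _ (d - Cmod (v - z))); [lra| |apply HV; now apply In].
    intros u Hu; apply G. pose proof (Cmod_dist_triangle u v z); lra. }
  assert (Hzz : Cmod (z - z) < d) by (now rewrite Cmod_diag).
  assert (E : forall v, Cmod (v - z) < d -> ((f' v - 0) * / (v - w) + (f v - f w) * (- / ((v - w) * (v - w)) * (1 - 0)))%C = C_derive g v).
  { intros v Hv; symmetry; apply is_C_derive_unique, is_Cderive_iff, D, Hv. }
  split; [rewrite <- E; auto|].
  apply (ccont_ext_loc _ _ z d Hd E). apply HV. now apply In.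
Qed.

Definition corner_dist (w : C) : R := Rmin (Cmod (w - 1)) (Cmod (w + 1)).

(** The closed triangle with vertices 1, -1 and -i, deprived of the corners 1 and -1, where [L] may
    blow up. *)
Definition Tri (w : C) : Prop := Rabs (Re w) < 1 /\ - (1 - Rabs (Re w)) <= Im w <= 0.

(* The four legs join the corners 1, -1 (s = 1, -1) to 0 and to -i (b = 0, 1). The speed t^7
   kills the singularity of the density at the corner. *)
Definition foot (b : R) : C := (0, - b).
Definition leg (s b t : R) : C := (s + (t ^ 8)%R * (foot b - s))%C.
Definition dleg (s b t : R) : C := ((8 * t ^ 7)%R * (foot b - s))%C.

Lemma path_derive_leg (s b t : R) : path_derive (leg s b) t (dleg s b t).
Proof.
unfold leg, dleg.
eapply path_derive_eq; [apply (path_derive_plus (fun _ => RtoC s) (fun t => (t ^ 8)%R * (foot b - s))%C); [apply path_derive_const|]|].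
- apply (path_derive_mult (fun t => RtoC (t ^ 8)) (fun _ => (foot b - s)%C)); [|apply path_derive_const].
  apply path_derive_RtoC. instantiate (1 := 8 * t ^ 7). auto_derive; trivial. ring.
- ring.
Qed.

Lemma ccont_dleg (s b t : R) : ccont (dleg s b) t.
Proof.
apply ccont_mult; [|apply ccont_const]. apply ccont_RtoC.
apply (ex_derive_continuous (fun t : R => 8 * t ^ 7)). auto_derive; trivial.
Qed.

Lemma leg_coord (s b t : R) : leg s b t = (s * (1 - t ^ 8), - (b * t ^ 8)).
Proof. unfold leg, foot, Cplus, Cmult, Cminus, Copp, RtoC; simpl; f_equal; ring. Qed.

Lemma leg_0 (s b : R) : leg s b 0 = s.
Proof. rewrite leg_coord. unfold RtoC. f_equal; ring. Qed.

Lemma leg_1 (s b : R) : leg s b 1 = foot b.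
Proof. rewrite leg_coord. unfold foot. f_equal; ring. Qed.

Lemma pow8_01 (t : R) : 0 <= t <= 1 -> 0 <= t ^ 8 <= 1.
Proof.
intros Ht; split; [apply pow_le; lra|]. rewrite <- (pow1 8). apply pow_incr; trivial.
Qed.

Lemma corner_dist_coord (x y : R) : corner_dist (x, y) <= Rabs (1 - Rabs x) + Rabs y.
Proof.
unfold corner_dist.
destruct (Rle_dec 0 x) as [Hx|Hx].
- eapply Rle_trans; [apply Rmin_l|]. eapply Rle_trans; [apply Cmod_le_Re_Im|]. simpl.
  rewrite (Rabs_pos_eq x), (Rabs_minus_sym 1 x) by trivial. replace (y + - 0) with y by ring. apply Rle_refl.
- eapply Rle_trans; [apply Rmin_r|]. eapply Rle_trans; [apply Cmod_le_Re_Im|]. simpl.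
  rewrite (Rabs_left x) by lra. replace (y + 0) with y by ring. replace (1 - - x) with (x + 1) by ring. apply Rle_refl.
Qed.

Lemma corner_dist_ge (x y : R) : Rabs x <= 1 -> 1 - Rabs x <= corner_dist (x, y).
Proof.
intros Hx. unfold corner_dist. apply Rmin_glb; (eapply Rle_trans; [|apply re_le_Cmod]); simpl;
unfold Rabs in *; destruct (Rcase_abs x); destruct (Rcase_abs _); lra.
Qed.

Lemma corner_dist_lip (z w : C) : corner_dist z <= Cmod (z - w) + corner_dist w.
Proof.
unfold corner_dist. pose proof (Cmod_dist_triangle z w 1). pose proof (Cmod_dist_triangle z w (- (1))).
replace (z - - (1))%C with (z + 1)%C in H0 by ring. replace (w - - (1))%C with (w + 1)%C in H0 by ring.
destruct (Rle_dec (Cmod (w - 1)) (Cmod (w + 1))).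
- rewrite (Rmin_left (Cmod (w - 1))) by trivial. eapply Rle_trans; [apply Rmin_l|trivial].
- rewrite (Rmin_right (Cmod (w - 1))) by lra. eapply Rle_trans; [apply Rmin_r|trivial].
Qed.

Section Leg.
Context (s b : R) (Hs : s = 1 \/ s = -1) (Hb : 0 <= b <= 1).

Lemma Rabs_leg (t : R) : 0 <= t <= 1 -> Rabs (s * (1 - t ^ 8)) = 1 - t ^ 8.
Proof.
intros Ht; pose proof (pow8_01 t Ht). rewrite Rabs_mult, (Rabs_pos_eq (1 - t ^ 8)) by lra.
destruct Hs as [-> | ->]; [rewrite Rabs_pos_eq|rewrite Rabs_left]; lra.
Qed.

Lemma leg_Tri (t : R) : 0 < t <= 1 -> Tri (leg s b t).
Proof.
intros Ht; rewrite leg_coord; unfold Tri, Re, Im; cbn [fst snd].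
assert (H := pow8_01 t ltac:(lra)). assert (0 < t ^ 8) by (apply pow_lt; lra).
rewrite Rabs_leg by lra. repeat split; nra.
Qed.

Lemma leg_corner_dist (t : R) : 0 <= t <= 1 -> t ^ 8 <= corner_dist (leg s b t).
Proof.
intros Ht. rewrite leg_coord. pose proof (pow8_01 t Ht).
pose proof (corner_dist_ge (s * (1 - t ^ 8)) (- (b * t ^ 8))) as D. rewrite Rabs_leg in D by trivial. lra.
Qed.

Lemma Cmod_dleg (t : R) : 0 <= t -> Cmod (dleg s b t) <= 16 * t ^ 7.
Proof.
intros Ht; unfold dleg. rewrite Cmod_mult, Cmod_R.
assert (0 <= t ^ 7) by now apply pow_le. rewrite Rabs_pos_eq by lra.
assert (Cmod (foot b - s) <= 2).
{ eapply Rle_trans; [apply Cmod_le_Re_Im|]. unfold foot; simpl.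
  destruct Hs as [-> | ->]; unfold Rabs; repeat destruct (Rcase_abs _); lra. }
nra.
Qed.

Context (Om : C -> Prop) (L L' : C -> C) (K : R) (HL : holo Om L L').
Context (HT : forall w, Tri w -> Om w).
(* |L| = O(corner_dist^(-3/4)) on the triangle, stated without real powers. *)
Context (HK : forall w q, Tri w -> 0 < q -> q ^ 8 <= corner_dist w -> Cmod (L w) * q ^ 6 <= K).

Definition ldens (t : R) : C := (L (leg s b t) * dleg s b t)%C.

(** At parameter [t] the corner distance is at least [t^8], so [L] is at most [K / t^6]; the speed
    is at most [16 t^7]. The product is [O(t)], which vanishes at the corner. *)
Lemma ldens_bound (t : R) : 0 <= t <= 1 -> Cmod (ldens t) <= 16 * K * t.
Proof.
intros Ht. unfold ldens. rewrite Cmod_mult.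
destruct (Req_dec t 0) as [->|Hn].
- pose proof (Cmod_dleg 0 ltac:(lra)) as H. pose proof (Cmod_ge_0 (dleg s b 0)).
  assert (E : Cmod (dleg s b 0) = 0) by (simpl in H; lra). rewrite E; lra.
- assert (Ht0 : 0 < t) by lra.
  assert (A := HK (leg s b t) t (leg_Tri t ltac:(lra)) Ht0 (leg_corner_dist t Ht)).
  assert (B := Cmod_dleg t ltac:(lra)).
  assert (0 <= Cmod (L (leg s b t))) by apply Cmod_ge_0.
  apply Rle_trans with (Cmod (L (leg s b t)) * (16 * t ^ 7)); [now apply Rmult_le_compat_l|].
  replace (t ^ 7) with (t ^ 6 * t) by ring. nra.
Qed.

Lemma leg_even (t : R) : leg s b (- t) = leg s b t.
Proof. rewrite !leg_coord. replace ((- t) ^ 8) with (t ^ 8) by ring. trivial. Qed.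

Lemma dleg_odd (t : R) : dleg s b (- t) = (- dleg s b t)%C.
Proof. unfold dleg. replace (8 * (- t) ^ 7) with (- (8 * t ^ 7)) by ring. rewrite RtoC_opp; ring. Qed.

Lemma ldens_cont : ccont_on ldens 0 1.
Proof.
intros t Ht. destruct (Req_dec t 0) as [->|Hn].
- assert (Z : ldens 0 = 0%C).
  { apply Cmod_eq_0, Rle_antisym; [|apply Cmod_ge_0]. pose proof (ldens_bound 0 ltac:(lra)). lra. }
  assert (K0 : 0 <= K).
  { assert (A := HK (leg s b 1) 1 (leg_Tri 1 ltac:(lra)) Rlt_0_1 (leg_corner_dist 1 ltac:(lra))).
    pose proof (Cmod_ge_0 (L (leg s b 1))). simpl in A. lra. }
  (* [ccont_on] means continuity on the whole line, so negative parameters matter at 0; [leg] is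
     even and [dleg] is odd. *)
  assert (B : forall v, Rabs v <= 1 -> Cmod (ldens v) <= 16 * K * Rabs v).
  { intros v Hv. destruct (Rle_dec 0 v).
    - rewrite Rabs_pos_eq in * by trivial. apply ldens_bound; lra.
    - rewrite Rabs_left in * by lra.
      replace (Cmod (ldens v)) with (Cmod (ldens (- v))); [apply ldens_bound; lra|].
      unfold ldens. rewrite leg_even, dleg_odd, !Cmod_mult, Cmod_opp; trivial. }
  intros P [eps HP].
  assert (Hd : 0 < Rmin 1 (eps / (16 * K + 1))) by (apply Rmin_pos; [lra|apply Rdiv_lt_0_compat; [apply cond_pos|lra]]).
  exists (mkposreal _ Hd). intros v Hv.
  apply HP, C_NormedModule_mixin_compat1. rewrite Z.
  change (Cmod (ldens v - 0) < eps). replace (ldens v - 0)%C with (ldens v) by ring.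
  assert (Hv' : Rabs v < Rmin 1 (eps / (16 * K + 1))).
  { replace v with (v - 0) by ring. exact Hv. }
  assert (V1 := Rlt_le_trans _ _ _ Hv' (Rmin_l _ _)).
  assert (V2 := Rlt_le_trans _ _ _ Hv' (Rmin_r _ _)).
  eapply Rle_lt_trans; [apply B; lra|].
  apply (Rmult_lt_compat_r (16 * K + 1)) in V2; [|lra].
  replace (eps / (16 * K + 1) * (16 * K + 1)) with (pos eps) in V2 by (field; lra).
  pose proof (Rabs_pos v). nra.
- apply ccont_mult; [|apply ccont_dleg].
  apply (continuous_comp (leg s b) L); [exact (path_derive_cont _ _ _ (path_derive_leg s b t))|].
  apply (holo_cont Om L L'); trivial. apply HT, leg_Tri; lra.
Qed.

Lemma leg_cont : ccont_on (leg s b) 0 1.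
Proof. intros t _; exact (path_derive_cont _ _ _ (path_derive_leg s b t)). Qed.

(** The transform itself costs only the power [7/8] of the corner distance, less than the order of
    the barrier. For its derivative a crude power 2 is enough, since it enters only as a factor of
    an exponentially small quantity. *)
Lemma leg_transform_bounds (w : C) (q : R) :
  (forall t, 0 <= t <= 1 -> corner_dist w <= 6 * Cmod (leg s b t - w)) ->
  0 < q -> q ^ 8 <= corner_dist w ->
  Cmod (cauchy_transform 1 ldens (leg s b) 0 1 w) * q ^ 7 <= 224 * K /\
  Cmod (cauchy_transform 2 ldens (leg s b) 0 1 w) * q ^ 16 <= 1152 * K.
Proof.
intros Hfar Hq Hq8.
assert (Hd0 : 0 < corner_dist w) by (eapply Rlt_le_trans; [|exact Hq8]; now apply pow_lt).
assert (Hne : forall t, 0 <= t <= 1 -> leg s b t <> w).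
{ intros t Ht E. specialize (Hfar t Ht). rewrite E in Hfar. rewrite Cmod_diag in Hfar; lra. }
assert (Hinv : forall t, 0 <= t <= 1 -> Cmod (/ (leg s b t - w)) = / Cmod (leg s b t - w)).
{ intros t Ht; apply Cmod_inv. intros E; apply (Hne t Ht).
  replace (leg s b t) with ((leg s b t - w) + w)%C by ring. rewrite E; ring. }
assert (Q7 : 0 < q ^ 7) by now apply pow_lt.
assert (K0 : 0 <= K).
{ assert (A := HK (leg s b 1) 1 (leg_Tri 1 ltac:(lra)) Rlt_0_1 (leg_corner_dist 1 ltac:(lra))).
  pose proof (Cmod_ge_0 (L (leg s b 1))). simpl in A. lra. }
split.
- apply Rle_trans with (2 * (1 - 0) * (112 * K / q ^ 7) * q ^ 7); [|right; field; lra].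
  apply Rmult_le_compat_r; [lra|]. apply CInt_bound; [lra|now apply cauchy_transform_conton; [apply ldens_cont|apply leg_cont|]|].
  intros t Ht. cbn [Cpow]. rewrite Cmult_1_r, Cmod_mult, Hinv by trivial.
  assert (B := ldens_bound t Ht). specialize (Hfar t Ht).
  assert (F2 : t ^ 8 <= 7 * Cmod (leg s b t - w)).
  { pose proof (leg_corner_dist t Ht). pose proof (corner_dist_lip (leg s b t) w). lra. }
  set (D := Cmod (leg s b t - w)) in *.
  assert (D0 : 0 < D) by lra.
  (* [D] dominates both [t^8 / 7] and [q^8 / 6], and [q^7 t] is at most the larger of [q^8] and
     [t^8]. *)
  assert (F3 : q ^ 7 * t <= 7 * D).
  { destruct (Rle_dec q t).
    - apply Rle_trans with (t ^ 7 * t); [apply Rmult_le_compat_r; [lra|apply pow_incr; lra]|].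
      replace (t ^ 7 * t) with (t ^ 8) by ring; trivial.
    - apply Rle_trans with (q ^ 7 * q); [apply Rmult_le_compat_l; lra|].
      replace (q ^ 7 * q) with (q ^ 8) by ring; lra. }
  apply Rle_trans with (16 * K * t * / D); [apply Rmult_le_compat_r; [left; now apply Rinv_0_lt_compat|trivial]|].
  apply Rmult_le_reg_r with (D * q ^ 7); [now apply Rmult_lt_0_compat|].
  replace (16 * K * t * / D * (D * q ^ 7)) with (16 * K * (q ^ 7 * t)) by (field; lra).
  replace (112 * K / q ^ 7 * (D * q ^ 7)) with (16 * K * (7 * D)) by (field; lra).
  apply Rmult_le_compat_l; lra.
- assert (Q16 : q ^ 16 = q ^ 8 * q ^ 8) by ring.
  assert (Q8 : 0 < q ^ 8) by now apply pow_lt.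
  rewrite Q16.
  apply Rle_trans with (2 * (1 - 0) * (576 * K / (q ^ 8 * q ^ 8)) * (q ^ 8 * q ^ 8)); [|right; field; lra].
  apply Rmult_le_compat_r; [nra|]. apply CInt_bound; [lra|now apply cauchy_transform_conton; [apply ldens_cont|apply leg_cont|]|].
  intros t Ht. cbn [Cpow]. rewrite Cmult_1_r, !Cmod_mult, Hinv by trivial.
  assert (B := ldens_bound t Ht). specialize (Hfar t Ht).
  set (D := Cmod (leg s b t - w)) in *.
  assert (D0 : 0 < D) by lra.
  assert (ID : / D <= 6 / q ^ 8).
  { replace (6 / q ^ 8) with (/ (q ^ 8 / 6)) by (field; lra). apply Rinv_le_contravar; lra. }
  assert (ID0 : 0 < / D) by now apply Rinv_0_lt_compat.
  replace (576 * K / (q ^ 8 * q ^ 8)) with (16 * K * (6 / q ^ 8 * (6 / q ^ 8))) by (field; lra).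
  apply Rmult_le_compat; [apply Cmod_ge_0|nra| |apply Rmult_le_compat; lra].
  eapply Rle_trans; [exact B|]. assert (0 <= 16 * K) by lra. nra.
Qed.
End Leg.

Lemma dist_coord (a b : C) : Rabs (Re a - Re b) <= Cmod (a - b) /\ Rabs (Im a - Im b) <= Cmod (a - b).
Proof.
split.
- replace (Re a - Re b) with (Re (a - b)) by (unfold Re; simpl; ring). apply re_le_Cmod.
- replace (Im a - Im b) with (Im (a - b)) by (unfold Im; simpl; ring). apply Im_le_Cmod.
Qed.

Lemma leg_dist (s b t : R) (w : C) : Rabs (s * (1 - t ^ 8) - Re w) <= Cmod (leg s b t - w) /\
  Rabs (- (b * t ^ 8) - Im w) <= Cmod (leg s b t - w).
Proof. rewrite leg_coord. apply (dist_coord (s * (1 - t ^ 8), - (b * t ^ 8)) w). Qed.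

(** The line [Im w = - (1 - Rabs (Re w)) / 2] runs halfway between the chord and the broken line. On
    its lower side the distance to the chord is comparable with that to the corners; [above_far] is
    the counterpart for the broken line. *)
Lemma below_far (s t : R) (w : C) : (s = 1 \/ s = -1) -> 0 <= t <= 1 ->
  Im w <= - (1 - Rabs (Re w)) / 2 -> corner_dist w <= 6 * Cmod (leg s 0 t - w).
Proof.
intros Hs Ht Hw. pose proof (pow8_01 t Ht) as H8.
destruct (leg_dist s 0 t w) as [D1 D2].
pose proof (corner_dist_coord (Re w) (Im w)) as D. rewrite <- (surjective_pairing w : w = (Re w, Im w)) in D.
pose proof (Rabs_leg s Hs t Ht) as A.
set (d := Cmod _) in *. set (x := Re w) in *. set (y := Im w) in *.
pose proof (Rabs_triang_inv2 (s * (1 - t ^ 8)) x) as T. rewrite A in T.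
apply Rle_trans with (Rabs (1 - Rabs x) + Rabs y); trivial.
pose proof (Rabs_pos x).
assert (D2' : Rabs y <= d). { replace (Rabs y) with (Rabs (- (0 * t ^ 8) - y)); trivial. rewrite <- Rabs_Ropp. f_equal; ring. }
assert (T' : Rabs (1 - t ^ 8 - Rabs x) <= d) by lra. clear T D2.
revert Hw D2' T' . unfold Rabs; repeat destruct (Rcase_abs _); intros; lra.
Qed.

Lemma above_far (s t : R) (w : C) : (s = 1 \/ s = -1) -> 0 <= t <= 1 ->
  - (1 - Rabs (Re w)) / 2 <= Im w -> corner_dist w <= 6 * Cmod (leg s 1 t - w).
Proof.
intros Hs Ht Hw. pose proof (pow8_01 t Ht) as H8.
destruct (leg_dist s 1 t w) as [D1 D2].
pose proof (corner_dist_coord (Re w) (Im w)) as D. rewrite <- (surjective_pairing w : w = (Re w, Im w)) in D.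
pose proof (Rabs_leg s Hs t Ht) as A.
set (d := Cmod _) in *. set (x := Re w) in *. set (y := Im w) in *.
pose proof (Rabs_triang_inv2 (s * (1 - t ^ 8)) x) as T. rewrite A in T.
apply Rle_trans with (Rabs (1 - Rabs x) + Rabs y); trivial.
pose proof (Rabs_pos x).
assert (T' : Rabs (1 - t ^ 8 - Rabs x) <= d) by lra. clear T.
assert (D2' : Rabs (t ^ 8 + y) <= d). { replace (Rabs (t ^ 8 + y)) with (Rabs (- (1 * t ^ 8) - y)); trivial. rewrite <- Rabs_Ropp. f_equal; ring. }
clear D2. set (X := Rabs x) in *. clearbody X.
revert Hw D2' T'. unfold Rabs; repeat destruct (Rcase_abs _); intros; lra.
Qed.

(** The function [Im w + (1 - Rabs (Re w))] vanishes on the broken line and is Lipschitz with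
    constant 2. The bound serves holomorphy all the way down to the broken line. *)
Lemma low_leg_far (s t : R) (w : C) : (s = 1 \/ s = -1) -> 0 <= t <= 1 ->
  (Im w + (1 - Rabs (Re w))) / 2 <= Cmod (leg s 1 t - w).
Proof.
intros Hs Ht. pose proof (pow8_01 t Ht) as H8.
destruct (leg_dist s 1 t w) as [D1 D2].
pose proof (Rabs_leg s Hs t Ht) as A.
set (d := Cmod _) in *. set (x := Re w) in *. set (y := Im w) in *.
pose proof (Rabs_triang_inv2 (s * (1 - t ^ 8)) x) as T. rewrite A in T.
revert D2 T. set (X := Rabs x) in *. clearbody X.
pose proof (Rle_abs (- (- (1 * t ^ 8) - y))) as Q1. rewrite Rabs_Ropp in Q1.
pose proof (Rle_abs (1 - t ^ 8 - X)) as Q2.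
intros; lra.
Qed.

Lemma chord_far (s t : R) (w : C) : - Im w <= Cmod (leg s 0 t - w).
Proof.
destruct (leg_dist s 0 t w) as [_ D2].
pose proof (Rle_abs (- (0 * t ^ 8) - Im w)). lra.
Qed.

(** * The jump between the transforms along the two paths *)

Section Jump.
Context (Om : C -> Prop) (L L' : C -> C) (K : R) (HO : openC Om) (HC : convexC Om) (HL : holo Om L L').
Context (HT : forall w, Tri w -> Om w).
Context (HK : forall w q, Tri w -> 0 < q -> q ^ 8 <= corner_dist w -> Cmod (L w) * q ^ 6 <= K).
Context (w : C) (Hx : Rabs (Re w) < 1) (Hy : Im w < 0) (Hy2 : - (1 - Rabs (Re w)) < Im w).

Lemma jump_ne (s b t : R) : (s = 1 \/ s = -1) -> (b = 0 \/ b = 1) -> 0 <= t <= 1 -> (leg s b t - w)%C <> 0%C.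
Proof.
intros Hs Hb Ht. apply Cmod_gt_0. destruct Hb as [-> | ->].
- pose proof (chord_far s t w); lra.
- pose proof (low_leg_far s t w Hs Ht); lra.
Qed.

Definition winding (s b : R) : C := CInt (fun t => / (leg s b t - w) * dleg s b t)%C 0 1.

Lemma winding_cont (s b : R) : (s = 1 \/ s = -1) -> (b = 0 \/ b = 1) ->
  ccont_on (fun t => / (leg s b t - w) * dleg s b t)%C 0 1.
Proof.
intros Hs Hb t Ht; apply ccont_mult; [|apply ccont_dleg].
apply ccont_inv; [|now apply jump_ne]. apply ccont_minus; [exact (path_derive_cont _ _ _ (path_derive_leg s b t))|apply ccont_const].
Qed.

(** As [w] lies below the chord, [leg s 0 t - w] stays in the upper half-plane, away from the
    downward cut of [log_down]. *)
Lemma winding_chord (s : R) : (s = 1 \/ s = -1) -> winding s 0 = (log_down (foot 0 - w) - log_down (s - w))%C.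
Proof.
intros Hs. unfold winding. rewrite (CInt_FTC (fun t => log_down (leg s 0 t - w))).
- now rewrite leg_0, leg_1.
- lra.
- intros t Ht. apply (path_derive_comp log_down (fun t => leg s 0 t - w)%C).
  + apply is_Cderive_log_down. unfold slit.
    assert (E : Re (- Ci * (leg s 0 t - w)) = - Im w) by (rewrite leg_coord; unfold Re, Im; simpl; ring).
    rewrite E. pose proof (Cmod_ge_0 (- Ci * (leg s 0 t - w))). lra.
  + eapply path_derive_eq; [apply (path_derive_plus (leg s 0) (fun _ => - w)%C); [apply path_derive_leg|apply path_derive_const]|ring].
- apply winding_cont; auto.
Qed.

Lemma winding_low (s : R) : (s = 1 \/ s = -1) -> winding s 1 = (log_up (foot 1 - w) - log_up (s - w))%C.
Proof.
intros Hs. unfold winding. rewrite (CInt_FTC (fun t => log_up (leg s 1 t - w))).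
- now rewrite leg_0, leg_1.
- lra.
- intros t Ht. apply (path_derive_comp log_up (fun t => leg s 1 t - w)%C).
  + apply is_Cderive_log_up. unfold slit.
    set (v := (leg s 1 t - w)%C).
    assert (E1 : Cmod (Ci * v) = Cmod v) by (rewrite Cmod_mult, Cmod_Ci; ring).
    assert (E : Re (Ci * v) = - Im v) by (unfold Re, Im; simpl; ring).
    rewrite E1, E. pose proof (Im_le_Cmod v) as I. pose proof (Rle_abs (Im v)) as J.
    (* Only points of the imaginary axis could meet the upward cut; there [Hy2], which places [w]
       above the broken line, makes [Im v] negative. *)
    destruct (Req_dec (Re v) 0) as [Z|Z].
    * assert (X : Re w = s * (1 - t ^ 8)).
      { unfold v in Z. rewrite leg_coord in Z. unfold Re in *; simpl in *. lra. }
      assert (Y : Im v = - t ^ 8 - Im w).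
      { unfold v. rewrite leg_coord. unfold Im; simpl. ring. }
      rewrite X, Rabs_leg in Hy2 by trivial. pose proof (Cmod_ge_0 v). lra.
    * pose proof (Cmod2_alt v) as M. pose proof (pow2_gt_0 _ Z). pose proof (Cmod_ge_0 v).
      destruct (Rle_dec (Im v) 0); [|nra].
      destruct (Req_dec (Cmod v) 0) as [E0|]; [|lra]. rewrite E0 in M. pose proof (pow2_ge_0 (Im v)). lra.
  + eapply path_derive_eq; [apply (path_derive_plus (leg s 1) (fun _ => - w)%C); [apply path_derive_leg|apply path_derive_const]|ring].
- apply winding_cont; auto.
Qed.

(** The values at the feet cancel. At [1 - w], in the right half-plane, the two branches agree, and
    at [-1 - w] they differ by [2 PI i]. The path along the chord and back along the broken line
    runs clockwise around [w]. *)
Lemma winding_sum : (winding (-1) 0 - winding 1 0 - (winding (-1) 1 - winding 1 1))%C = (- (0%R, (2 * PI)%R))%C.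
Proof.
rewrite !winding_chord, !winding_low by auto.
assert (X := Rabs_def2 _ _ Hx).
assert (E1 : Re (1 - w) = 1 - Re w) by (unfold Re; simpl; ring).
assert (E2 : Re (RtoC (-1) - w) = -1 - Re w) by (unfold Re; simpl; ring).
assert (A := log_down_up (1 - w) ltac:(rewrite E1; lra)).
assert (B := log_down_up (RtoC (-1) - w) ltac:(rewrite E2; lra)).
destruct (Rlt_dec 0 (Re (1 - w))); [|lra].
destruct (Rlt_dec 0 (Re (RtoC (-1) - w))); [lra|].
rewrite A, B. ring.
Qed.

(** On a leg, [L / (z - w)] is [L w / (z - w)] plus the difference quotient [g], which has the
    primitive [G]. The corner is outside the domain of [G], so the leg is cut at parameter [e]; the
    integrand is bounded, and the piece left out is [O(e)]. *)
Lemma leg_split (g g' G : C -> C) (s b : R) : (s = 1 \/ s = -1) -> (b = 0 \/ b = 1) ->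
  holo Om g g' -> (forall z, z <> w -> g z = ((L z - L w) * / (z - w))%C) -> (forall z, Om z -> is_Cderive G z (g z)) ->
  exists B, forall e, 0 < e < 1 ->
    Cmod (cauchy_transform 1 (ldens s b L) (leg s b) 0 1 w - L w * winding s b - (G (foot b) - G (leg s b e))) <= B * e.
Proof.
intros Hs Hb Hg Eg HG.
assert (Hb' : 0 <= b <= 1) by (destruct Hb as [-> | ->]; lra).
assert (Hleg : ccont_on (leg s b) 0 1) by apply leg_cont.
assert (Cl : ccont_on (ldens s b L) 0 1) by (apply (ldens_cont s b Hs Hb' Om L L' K); trivial).
assert (Hne : forall t, 0 <= t <= 1 -> leg s b t <> w).
{ intros t Ht E; apply (jump_ne s b t Hs Hb Ht). rewrite E; ring. }
set (I := fun t => (ldens s b L t * Cpow (/ (leg s b t - w)) 1 - L w * (/ (leg s b t - w) * dleg s b t))%C).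
assert (CI0 : ccont_on I 0 1).
{ intros t Ht; apply ccont_minus.
  - now apply cauchy_transform_conton with (a := 0) (b := 1).
  - apply ccont_mult; [apply ccont_const|]. now apply winding_cont. }
assert (E : (cauchy_transform 1 (ldens s b L) (leg s b) 0 1 w - L w * winding s b)%C = CInt I 0 1).
{ unfold cauchy_transform, winding. rewrite <- CInt_scal by (try lra; now apply winding_cont).
  rewrite <- CInt_minus; trivial; [lra|now apply cauchy_transform_conton|].
  intros t Ht. apply ccont_mult; [apply ccont_const|]. now apply winding_cont. }
destruct (ccont_on_bounded I 0 1 Rle_0_1 CI0) as [B [HB HB2]].
exists (2 * B). intros e He. rewrite E.
rewrite <- (CInt_Chasles I 0 e 1) by (trivial; lra).
rewrite (CInt_FTC (fun t => G (leg s b t)) I e 1); [|lra| |intros t Ht; apply CI0; lra].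
- rewrite leg_1.
  replace (CInt I 0 e + (G (foot b) - G (leg s b e)) - (G (foot b) - G (leg s b e)))%C with (CInt I 0 e) by ring.
  eapply Rle_trans; [apply (CInt_bound I 0 e B); [lra| |]|right; ring].
  + intros t Ht; apply CI0; lra.
  + intros t Ht; apply HB2; lra.
- intros t Ht. eapply path_derive_eq; [apply (path_derive_comp G (leg s b)); [|apply path_derive_leg]|].
  + apply HG, HT, leg_Tri; trivial; lra.
  + rewrite Eg by (apply Hne; lra). unfold I, ldens. simpl. ring.
Qed.

(** At parameter [e] the two legs issuing from a corner are joined by a vertical segment of length
    [e^8], on which [g] is [O(e^(-6))]; the increment of [G] is therefore even [O(e^2)]. *)
Lemma corner_close (g G : C -> C) (s : R) : (s = 1 \/ s = -1) ->
  (forall z, z <> w -> g z = ((L z - L w) * / (z - w))%C) -> (forall z, Om z -> is_Cderive G z (g z)) ->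
  exists B e0, 0 < e0 < 1 /\ forall e, 0 < e < e0 -> Cmod (G (leg s 0 e) - G (leg s 1 e)) <= B * e.
Proof.
intros Hs Eg HG.
set (rho := (1 - Rabs (Re w)) / 2). assert (Hrho : 0 < rho) by (unfold rho; lra).
assert (Hrho1 : rho < 1) by (unfold rho; pose proof (Rabs_pos (Re w)); lra).
exists (2 * ((Rabs K + Cmod (L w)) * / rho)), rho. split; [lra|].
intros e He.
assert (He8 : e ^ 8 <= e).
{ replace (e ^ 8) with (e * e ^ 7) by ring. assert (e ^ 7 <= 1 ^ 7) by (apply pow_incr; lra). rewrite pow1 in H. nra. }
assert (He8' : 0 < e ^ 8) by (apply pow_lt; lra).
set (a := leg s 1 e). set (b := leg s 0 e).
assert (Eab : (b - a)%C = (0, e ^ 8)).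
{ unfold a, b. rewrite !leg_coord. unfold Cminus, Cplus, Copp; cbn [fst snd]. f_equal; ring. }
assert (Cab : Cmod (b - a) = e ^ 8).
{ rewrite Eab. replace ((0, e ^ 8) : C) with (Ci * (e ^ 8)%R)%C by (unfold Ci, Cmult, RtoC; cbn [fst snd]; f_equal; ring).
  rewrite Cmod_mult, Cmod_Ci, Cmod_R, Rabs_pos_eq by lra. ring. }
assert (Seg : forall t : R, 0 <= t <= 1 -> (a + t * (b - a))%C = (s * (1 - e ^ 8), - ((1 - t) * e ^ 8))).
{ intros t Ht. rewrite Eab. unfold a. rewrite leg_coord. unfold Cplus, Cmult, RtoC; cbn [fst snd]. f_equal; ring. }
assert (Rl := Rabs_leg s Hs e ltac:(lra)).
assert (STri : forall t : R, 0 <= t <= 1 -> Tri (a + t * (b - a))%C).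
{ intros t Ht. rewrite Seg by trivial. unfold Tri, Re, Im; cbn [fst snd]. rewrite Rl. repeat split; try lra; nra. }
assert (Sdd : forall t : R, 0 <= t <= 1 -> e ^ 8 <= corner_dist (a + t * (b - a))%C).
{ intros t Ht. rewrite Seg by trivial. pose proof (corner_dist_ge (s * (1 - e ^ 8)) (- ((1 - t) * e ^ 8))) as D. rewrite Rl in D. lra. }
assert (M := is_Cderive_mvt G g a b ((Rabs K + Cmod (L w)) * / rho / e ^ 6)).
rewrite Cab in M.
assert (He6 : 0 < e ^ 6) by (apply pow_lt; lra).
assert (He61 : e ^ 6 <= 1) by (rewrite <- (pow1 6); apply pow_incr; lra).
eapply Rle_trans; [apply M|].
- intros t Ht. split; [apply HG, HT, STri, Ht|].
  set (z := (a + t * (b - a))%C).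
  assert (Hzw : rho <= Cmod (z - w)).
  { destruct (dist_coord z w) as [D _]. eapply Rle_trans; [|exact D].
    pose proof (Rabs_triang_inv (Re z) (Re w)) as T. assert (Ez : Re z = s * (1 - e ^ 8)) by (unfold z; rewrite Seg; trivial).
    rewrite Ez, Rl in T. rewrite Ez. unfold rho in *. lra. }
  assert (Hne : (z - w)%C <> 0%C) by (apply Cmod_gt_0; lra).
  rewrite Eg by (intros E; apply Hne; rewrite E; ring).
  rewrite Cmod_mult, Cmod_inv by trivial.
  assert (A := HK z e (STri t Ht) ltac:(lra) (Sdd t Ht)).
  assert (B1 : Cmod (L z - L w) <= (Rabs K + Cmod (L w)) / e ^ 6).
  { apply Rmult_le_reg_r with (e ^ 6); trivial.
    replace ((Rabs K + Cmod (L w)) / e ^ 6 * e ^ 6) with (Rabs K + Cmod (L w)) by (field; lra).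
    pose proof (Cmod_triangle_sub (L z) (L w)). pose proof (Rle_abs K). pose proof (Cmod_ge_0 (L w)). nra. }
  assert (B2 : / Cmod (z - w) <= / rho) by (apply Rinv_le_contravar; trivial).
  replace ((Rabs K + Cmod (L w)) * / rho / e ^ 6) with ((Rabs K + Cmod (L w)) / e ^ 6 * / rho) by (field; lra).
  apply Rmult_le_compat; trivial; [apply Cmod_ge_0|]. left; apply Rinv_0_lt_compat; lra.
- replace (2 * ((Rabs K + Cmod (L w)) * / rho / e ^ 6) * e ^ 8) with (2 * ((Rabs K + Cmod (L w)) * / rho) * e ^ 2) by (field; lra).
  apply Rmult_le_compat_l.
  + pose proof (Rabs_pos K). pose proof (Cmod_ge_0 (L w)). assert (0 < / rho) by now apply Rinv_0_lt_compat. nra.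
  + simpl; nra.
Qed.

(** Cauchy's formula for the triangle with its corners cut off. Adding [leg_split] over the four
    legs, the values of [G] at the feet cancel, those near the corners differ by [O(e)], and the
    windings contribute [- 2 PI i L w]. Then [e] tends to 0. *)
Lemma jump :
  (cauchy_transform 1 (ldens (-1) 0 L) (leg (-1) 0) 0 1 w - cauchy_transform 1 (ldens 1 0 L) (leg 1 0) 0 1 w)%C =
  (cauchy_transform 1 (ldens (-1) 1 L) (leg (-1) 1) 0 1 w - cauchy_transform 1 (ldens 1 1 L) (leg 1 1) 0 1 w - (0%R, (2 * PI)%R) * L w)%C.
Proof.
assert (HOw : Om w) by (apply HT; unfold Tri; repeat split; lra).
destruct (diff_quotient_holo Om L L' w HO HOw HL) as [g [g' [Hg Eg]]].
destruct (primitive_convex Om g g' w HO HC HOw Hg) as [G HG].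
destruct (leg_split g g' G (-1) 0) as [B1 H1]; auto.
destruct (leg_split g g' G 1 0) as [B2 H2]; auto.
destruct (leg_split g g' G (-1) 1) as [B3 H3]; auto.
destruct (leg_split g g' G 1 1) as [B4 H4]; auto.
destruct (corner_close g G (-1)) as [B5 [e5 [He5 H5]]]; auto.
destruct (corner_close g G 1) as [B6 [e6 [He6 H6]]]; auto.
pose proof winding_sum as HW.
set (U1 := cauchy_transform 1 (ldens (-1) 0 L) _ _ _ _) in *. set (U2 := cauchy_transform 1 (ldens 1 0 L) _ _ _ _) in *.
set (U3 := cauchy_transform 1 (ldens (-1) 1 L) _ _ _ _) in *. set (U4 := cauchy_transform 1 (ldens 1 1 L) _ _ _ _) in *.
set (W := (0%R, (2 * PI)%R) : C) in *.
set (S := (U1 - U2 - (U3 - U4 - W * L w))%C).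
enough (HS : S = 0%C).
{ rewrite <- (Cplus_0_r (U3 - U4 - W * L w)), <- HS. unfold S. ring. }
set (B := Rabs B1 + Rabs B2 + Rabs B3 + Rabs B4 + Rabs B5 + Rabs B6).
assert (HB : 0 <= B) by (unfold B; pose proof (Rabs_pos B1); pose proof (Rabs_pos B2); pose proof (Rabs_pos B3);
  pose proof (Rabs_pos B4); pose proof (Rabs_pos B5); pose proof (Rabs_pos B6); lra).
assert (Key : forall e, 0 < e < Rmin e5 e6 -> Cmod S <= B * e).
{ intros e He.
  assert (e < e5) by (eapply Rlt_le_trans; [apply He|apply Rmin_l]).
  assert (e < e6) by (eapply Rlt_le_trans; [apply He|apply Rmin_r]).
  specialize (H1 e ltac:(lra)); specialize (H2 e ltac:(lra)); specialize (H3 e ltac:(lra)); specialize (H4 e ltac:(lra)).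
  specialize (H5 e ltac:(lra)); specialize (H6 e ltac:(lra)).
  set (R1 := (U1 - L w * winding (-1) 0 - (G (foot 0) - G (leg (-1) 0 e)))%C) in *.
  set (R2 := (U2 - L w * winding 1 0 - (G (foot 0) - G (leg 1 0 e)))%C) in *.
  set (R3 := (U3 - L w * winding (-1) 1 - (G (foot 1) - G (leg (-1) 1 e)))%C) in *.
  set (R4 := (U4 - L w * winding 1 1 - (G (foot 1) - G (leg 1 1 e)))%C) in *.
  set (R5 := (G (leg (-1) 0 e) - G (leg (-1) 1 e))%C) in *.
  set (R6 := (G (leg 1 0 e) - G (leg 1 1 e))%C) in *.
  assert (ES : S = (R1 - R2 - (R3 - R4) - (R5 - R6))%C).
  { transitivity (R1 - R2 - (R3 - R4) - (R5 - R6) + L w * (winding (-1) 0 - winding 1 0 - (winding (-1) 1 - winding 1 1) + W))%C.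
    - unfold S, R1, R2, R3, R4, R5, R6; ring.
    - rewrite HW. ring. }
  rewrite ES.
  pose proof (Cmod_triangle_sub (R1 - R2 - (R3 - R4)) (R5 - R6)).
  pose proof (Cmod_triangle_sub (R1 - R2) (R3 - R4)).
  pose proof (Cmod_triangle_sub R1 R2). pose proof (Cmod_triangle_sub R3 R4). pose proof (Cmod_triangle_sub R5 R6).
  pose proof (Rle_abs B1); pose proof (Rle_abs B2); pose proof (Rle_abs B3); pose proof (Rle_abs B4); pose proof (Rle_abs B5); pose proof (Rle_abs B6).
  unfold B. nra. }
apply Cmod_eq_0, Rle_antisym; [|apply Cmod_ge_0].
apply Rnot_lt_le; intros HS0.
assert (He0 : 0 < Rmin e5 e6) by (apply Rmin_pos; lra).
set (e := Rmin (Rmin e5 e6 / 2) (Cmod S / (2 * (B + 1)))).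
assert (Hq : 0 < Cmod S / (2 * (B + 1))) by (apply Rdiv_lt_0_compat; lra).
assert (He1 : 0 < e) by (apply Rmin_pos; lra).
assert (He2 : e <= Rmin e5 e6 / 2) by apply Rmin_l.
assert (He3 : e <= Cmod S / (2 * (B + 1))) by apply Rmin_r.
specialize (Key e ltac:(lra)).
assert (B * e <= (B + 1) * (Cmod S / (2 * (B + 1)))) by nra.
replace ((B + 1) * (Cmod S / (2 * (B + 1)))) with (Cmod S / 2) in H by (field; lra). lra.
Qed.
End Jump.

(* The Cauchy transforms of [L] along the chord from -1 to 1 and along the broken line through -i
   split [L] additively on the triangle between the two paths. *)
Lemma cauchy_splitting (Om : C -> Prop) (L L' : C -> C) (K : R) :
  openC Om -> convexC Om -> holo Om L L' -> (forall w, Tri w -> Om w) ->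
  (forall w q, Tri w -> 0 < q -> q ^ 8 <= corner_dist w -> Cmod (L w) * q ^ 6 <= K) ->
  exists lo lo' up up' K',
    holo (fun w => Im w < 0) lo lo' /\
    holo (fun w => - (1 - Rabs (Re w)) < Im w) up up' /\
    (forall w, Rabs (Re w) < 1 -> - (1 - Rabs (Re w)) < Im w < 0 -> lo w = (up w - L w)%C) /\
    (forall w q, Im w <= - (1 - Rabs (Re w)) / 2 -> 0 < q -> q ^ 8 <= corner_dist w ->
       Cmod (lo w) * q ^ 7 <= K' /\ Cmod (lo' w) * q ^ 16 <= K') /\
    (forall w q, - (1 - Rabs (Re w)) / 2 <= Im w -> 0 < q -> q ^ 8 <= corner_dist w ->
       Cmod (up w) * q ^ 7 <= K' /\ Cmod (up' w) * q ^ 16 <= K').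
Proof.
intros HO HC HL HT HK.
set (c := (/ (0%R, (2 * PI)%R))%C).
assert (Hc0 : ((0%R, (2 * PI)%R) : C) <> 0%C).
{ intros E; apply (f_equal Im) in E; simpl in E. pose proof PI_RGT_0; lra. }
assert (Hm : -1 = 1 \/ -1 = -1) by auto. assert (Hp : 1 = 1 \/ 1 = -1) by auto.
assert (H00 : 0 <= 0 <= 1) by lra. assert (H11 : 0 <= 1 <= 1) by lra.
(* Leg [s = -1] minus leg [s = 1] is a path from -1 to 1, along the chord for [b = 0] and along the
   broken line for [b = 1]; [c] is [1 / (2 PI i)]. *)
set (V := fun b n w => (c * (cauchy_transform n (ldens (-1) b L) (leg (-1) b) 0 1 w - cauchy_transform n (ldens 1 b L) (leg 1 b) 0 1 w))%C).
assert (K0 : 0 <= K).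
{ assert (A := HK (leg 1 0 1) 1 (leg_Tri 1 0 Hp H00 1 ltac:(lra)) Rlt_0_1 (leg_corner_dist 1 0 Hp 1 ltac:(lra))).
  pose proof (Cmod_ge_0 (L (leg 1 0 1))). simpl in A. lra. }
assert (HV : forall b w r, (b = 0 \/ b = 1) -> 0 < r ->
   (forall s t, (s = 1 \/ s = -1) -> 0 <= t <= 1 -> r <= Cmod (leg s b t - w)) ->
   is_Cderive (V b 1%nat) w (V b 2%nat w) /\ ccont (V b 2%nat) w).
{ intros b w r Hb Hr Hfar. assert (Hb' : 0 <= b <= 1) by (destruct Hb as [-> | ->]; lra).
  assert (D : forall s, (s = 1 \/ s = -1) ->
     is_Cderive (cauchy_transform 1 (ldens s b L) (leg s b) 0 1) w (cauchy_transform 2 (ldens s b L) (leg s b) 0 1 w) /\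
     ccont (cauchy_transform 2 (ldens s b L) (leg s b) 0 1) w).
  { intros s Hs.
    assert (Cl : ccont_on (ldens s b L) 0 1) by (apply (ldens_cont s b Hs Hb' Om L L' K); trivial).
    assert (Cg : ccont_on (leg s b) 0 1) by apply leg_cont.
    split.
    - apply (cauchy_transform1_derive _ _ _ _ Rle_0_1 Cl Cg w r Hr). intros t Ht; now apply Hfar.
    - exact (is_Cderive_cont _ _ _ (cauchy_transform2_derive _ _ _ _ Rle_0_1 Cl Cg w r Hr (fun t Ht => Hfar s t Hs Ht))). }
  destruct (D (-1) Hm) as [D1 C1], (D 1 Hp) as [D2 C2]. split.
  - unfold V. eapply is_Cderive_eq; [apply (is_Cderive_mult (fun _ => c)); [apply is_Cderive_const|]|].
    + apply (is_Cderive_plus _ (fun w => - cauchy_transform 1 (ldens 1 b L) (leg 1 b) 0 1 w)%C); [exact D1|].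
      apply (is_Cderive_ext_loc (fun w => - (1) * cauchy_transform 1 (ldens 1 b L) (leg 1 b) 0 1 w)%C _ _ _ 1); [lra|intros; ring|].
      apply (is_Cderive_mult (fun _ => - (1))%C); [apply is_Cderive_const|exact D2].
    + ring.
  - unfold V. apply ccont_mult; [apply ccont_const|now apply ccont_minus]. }
(* [2304] is twice [1152], for the two legs; it also covers twice [224]. *)
assert (BV : forall b w q, (b = 0 \/ b = 1) -> (forall s t, (s = 1 \/ s = -1) -> 0 <= t <= 1 -> corner_dist w <= 6 * Cmod (leg s b t - w)) ->
   0 < q -> q ^ 8 <= corner_dist w ->
   Cmod (V b 1%nat w) * q ^ 7 <= Cmod c * (2304 * K) /\ Cmod (V b 2%nat w) * q ^ 16 <= Cmod c * (2304 * K)).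
{ intros b w q Hb Hfar Hq Hq8. assert (Hb' : 0 <= b <= 1) by (destruct Hb as [-> | ->]; lra).
  destruct (leg_transform_bounds (-1) b Hm Hb' Om L L' K HL HT HK w q) as [A1 A2]; auto.
  destruct (leg_transform_bounds 1 b Hp Hb' Om L L' K HL HT HK w q) as [A3 A4]; auto.
  assert (0 < q ^ 7) by now apply pow_lt. assert (0 < q ^ 16) by now apply pow_lt.
  unfold V; rewrite !Cmod_mult, !Rmult_assoc. pose proof (Cmod_ge_0 c).
  split; apply Rmult_le_compat_l; trivial.
  - pose proof (Cmod_triangle_sub (cauchy_transform 1 (ldens (-1) b L) (leg (-1) b) 0 1 w) (cauchy_transform 1 (ldens 1 b L) (leg 1 b) 0 1 w)). nra.
  - pose proof (Cmod_triangle_sub (cauchy_transform 2 (ldens (-1) b L) (leg (-1) b) 0 1 w) (cauchy_transform 2 (ldens 1 b L) (leg 1 b) 0 1 w)). nra. }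
exists (V 0 1%nat), (V 0 2%nat), (V 1 1%nat), (V 1 2%nat), (Cmod c * (2304 * K)).
repeat split.
- apply (HV 0 z (- Im z)); auto; [lra|]. intros s t Hs Ht; apply chord_far.
- apply (HV 0 z (- Im z)); auto; [lra|]. intros s t Hs Ht; apply chord_far.
- apply (HV 1 z ((Im z + (1 - Rabs (Re z))) / 2)); auto; [lra|]. intros s t Hs Ht; now apply low_leg_far.
- apply (HV 1 z ((Im z + (1 - Rabs (Re z))) / 2)); auto; [lra|]. intros s t Hs Ht; now apply low_leg_far.
- intros w Hx Hy. unfold V. rewrite (jump Om L L' K HO HC HL HT HK w Hx ltac:(lra) ltac:(lra)).
  unfold c. field. exact Hc0.
- apply (BV 0 w q); auto. intros s t Hs Ht; now apply below_far.
- apply (BV 0 w q); auto. intros s t Hs Ht; now apply below_far.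
- apply (BV 1 w q); auto. intros s t Hs Ht; now apply above_far.
- apply (BV 1 w q); auto. intros s t Hs Ht; now apply above_far.
Qed.

(** * Good end points *)

(** The root has order [S n]: [nth_root 7] and [nth_root 15] are the eighth and sixteenth roots that
    stand in for real powers. *)
Lemma nth_root (n : nat) (x : R) : 0 < x -> exists q, 0 < q /\ q ^ S n = x.
Proof.
intros Hx. exists (Rpower x (/ INR (S n))); split; [apply exp_pos|].
rewrite <- Rpower_pow by apply exp_pos. rewrite Rpower_mult, Rinv_l by (apply not_0_INR; discriminate).
now apply Rpower_1.
Qed.

Lemma pow_le_inv (n : nat) (p q : R) : 0 <= p -> 0 <= q -> p ^ S n <= q ^ S n -> p <= q.
Proof.
intros Hp Hq H. apply Rnot_lt_le; intros Hlt.
assert (q ^ n <= p ^ n) by (apply pow_incr; lra).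
assert (0 < p ^ n) by (apply pow_lt; lra).
assert (0 <= q ^ n) by (apply pow_le; lra). simpl in H. nra.
Qed.

Lemma seg_Cmod (a b : C) (t : R) : 0 <= t <= 1 -> Cmod (a + t * (b - a)) <= (1 - t) * Cmod a + t * Cmod b.
Proof.
intros Ht. replace (a + t * (b - a))%C with ((1 - t)%R * a + t * b)%C by (rewrite RtoC_minus; ring).
eapply Rle_trans; [apply Cmod_triangle|]. rewrite !Cmod_mult, !Cmod_R, !Rabs_pos_eq; lra.
Qed.

Lemma seg_dist (a b c : C) (t m : R) : 0 <= t <= 1 -> Cmod (a - c) <= m -> Cmod (b - c) <= m ->
  Cmod (a + t * (b - a) - c) <= m.
Proof.
intros Ht Ha Hb. replace (a + t * (b - a) - c)%C with ((a - c) + t * ((b - c) - (a - c)))%C by ring.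
eapply Rle_trans; [now apply seg_Cmod|]. nra.
Qed.

Lemma is_derive_weighted (f : R -> R) (l k M t : R) : is_derive f t l ->
  is_derive (fun t => (M - f t) * exp (- (8 * k) * t)) t ((- l - 8 * k * (M - f t)) * exp (- (8 * k) * t)).
Proof.
intros D. auto_derive.
- exists l; exact D.
- replace (Derive (fun x => f x) t) with l by (symmetry; now apply is_derive_unique). ring.
Qed.

(** A Gronwall argument. Along the segment [derive_bound_Re] with radius [r / 2] bounds [Cmod L'] by
    [8 / r (M - Re L)], so [(M - Re L) exp (- 8 k t)] does not increase. The resulting bound for
    [L'] is then integrated, which controls the imaginary part too. *)
Lemma harnack_chain (U : C -> Prop) (L L' : C -> C) (a b : C) (r k M : R) :
  holo U L L' -> 0 < r -> 0 <= k -> Cmod (b - a) <= k * r ->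
  (forall (t : R) (z : C), 0 <= t <= 1 -> Cmod (z - (a + t * (b - a))) < r -> U z /\ Re (L z) <= M) ->
  Cmod (L b - L a) <= 16 * k * exp (8 * k) * (M - Re (L a)).
Proof.
intros HL Hr Hk Hab Hball.
set (z := fun t : R => (a + t * (b - a))%C).
assert (H0 : forall t : R, Cmod (z t - z t) < r).
{ intros t. now rewrite Cmod_diag. }
assert (HB : forall t, 0 <= t <= 1 -> Cmod (L' (z t)) <= 8 / r * (M - Re (L (z t)))).
{ intros t Ht. replace (8 / r) with (4 / (r / 2)) by (field; lra).
  apply (derive_bound_Re (z t) (r / 2) r M L L'); try lra.
  - apply (holo_sub U); trivial. intros v Hv; now apply (Hball t).
  - intros v Hv; now apply (Hball t). }
assert (Hv0 : forall t, 0 <= t <= 1 -> 0 <= M - Re (L (z t))).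
{ intros t Ht. destruct (Hball t (z t) Ht (H0 t)); lra. }
set (v := fun t => (M - Re (L (z t))) * exp (- (8 * k) * t)).
set (dv := fun t => (- Re (L' (z t) * (b - a)) - 8 * k * (M - Re (L (z t)))) * exp (- (8 * k) * t)).
assert (Dv : forall t, 0 <= t <= 1 -> is_derive v t (dv t)).
{ intros t Ht.
  assert (D : path_derive (fun t => L (z t)) t (L' (z t) * (b - a))%C).
  { apply path_derive_comp; [|apply path_derive_affine]. apply HL. now apply (Hball t). }
  destruct D as [D _]. exact (is_derive_weighted _ _ k M t D). }
assert (Neg : forall t, 0 <= t <= 1 -> dv t <= 0).
{ intros t Ht; unfold dv.
  assert (E := exp_pos (- (8 * k) * t)).
  assert (N : - Re (L' (z t) * (b - a)) - 8 * k * (M - Re (L (z t))) <= 0); [|nra].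
  pose proof (re_le_Cmod (L' (z t) * (b - a))) as A. rewrite Cmod_mult in A.
  pose proof (Rabs_maj2 (Re (L' (z t) * (b - a)))).
  assert (Cmod (L' (z t)) * Cmod (b - a) <= (8 / r * (M - Re (L (z t)))) * (k * r)).
  { apply Rmult_le_compat; auto using Cmod_ge_0. }
  replace ((8 / r * (M - Re (L (z t)))) * (k * r)) with (8 * k * (M - Re (L (z t)))) in H1 by (field; lra). lra. }
assert (Hv : forall t, 0 <= t <= 1 -> M - Re (L (z t)) <= exp (8 * k) * (M - Re (L a))).
{ intros t Ht.
  destruct (MVT_gen v 0 t dv) as [c [Hc E]].
  - intros x Hx; rewrite Rmin_left, Rmax_right in Hx by lra. apply Dv; lra.
  - intros x Hx; rewrite Rmin_left, Rmax_right in Hx by lra.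
    apply continuity_pt_filterlim, (ex_derive_continuous v). exists (dv x); apply Dv; lra.
  - rewrite Rmin_left, Rmax_right in Hc by lra.
    assert (V : v t <= v 0) by (pose proof (Neg c ltac:(lra)); nra).
    unfold v in V. rewrite Rmult_0_r, exp_0, Rmult_1_r in V.
    replace (z 0) with a in V by (unfold z; ring).
    assert (E1 : exp (8 * k * t) * exp (- (8 * k) * t) = 1) by (rewrite <- exp_plus, <- exp_0; f_equal; ring).
    assert (P1 := exp_pos (8 * k * t)).
    assert (E2 : exp (8 * k * t) <= exp (8 * k)).
    { destruct (Rle_lt_or_eq_dec (8 * k * t) (8 * k)) as [Hl|He]; [nra| |rewrite He; lra].
      left; now apply exp_increasing. }
    assert (Ha := Hv0 0 ltac:(lra)). replace (z 0) with a in Ha by (unfold z; ring).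
    apply (Rmult_le_compat_l (exp (8 * k * t))) in V; [|lra].
    replace (exp (8 * k * t) * ((M - Re (L (z t))) * exp (- (8 * k) * t))) with ((exp (8 * k * t) * exp (- (8 * k) * t)) * (M - Re (L (z t)))) in V by ring.
    rewrite E1 in V. nra. }
assert (Ha := Hv0 0 ltac:(lra)). replace (z 0) with a in Ha by (unfold z; ring).
assert (B := is_Cderive_mvt L L' a b (8 / r * (exp (8 * k) * (M - Re (L a))))).
eapply Rle_trans; [apply B|].
- intros t Ht; split; [apply HL, (Hball t (z t) Ht (H0 t))|].
  eapply Rle_trans; [now apply HB|]. apply Rmult_le_compat_l; [apply Rlt_le, Rdiv_lt_0_compat; lra|]. now apply Hv.
- assert (0 <= exp (8 * k) * (M - Re (L a))) by (apply Rmult_le_pos; [left; apply exp_pos|trivial]).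
  apply Rle_trans with (2 * (8 / r * (exp (8 * k) * (M - Re (L a)))) * (k * r)).
  + apply Rmult_le_compat_l; trivial. apply Rmult_le_pos; [lra|]. apply Rmult_le_pos; trivial. apply Rlt_le, Rdiv_lt_0_compat; lra.
  + right; field; lra.
Qed.

(** If [f] stayed below the stated value on the arc then, with [f <= M] elsewhere, its mean would be
    less than [m]. The deficit [m - M] is divided by the fraction [al / (2 PI)] of the circle; the
    [- 1] makes the contradiction strict. *)
Lemma exists_in_arc (f : R -> R) (m M al : R) : 0 < al -> al <= 2 * PI ->
  (forall t, 0 <= t <= 2 * PI -> continuous f t) -> RInt f 0 (2 * PI) = 2 * PI * m ->
  (forall t, 0 <= t <= 2 * PI -> f t <= M) -> 0 <= M ->
  exists t, 0 <= t <= al /\ 2 * PI / al * (m - M) - 1 <= f t.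
Proof.
intros Hal Hal2 Cf If HM HM0.
apply NNPP; intros N.
assert (B : forall t, 0 <= t <= al -> f t <= 2 * PI / al * (m - M) - 1).
{ intros t Ht. apply Rnot_lt_le; intros H; apply N; exists t; split; lra. }
assert (Ex : forall a b, 0 <= a -> a <= b -> b <= 2 * PI -> ex_RInt f a b).
{ intros a b Ha Hab Hb; apply (ex_RInt_continuous (V := R_CompleteNormedModule)); intros t Ht.
  rewrite Rmin_left, Rmax_right in Ht by lra. apply Cf; lra. }
assert (Ch := RInt_Chasles f 0 al (2 * PI) (Ex 0 al ltac:(lra) ltac:(lra) Hal2) (Ex al (2 * PI) ltac:(lra) Hal2 ltac:(lra))).
unfold plus in Ch; simpl in Ch.
assert (I1 : RInt f 0 al <= RInt (fun _ => 2 * PI / al * (m - M) - 1) 0 al).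
{ apply RInt_le; [lra|apply Ex; lra|apply ex_RInt_const|]. intros t Ht; apply B; lra. }
assert (I2 : RInt f al (2 * PI) <= RInt (fun _ => M) al (2 * PI)).
{ apply RInt_le; [lra|apply Ex; lra|apply ex_RInt_const|]. intros t Ht; apply HM; lra. }
rewrite RInt_const in I1, I2. unfold scal in I1, I2; simpl in I1, I2; unfold mult in I1, I2; simpl in I1, I2.
rewrite If in Ch.
replace ((al - 0) * (2 * PI / al * (m - M) - 1)) with (2 * PI * (m - M) - al) in I1 by (field; lra). nra.
Qed.

Lemma holo_rotate (e : C) (V : C -> Prop) (L L' : C -> C) :
  holo V L L' -> holo (fun z => V (e * z)%C) (fun z => L (e * z)%C) (fun z => L' (e * z) * e)%C.
Proof.
intros HL. eapply holo_ext; [|apply (holo_comp (fun z => V (e * z)%C) V L L' (fun z => e * z)%C (fun z => e * 1)%C); trivial].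
- intros z; simpl; ring.
- apply holo_scal, holo_id.
Qed.

Section GreedyStep.
Context (L L' : C -> C) (z : C) (t : R) (Ht : t = 1 - Cmod z) (Ht0 : 0 < t) (Hz : 1 / 2 <= Cmod z).
Context (HL : holo (fun v => Cmod (v - z) < t) L L').

(* Mean value over the circle of radius (1 - 1/400000) t: a point of its outer arc [0, 1/200]
   cannot be too negative, although this arc has height at most t / 65536. *)
Lemma greedy_step (M : R) : 0 <= M -> (forall v, Cmod (v - z) < t -> t / 400000 <= 1 - Cmod v -> Re (L v) <= M) ->
  exists z', Cmod (z' - z) <= t /\ t / 400000 <= 1 - Cmod z' <= t / 65536 /\ - Re (L z') <= 1600 * (M - Re (L z)) + 1.
Proof.
intros HM0 HM.
(* Rotating by [e] moves [z] to the positive real axis, so that the outermost point of the circle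
   has angle 0. *)
set (e := (z * / Cmod z)%C).
assert (HCz : RtoC (Cmod z) <> 0%C) by (intros E; apply RtoC_inj in E; lra).
assert (He : Cmod e = 1).
{ unfold e. rewrite Cmod_mult, Cmod_inv by trivial. rewrite Cmod_R, Rabs_pos_eq by lra. field; lra. }
assert (Hez : (e * Cmod z)%C = z) by (unfold e; field; trivial).
set (x := RtoC (Cmod z)) in *.
assert (Hrot : forall v, Cmod (e * v - z) = Cmod (v - x)).
{ intros v. rewrite <- Hez. replace (e * v - e * x)%C with (e * (v - x))%C by ring. rewrite Cmod_mult, He; ring. }
set (rho := t * (1 - 1 / 400000)).
assert (Hrho : 0 < rho) by (unfold rho; nra).
assert (Hrho1 : rho < t) by (unfold rho; nra).
assert (HR : holo (fun v => Cmod (v - x) < t) (fun v => L (e * v)%C) (fun v => L' (e * v) * e)%C).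
{ apply (holo_sub (fun v => Cmod (e * v - z) < t)).
  - intros v Hv; now rewrite Hrot.
  - exact (holo_rotate e _ L L' HL). }
assert (MV := mean_value x rho Hrho t Hrho1 _ _ HR).
apply (f_equal Re) in MV. unfold CInt in MV; simpl in MV. rewrite Rmult_0_l, Rminus_0_r, Hez in MV.
set (f := fun s => Re (L (e * circ x rho s)%C)).
assert (Hin : forall s, Cmod (e * circ x rho s - z) < t).
{ intros s. rewrite Hrot, Cmod_circ by lra. trivial. }
assert (Hht : forall s, t / 400000 <= 1 - Cmod (e * circ x rho s)).
{ intros s. rewrite Cmod_mult, He. unfold circ.
  pose proof (Cmod_triangle x (rho * eit s)) as T. rewrite Cmod_mult, Cmod_eit in T.
  unfold x in T at 2. rewrite !Cmod_R, !Rabs_pos_eq in T by lra. unfold rho in *. lra. }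
destruct (exists_in_arc f (Re (L z)) M (1 / 200)) as [s [Hs Hf]].
- lra.
- pose proof PI_RGT_0. pose proof PI2_1. lra.
- intros s _. apply (ccont_Re (fun s => L (e * circ x rho s)%C)).
  apply (continuous_comp (circ x rho) (fun v => L (e * v)%C)); [apply ccont_circ|].
  apply (holo_cont _ _ _ _ HR). rewrite Cmod_circ; lra.
- exact MV.
- intros s _. now apply HM.
- trivial.
- exists (e * circ x rho s)%C. split; [|split; [split|]].
  + left; apply Hin.
  + apply Hht.
  + rewrite Cmod_mult, He.
    pose proof (re_le_Cmod (circ x rho s)) as A. pose proof (Rle_abs (Re (circ x rho s))) as B.
    assert (E : Re (circ x rho s) = Cmod z + rho * cos s) by (unfold circ, x, eit, Re; simpl; ring).
    pose proof (cos_near s) as Cs. pose proof (Rle_abs (- (cos s - 1))) as Cs2. rewrite Rabs_Ropp in Cs2.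
    (* For [s <= 1/200] the relative height is at most [1/400000 + 1/80000], just below
       [1/65536 = 4^(-8)]. *)
    assert (s ^ 2 <= 1 / 40000) by (simpl; nra).
    assert (1 - 1 / 80000 <= cos s) by lra.
    assert (rho * (1 - 1 / 80000) <= rho * cos s) by (apply Rmult_le_compat_l; lra).
    unfold rho in *. lra.
  + assert (HMz : 0 <= M - Re (L z)).
    { enough (Re (L z) <= M) by lra. apply HM; [|lra]. now rewrite Cmod_diag. }
    (* The loss is [2 PI / (1/200) = 400 PI], at most 1600. *)
    pose proof PI_4. unfold f in Hf.
    replace (2 * PI / (1 / 200) * (Re (L z) - M)) with (- (400 * PI * (M - Re (L z)))) in Hf by field. nra.
Qed.
End GreedyStep.

(** As [t] at least halves, the intervals of radius [2 t n] about each coordinate of [Z n] are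
    nested; a common point of each family gives [p], and the two coordinates add up to 4. *)
Lemma limit_of_steps (Z : nat -> C) (t : nat -> R) :
  (forall n, 0 <= t n) -> (forall n, t (S n) <= t n / 2) -> (forall n, Cmod (Z (S n) - Z n) <= t n) ->
  exists p, forall n, Cmod (p - Z n) <= 4 * t n.
Proof.
intros H0 H2 HZ.
assert (Gen : forall x : nat -> R, (forall n, Rabs (x (S n) - x n) <= t n) -> exists l, forall n, Rabs (l - x n) <= 2 * t n).
{ intros x Hx.
  assert (Inc : forall n k, x n - 2 * t n <= x (n + k)%nat - 2 * t (n + k)%nat).
  { intros n; induction k as [|k IH]; [rewrite Nat.add_0_r; lra|].
    rewrite Nat.add_succ_r. specialize (Hx (n + k)%nat). specialize (H2 (n + k)%nat).
    apply Rabs_le_between in Hx. lra. }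
  assert (Dec : forall n k, x (n + k)%nat + 2 * t (n + k)%nat <= x n + 2 * t n).
  { intros n; induction k as [|k IH]; [rewrite Nat.add_0_r; lra|].
    rewrite Nat.add_succ_r. specialize (Hx (n + k)%nat). specialize (H2 (n + k)%nat).
    apply Rabs_le_between in Hx. lra. }
  assert (Bd : forall n m, x n - 2 * t n <= x m + 2 * t m).
  { intros n m. pose proof (Inc n m). pose proof (Dec m n). rewrite (Nat.add_comm m n) in H1. specialize (H0 (n + m)%nat). lra. }
  destruct (completeness (fun v => exists n, v = x n - 2 * t n)) as [l [Hl1 Hl2]].
  - exists (x O + 2 * t O). intros v [n ->]. apply Bd.
  - exists (x O - 2 * t O), O. trivial.
  - exists l. intros n. apply Rabs_le. split.
    + specialize (Hl1 (x n - 2 * t n) (ex_intro _ n eq_refl)). lra.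
    + specialize (Hl2 (x n + 2 * t n)). enough (l <= x n + 2 * t n) by lra. apply Hl2. intros v [m ->]. apply Bd. }
destruct (Gen (fun n => Re (Z n))) as [p1 H1].
{ intros n. eapply Rle_trans; [|apply (HZ n)].
  replace (Re (Z (S n)) - Re (Z n)) with (Re (Z (S n) - Z n)) by (unfold Re; simpl; ring). apply re_le_Cmod. }
destruct (Gen (fun n => Im (Z n))) as [p2 H3].
{ intros n. eapply Rle_trans; [|apply (HZ n)].
  replace (Im (Z (S n)) - Im (Z n)) with (Im (Z (S n) - Z n)) by (unfold Im; simpl; ring). apply Im_le_Cmod. }
exists (p1, p2). intros n. eapply Rle_trans; [apply Cmod_le_Re_Im|].
replace (Re ((p1, p2) - Z n)) with (p1 - Re (Z n)) by (unfold Re; simpl; ring).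
replace (Im ((p1, p2) - Z n)) with (p2 - Im (Z n)) by (unfold Im; simpl; ring).
specialize (H1 n); specialize (H3 n). lra.
Qed.

Lemma halving_small (t : nat -> R) : (forall n, 0 <= t n) -> (forall n, t (S n) <= t n / 2) ->
  forall eps, 0 < eps -> exists n, t n < eps.
Proof.
intros H0 H2 eps He.
assert (B : forall n, t n <= t O * (1 / 2) ^ n).
{ induction n as [|n IH]; [simpl; lra|]. specialize (H2 n). simpl. lra. }
destruct (pow_lt_1_zero (1 / 2) ltac:(rewrite Rabs_pos_eq; lra) (eps / (t O + 1))) as [N HN].
- apply Rdiv_lt_0_compat; trivial. specialize (H0 O); lra.
- exists N. specialize (HN N (Nat.le_refl N)). specialize (B N). specialize (H0 O).
  rewrite Rabs_pos_eq in HN by (apply pow_le; lra).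
  apply (Rmult_lt_compat_r (t O + 1)) in HN; [|lra].
  replace (eps / (t O + 1) * (t O + 1)) with eps in HN by (field; lra).
  assert (0 <= (1 / 2) ^ N) by (apply pow_le; lra). lra.
Qed.

Definition cap (xi : C) (del : R) (z : C) : Prop := Cmod z < 1 /\ Cmod (z - xi) < del.

(* [Re L <= B (1 - |z|)^(-3/4)], stated without real powers. *)
Definition upper_growth (U : C -> Prop) (L : C -> C) (B : R) : Prop :=
  forall z q, U z -> 0 < q -> q ^ 8 <= 1 - Cmod z -> Re (L z) * q ^ 6 <= B.

(** The condition with [c] describes a Stolz angle at [p], and every aperture is allowed, each with
    its own [K]. The bound says [O(|z - p|^(-3/4))], with [q] in place of an eighth root. *)
Definition stolz_growth (xi : C) (del : R) (p : C) (L : C -> C) : Prop :=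
  forall c, 0 < c -> exists K, forall z q, cap xi del z -> c * Cmod (z - p) <= 1 - Cmod z ->
    0 < q -> q ^ 8 <= Cmod (z - p) -> Cmod (L z) * q ^ 6 <= K.

Section Endpoint.
Context (xi : C) (del : R) (Hxi : Cmod xi = 1) (Hdel : 0 < del).

(** Iterates [greedy_step]. The bound [- Re L q^6 <= A] reproduces itself: [q^6] shrinks by a factor
    of at least [4096] while the depth grows by at most [1600], and [A] is large enough to absorb
    the upper bound and the additive 1. *)
Lemma greedy_sequence (L L' : C -> C) (B eps : R) : 0 <= B -> 0 < eps <= 1 / 4 -> eps < del ->
  holo (cap xi del) L L' -> upper_growth (cap xi del) L B ->
  exists (Z : nat -> C) (A : R), forall n,
    0 < 1 - Cmod (Z n) <= eps / 2 /\ Cmod (Z n - xi) + 2 * (1 - Cmod (Z n)) <= eps /\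
    Cmod (Z (S n) - Z n) <= 1 - Cmod (Z n) /\
    (1 - Cmod (Z n)) / 400000 <= 1 - Cmod (Z (S n)) <= (1 - Cmod (Z n)) / 65536 /\
    (forall q, 0 < q -> q ^ 8 = 1 - Cmod (Z n) -> - Re (L (Z n)) * q ^ 6 <= A).
Proof.
intros HB Heps Hed HL Hup.
set (z0 := ((1 - eps / 3)%R * xi)%C).
assert (Hz0 : Cmod z0 = 1 - eps / 3).
{ unfold z0. rewrite Cmod_mult, Hxi, Cmod_R, Rabs_pos_eq; lra. }
assert (Hz0xi : Cmod (z0 - xi) = eps / 3).
{ unfold z0. replace ((1 - eps / 3)%R * xi - xi)%C with ((- (eps / 3))%R * xi)%C by (rewrite RtoC_minus, RtoC_opp; ring).
  rewrite Cmod_mult, Hxi, Cmod_R, Rabs_left; lra. }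
set (A := 4 * (1600 * (B * 262144) + 1) + Rabs (Re (L z0))).
assert (HA0 : 0 <= Rabs (Re (L z0))) by apply Rabs_pos.
set (valid := fun z => 0 < 1 - Cmod z <= eps / 2 /\ Cmod (z - xi) + 2 * (1 - Cmod z) <= eps /\
   (forall q, 0 < q -> q ^ 8 = 1 - Cmod z -> - Re (L z) * q ^ 6 <= A)).
assert (Step : forall z, valid z -> exists z', valid z' /\ Cmod (z' - z) <= 1 - Cmod z /\
   (1 - Cmod z) / 400000 <= 1 - Cmod z' <= (1 - Cmod z) / 65536).
{ intros z [V1 [V2 V3]].
  set (t := 1 - Cmod z) in *.
  destruct (nth_root 7 t ltac:(lra)) as [q [Hq Hq8]].
  assert (Hq6 : 0 < q ^ 6) by now apply pow_lt.
  assert (Hq1 : q <= 1) by (apply (pow_le_inv 7); lra).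
  (* Heights of at least [t / 400000] exceed [(q / 8)^8 = t / 16777216], so the upper growth applies
     with [q / 8]; [262144] is [8^6]. *)
  assert (HM : 0 <= B * 262144 / q ^ 6) by (apply Rdiv_le_0_compat; lra).
  destruct (greedy_step L L' z t eq_refl ltac:(lra) ltac:(unfold t in *; lra)) with (M := B * 262144 / q ^ 6) as [z' [S1 [S2 S3]]]; trivial.
  - apply (holo_sub (cap xi del)); trivial. intros v Hv; split.
    + pose proof (Cmod_triangle_rev v z). unfold t in *; lra.
    + pose proof (Cmod_dist_triangle v z xi). lra.
  - intros v Hv Hh. apply Rmult_le_reg_r with (q ^ 6); trivial.
    replace (B * 262144 / q ^ 6 * q ^ 6) with (B * 262144) by (field; lra).
    assert (D : cap xi del v).
    { split; [lra|]. pose proof (Cmod_dist_triangle v z xi). lra. }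
    assert (G := Hup v (q / 8) D ltac:(lra)).
    replace ((q / 8) ^ 8) with (q ^ 8 / 16777216) in G by field.
    replace ((q / 8) ^ 6) with (q ^ 6 / 262144) in G by field.
    assert (G2 := G ltac:(lra)). lra.
  - exists z'. split; [split; [|split]|split]; trivial; try lra.
    + pose proof (Cmod_dist_triangle z' z xi). lra.
    + intros q' Hq' Hq8'.
      (* The new height is at most [t / 65536 = (q / 4)^8]. *)
      assert (Q : q' <= q / 4).
      { apply (pow_le_inv 7); lra. }
      assert (Q6 : q' ^ 6 <= q ^ 6 / 4096).
      { replace (q ^ 6 / 4096) with ((q / 4) ^ 6) by field. apply pow_incr; lra. }
      assert (Q60 : 0 < q' ^ 6) by now apply pow_lt.
      assert (Q61 : q' ^ 6 <= 1) by (rewrite <- (pow1 6); apply pow_incr; lra).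
      assert (V4 := V3 q Hq Hq8).
      assert (X0 : 0 <= B * 262144 / q ^ 6 - Re (L z)).
      { apply Rmult_le_reg_r with (q ^ 6); trivial. rewrite Rmult_0_l.
        replace ((B * 262144 / q ^ 6 - Re (L z)) * q ^ 6) with (B * 262144 - Re (L z) * q ^ 6) by (field; lra).
        assert (D : cap xi del z) by (split; unfold t in *; lra).
        assert (G := Hup z q D Hq ltac:(unfold t in *; lra)). lra. }
      apply Rle_trans with ((1600 * (B * 262144 / q ^ 6 - Re (L z)) + 1) * q' ^ 6).
      { apply Rmult_le_compat_r; lra. }
      apply Rle_trans with (1600 * (B * 262144 / q ^ 6 - Re (L z)) * (q ^ 6 / 4096) + 1); [nra|].
      replace (1600 * (B * 262144 / q ^ 6 - Re (L z)) * (q ^ 6 / 4096)) with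
        (1600 / 4096 * (B * 262144 + - Re (L z) * q ^ 6)) by (field; lra).
      unfold A in *. lra. }
assert (V0 : valid z0).
{ unfold valid. rewrite Hz0, Hz0xi. split; [lra|split; [lra|]].
  intros q Hq Hq8. assert (q <= 1) by (apply (pow_le_inv 7); lra).
  assert (q ^ 6 <= 1) by (rewrite <- (pow1 6); apply pow_incr; lra).
  assert (0 < q ^ 6) by now apply pow_lt.
  pose proof (Rabs_maj2 (Re (L z0))). unfold A. nra. }
set (next := fun s : {z : C | valid z} =>
  let (z', H) := constructive_indefinite_description _ (Step (proj1_sig s) (proj2_sig s)) in
  exist valid z' (proj1 H)).
assert (Hnext : forall s, let z := proj1_sig s in let z' := proj1_sig (next s) in
  Cmod (z' - z) <= 1 - Cmod z /\ (1 - Cmod z) / 400000 <= 1 - Cmod z' <= (1 - Cmod z) / 65536).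
{ intros s; unfold next. destruct (constructive_indefinite_description _ _) as [z' [H1 H2]]; exact H2. }
set (it := fix it n := match n with O => exist valid z0 V0 | S m => next (it m) end).
exists (fun n => proj1_sig (it n)), A. intros n.
destruct (proj2_sig (it n)) as [P1 [P2 P3]]. destruct (Hnext (it n)) as [N1 N2].
repeat split; trivial; try apply P1; apply N2.
Qed.

(** Harnack's inequality is used at two places: from each point of the sequence to the next, which
    turns the one-sided bound on [Re L] into one on [Cmod L], and from the point of the right scale
    to any point of the Stolz angle. At a fixed scale both chains have bounded length. *)
Lemma stolz_growth_of_sequence (L L' : C -> C) (B A eps : R) (Z : nat -> C) (p : C) :
  0 <= B -> 0 < eps <= 1 / 4 -> eps <= del / 10 ->
  holo (cap xi del) L L' -> upper_growth (cap xi del) L B ->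
  (forall n,
    0 < 1 - Cmod (Z n) <= eps / 2 /\ Cmod (Z n - xi) + 2 * (1 - Cmod (Z n)) <= eps /\
    Cmod (Z (S n) - Z n) <= 1 - Cmod (Z n) /\
    (1 - Cmod (Z n)) / 400000 <= 1 - Cmod (Z (S n)) <= (1 - Cmod (Z n)) / 65536 /\
    (forall q, 0 < q -> q ^ 8 = 1 - Cmod (Z n) -> - Re (L (Z n)) * q ^ 6 <= A)) ->
  Cmod p = 1 -> (forall n, Cmod (p - Z n) <= 4 * (1 - Cmod (Z n))) ->
  stolz_growth xi (del / 2) p L.
Proof.
intros HB Heps Hed HL Hup HZ Hp HpZ.
set (t := fun n => 1 - Cmod (Z n)).
assert (Ht0 : forall n, 0 < t n <= eps / 2) by (intros n; apply (HZ n)).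
assert (HA0 : 0 <= Rabs A) by apply Rabs_pos. pose proof (Rle_abs A) as HA.
assert (Chain : forall c k, 0 < c <= 1 -> 0 <= k -> exists K1, 0 <= K1 /\ forall n z q,
   0 < q -> q ^ 8 = t n -> Cmod z < 1 -> c * t n <= 1 - Cmod z -> Cmod (z - xi) <= del / 2 -> Cmod (z - Z n) <= k * t n ->
   Cmod (L z - L (Z n)) * q ^ 6 <= K1).
{ intros c k Hc Hk.
  (* Within [c t n / 2] of the segment the height is still at least [c t n / 2 = (c2 q)^8], which is
     where the upper growth is evaluated. In units of that radius the segment has length at most
     [kk = 2 k / c]. *)
  destruct (nth_root 7 (c / 2) ltac:(lra)) as [c2 [Hc2 Hc28]].
  assert (Hc26 : 0 < c2 ^ 6) by now apply pow_lt.
  set (kk := 2 * k / c). assert (Hkk : 0 <= kk) by (apply Rdiv_le_0_compat; lra).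
  assert (Hex := exp_pos (8 * kk)).
  assert (Hke : 0 <= 16 * kk * exp (8 * kk)) by (apply Rmult_le_pos; [apply Rmult_le_pos; [lra|exact Hkk]|lra]).
  exists (16 * kk * exp (8 * kk) * (B / c2 ^ 6 + Rabs A)). split.
  { assert (0 <= B / c2 ^ 6) by (apply Rdiv_le_0_compat; lra). apply Rmult_le_pos; [exact Hke|lra]. }
  intros n z q Hq Hq8 Hz1 Hzh Hzxi Hzn.
  destruct (HZ n) as [P1 [P2 [P3 [P4 P5]]]]. fold (t n) in *.
  assert (Hq6 : 0 < q ^ 6) by now apply pow_lt.
  assert (H := harnack_chain (cap xi del) L L' (Z n) z (c * t n / 2) kk (B / (c2 * q) ^ 6) HL).
  assert (Hcq : 0 < (c2 * q) ^ 6) by (apply pow_lt, Rmult_lt_0_compat; lra).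
  apply Rle_trans with (16 * kk * exp (8 * kk) * (B / (c2 * q) ^ 6 - Re (L (Z n))) * q ^ 6).
  - apply Rmult_le_compat_r; [lra|]. apply H; trivial.
    + assert (0 < c * t n) by (apply Rmult_lt_0_compat; lra). lra.
    + unfold kk. replace (2 * k / c * (c * t n / 2)) with (k * t n) by (field; lra). trivial.
    + intros s v Hs Hv.
      assert (Hct : c * t n <= t n) by nra.
      assert (Hh : c * t n / 2 <= 1 - Cmod v).
      { pose proof (Cmod_triangle_rev v (Z n + s * (z - Z n))) as T. pose proof (seg_Cmod (Z n) z s Hs) as T2.
        assert (Cmod (Z n) <= 1 - c * t n) by (unfold t in *; lra).
        assert ((1 - s) * Cmod (Z n) + s * Cmod z <= 1 - c * t n) by nra. lra. }
      assert (D : cap xi del v).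
      { split; [assert (0 < c * t n) by (apply Rmult_lt_0_compat; lra); lra|].
        pose proof (Cmod_dist_triangle v (Z n + s * (z - Z n)) xi) as T.
        pose proof (seg_dist (Z n) z xi s (del / 2) Hs ltac:(lra) Hzxi). lra. }
      split; trivial.
      assert (Hcq0 : 0 < c2 * q) by (apply Rmult_lt_0_compat; lra).
      assert (G := Hup v (c2 * q) D Hcq0).
      rewrite Rpow_mult_distr, Hc28, Hq8 in G. assert (G2 := G ltac:(lra)).
      apply Rmult_le_reg_r with ((c2 * q) ^ 6); trivial.
      replace (B / (c2 * q) ^ 6 * (c2 * q) ^ 6) with B by (field; lra). trivial.
  - rewrite (Rmult_assoc (16 * kk * exp (8 * kk))).
    apply Rmult_le_compat_l; [exact Hke|].
    replace ((B / (c2 * q) ^ 6 - Re (L (Z n))) * q ^ 6) with (B / c2 ^ 6 + - Re (L (Z n)) * q ^ 6).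
    2:{ rewrite Rpow_mult_distr. field. split; lra. }
    specialize (P5 q Hq Hq8). lra. }
(* The induction closes because [(D + K1) / 4096 <= D]. *)
assert (Seq : exists D, 0 <= D /\ forall n q, 0 < q -> q ^ 8 = t n -> Cmod (L (Z n)) * q ^ 6 <= D).
{ destruct (Chain (1 / 400000) 1 ltac:(lra) ltac:(lra)) as [K1 [HK1 HK]].
  exists (Cmod (L (Z O)) + K1). pose proof (Cmod_ge_0 (L (Z O))) as HZ0. split; [lra|].
  induction n as [|n IH]; intros q Hq Hq8.
  - assert (q <= 1) by (apply (pow_le_inv 7); try lra; rewrite Hq8, pow1; pose proof (Ht0 O); lra).
    assert (q ^ 6 <= 1) by (rewrite <- (pow1 6); apply pow_incr; lra).
    assert (0 < q ^ 6) by now apply pow_lt. nra.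
  - destruct (HZ n) as [P1 [P2 [P3 [P4 P5]]]]. destruct (HZ (S n)) as [R1 [R2 _]]. fold (t n) in *. fold (t (S n)) in *.
    destruct (nth_root 7 (t n) ltac:(lra)) as [r [Hr Hr8]].
    assert (Q : q <= r / 4).
    { apply (pow_le_inv 7); lra. }
    assert (Q6 : q ^ 6 <= r ^ 6 / 4096).
    { replace (r ^ 6 / 4096) with ((r / 4) ^ 6) by field. apply pow_incr; lra. }
    assert (r6 : 0 < r ^ 6) by now apply pow_lt.
    specialize (IH r Hr Hr8).
    assert (C1 := HK n (Z (S n)) r Hr Hr8 ltac:(unfold t in *; lra) ltac:(unfold t in *; lra) ltac:(lra) ltac:(lra)).
    assert (Tr : Cmod (L (Z (S n))) <= Cmod (L (Z n)) + Cmod (L (Z (S n)) - L (Z n))).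
    { replace (L (Z (S n))) with (L (Z n) + (L (Z (S n)) - L (Z n)))%C at 1 by ring. apply Cmod_triangle. }
    pose proof (Cmod_ge_0 (L (Z (S n)))).
    apply Rle_trans with (Cmod (L (Z (S n))) * (r ^ 6 / 4096)); [now apply Rmult_le_compat_l|].
    assert (Cmod (L (Z (S n))) * r ^ 6 <= (Cmod (L (Z n)) + Cmod (L (Z (S n)) - L (Z n))) * r ^ 6) by (apply Rmult_le_compat_r; lra).
    lra. }
destruct Seq as [D [HD0 HD]].
intros c Hc.
(* The scale [n] will satisfy [t (S n) < Cmod (z - p)], and [t (S n)] is at least [t n / 400000]; so
   the height of [z] is at least [c t n / 400000]. *)
set (c1 := Rmin 1 (c / 400000)).
assert (Hc1 : 0 < c1 <= 1) by (unfold c1; split; [apply Rmin_pos; lra|apply Rmin_l]).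
(* For [n > 0] the distance to [Z n] is at most [t n + 4 t n]. The scale [n = 0] also takes in
   points far from [p], for which only [Cmod (z - p) <= 2] is known. *)
set (k0 := 2 / t O + 5).
assert (HtO := Ht0 O).
assert (Hk0 : 5 < k0) by (unfold k0; assert (0 < 2 / t O) by (apply Rdiv_lt_0_compat; lra); lra).
destruct (Chain c1 k0 Hc1 ltac:(lra)) as [K1 [HK1 HK]].
destruct (nth_root 7 (t O) ltac:(lra)) as [q0 [Hq0 Hq08]].
assert (Hq01 : q0 <= 1) by (apply (pow_le_inv 7); lra).
exists ((D + K1) * (2 / q0) ^ 6).
intros z q [Hz1 Hzxi] Hst Hq Hq8.
assert (Hzp : 0 < Cmod (z - p)) by (assert (0 < q ^ 8) by (now apply pow_lt); lra).
assert (Hzp2 : Cmod (z - p) <= 2) by (pose proof (Cmod_triangle_sub z p); lra).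
assert (Hn : exists n, t (S n) < Cmod (z - p) /\ (n = O \/ Cmod (z - p) <= t n)).
{ destruct (halving_small t (fun n => Rlt_le _ _ (proj1 (Ht0 n)))
     (fun n => ltac:(destruct (HZ n) as [P1 [_ [_ [P4 _]]]]; fold (t n) in *; fold (t (S n)) in *; lra)) _ Hzp) as [N HN].
  induction N as [|N IH].
  - exists O. split; [|now left]. destruct (HZ O) as [P1 [_ [_ [P4 _]]]]. unfold t in *. lra.
  - destruct (Rlt_dec (t N) (Cmod (z - p))) as [H|H]; [now apply IH|].
    exists N. split; trivial. right; lra. }
destruct Hn as [n [Hn1 Hn2]].
destruct (HZ n) as [P1 [P2 [P3 [P4 P5]]]]. fold (t n) in *. fold (t (S n)) in *.
destruct (nth_root 7 (t n) ltac:(lra)) as [r [Hr Hr8]].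
assert (Hzn : Cmod (z - Z n) <= k0 * t n).
{ pose proof (Cmod_dist_triangle z p (Z n)). specialize (HpZ n). fold (t n) in HpZ.
  destruct Hn2 as [-> | Hn2]; [|nra].
  assert (k0 * t O = 2 + 5 * t O) by (unfold k0; field; lra). lra. }
assert (Hh : c1 * t n <= 1 - Cmod z).
{ pose proof (Rmin_r 1 (c / 400000)) as M. fold c1 in M. nra. }
assert (C1 := HK n z r Hr Hr8 Hz1 Hh ltac:(lra) Hzn).
assert (C2 := HD n r Hr Hr8).
assert (Tr : Cmod (L z) <= Cmod (L (Z n)) + Cmod (L z - L (Z n))).
{ replace (L z) with (L (Z n) + (L z - L (Z n)))%C at 1 by ring. apply Cmod_triangle. }
assert (r6 : 0 < r ^ 6) by now apply pow_lt.
assert (Hqr : q <= 2 / q0 * r).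
{ assert (H2q : 2 <= 2 / q0) by (apply Rmult_le_reg_r with q0; trivial; replace (2 / q0 * q0) with 2 by (field; lra); lra).
  destruct Hn2 as [-> | Hn2].
  - replace r with q0.
    + replace (2 / q0 * q0) with 2 by (field; lra). apply (pow_le_inv 7); lra.
    + apply Rle_antisym; apply (pow_le_inv 7); lra.
  - assert (q <= r) by (apply (pow_le_inv 7); lra). nra. }
assert (Q6 : q ^ 6 <= (2 / q0) ^ 6 * r ^ 6) by (rewrite <- Rpow_mult_distr; apply pow_incr; lra).
pose proof (Cmod_ge_0 (L z)).
assert (Q0 : 0 < (2 / q0) ^ 6) by (apply pow_lt, Rdiv_lt_0_compat; lra).
apply Rle_trans with (Cmod (L z) * ((2 / q0) ^ 6 * r ^ 6)); [now apply Rmult_le_compat_l|].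
replace (Cmod (L z) * ((2 / q0) ^ 6 * r ^ 6)) with (Cmod (L z) * r ^ 6 * (2 / q0) ^ 6) by ring.
apply Rmult_le_compat_r; [lra|]. nra.
Qed.

(** An end point is shared by two arcs with different logarithms, so both must be controlled along
    one sequence. The descent is run for [L1 + L2]; a lower bound for the sum and the upper bound
    for one summand give a lower bound for the other. *)
Lemma good_endpoint (L1 L1' L2 L2' : C -> C) (B eps : R) : 0 <= B -> 0 < eps ->
  holo (cap xi del) L1 L1' -> holo (cap xi del) L2 L2' ->
  upper_growth (cap xi del) L1 B -> upper_growth (cap xi del) L2 B ->
  exists p, Cmod p = 1 /\ Cmod (p - xi) < eps /\
    stolz_growth xi (del / 2) p L1 /\ stolz_growth xi (del / 2) p L2.
Proof.
intros HB Heps HL1 HL2 HU1 HU2.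
set (e := Rmin (1 / 4) (Rmin (del / 10) (eps / 4))).
assert (He0 : 0 < e) by (repeat apply Rmin_pos; lra).
assert (He1 : e <= 1 / 4) by apply Rmin_l.
assert (He23 : e <= Rmin (del / 10) (eps / 4)) by apply Rmin_r.
assert (He2 : e <= del / 10) by (eapply Rle_trans; [exact He23|apply Rmin_l]).
assert (He3 : e <= eps / 4) by (eapply Rle_trans; [exact He23|apply Rmin_r]).
assert (HU : upper_growth (cap xi del) (fun z => L1 z + L2 z)%C (2 * B)).
{ intros z q Hz Hq Hq8. specialize (HU1 z q Hz Hq Hq8). specialize (HU2 z q Hz Hq Hq8).
  replace (Re (L1 z + L2 z)) with (Re (L1 z) + Re (L2 z)) by (unfold Re; simpl; ring). lra. }
destruct (greedy_sequence _ _ (2 * B) e ltac:(lra) ltac:(lra) ltac:(lra) (holo_plus _ _ _ _ _ HL1 HL2) HU) as [Z [A HZ]].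
destruct (limit_of_steps Z (fun n => 1 - Cmod (Z n))) as [p Hp].
{ intros n; destruct (HZ n); lra. }
{ intros n; destruct (HZ n) as [P1 [_ [_ [P4 _]]]]; lra. }
{ intros n; apply (HZ n). }
assert (Hp1 : Cmod p = 1).
{ apply cond_eq. intros d Hd.
  destruct (halving_small (fun n => 1 - Cmod (Z n))) with (eps := d / 5) as [n Hn].
  - intros n; destruct (HZ n); lra.
  - intros n; destruct (HZ n) as [P1 [_ [_ [P4 _]]]]; lra.
  - lra.
  - specialize (Hp n). destruct (HZ n) as [P1 _].
    pose proof (Cmod_triangle_rev p (Z n)). pose proof (Cmod_triangle_rev (Z n) p) as T. rewrite Cmod_sub_sym in T.
    apply Rabs_def1; lra. }
assert (Hn : forall L3 L4, upper_growth (cap xi del) L4 B ->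
   (forall z, Re (L3 z) + Re (L4 z) = Re (L1 z + L2 z)) ->
   forall n q, 0 < q -> q ^ 8 = 1 - Cmod (Z n) -> - Re (L3 (Z n)) * q ^ 6 <= A + B).
{ intros L3 L4 H4 E n q Hq Hq8. destruct (HZ n) as [P1 [P2 [_ [_ P5]]]]. specialize (P5 q Hq Hq8).
  assert (D : cap xi del (Z n)) by (split; lra).
  specialize (H4 (Z n) q D Hq ltac:(lra)). rewrite <- E in P5. nra. }
exists p. split; [trivial|split].
{ specialize (Hp O). destruct (HZ O) as [P1 [P2 _]]. pose proof (Cmod_dist_triangle p (Z O) xi). lra. }
split; [apply (stolz_growth_of_sequence L1 L1' B (A + B) e Z p)|apply (stolz_growth_of_sequence L2 L2' B (A + B) e Z p)];
trivial; try lra; intros n; destruct (HZ n) as [P1 [P2 [P3 [P4 _]]]]; repeat split; trivial; try lra.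
- apply (Hn L1 L2); trivial.
- apply (Hn L2 L1); trivial. intros z. unfold Re; simpl; ring.
Qed.
End Endpoint.

(** * Barriers *)

(** Each local derivative equals [C_derive], which thus serves as a single derivative for a function
    patched from pieces. *)
Lemma holo_of_local (U : C -> Prop) (h : C -> C) :
  (forall z, U z -> exists r h', 0 < r /\ holo (fun v => Cmod (v - z) < r) h h') -> holo U h (C_derive h).
Proof.
intros H z Hz. destruct (H z Hz) as [r [h' [Hr Hh]]].
assert (Hzz : Cmod (z - z) < r) by (now rewrite Cmod_diag).
assert (E : forall v, Cmod (v - z) < r -> h' v = C_derive h v).
{ intros v Hv; symmetry; apply is_C_derive_unique, is_Cderive_iff, Hh, Hv. }
split; [rewrite <- E by trivial; now apply Hh|].
apply (ccont_ext_loc h' _ z r Hr E). now apply Hh.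
Qed.

Lemma holo_ext_fun (U : C -> Prop) (f g f' : C -> C) : openC U -> (forall z, U z -> f z = g z) ->
  holo U f f' -> holo U g f'.
Proof.
intros HO E Hf z Hz. destruct (HO z Hz) as [r [Hr Hb]]. destruct (Hf z Hz) as [H1 H2]. split; trivial.
apply (is_Cderive_ext_loc f g z _ r); auto.
Qed.

Lemma holo_glue (D V1 V2 : C -> Prop) (h h1 h1' h2 h2' : C -> C) :
  openC (fun z => D z /\ V1 z) -> openC (fun z => D z /\ V2 z) -> (forall z, D z -> V1 z \/ V2 z) ->
  holo (fun z => D z /\ V1 z) h1 h1' -> holo (fun z => D z /\ V2 z) h2 h2' ->
  (forall z, D z /\ V1 z -> h1 z = h z) -> (forall z, D z /\ V2 z -> h2 z = h z) ->
  holo D h (C_derive h).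
Proof.
intros O1 O2 Cov H1 H2 E1 E2. apply holo_of_local. intros z Hz.
destruct (Cov z Hz) as [HV|HV].
- destruct (O1 z (conj Hz HV)) as [r [Hr Hb]]. exists r, h1'. split; trivial.
  apply (holo_sub (fun z => D z /\ V1 z)); trivial. now apply (holo_ext_fun _ h1).
- destruct (O2 z (conj Hz HV)) as [r [Hr Hb]]. exists r, h2'. split; trivial.
  apply (holo_sub (fun z => D z /\ V2 z)); trivial. now apply (holo_ext_fun _ h2).
Qed.

Lemma pow_le_exp (n : nat) : exists C, 0 < C /\ forall y, 0 <= y -> y ^ n <= C * exp y.
Proof.
induction n as [|n [C [HC IH]]].
- exists 1; split; [lra|]. intros y Hy; simpl. pose proof (exp_ineq1_le y). lra.
- set (N := INR (S n)). assert (HN : 0 < N) by (unfold N; apply lt_0_INR; lia).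
  exists (N ^ S n). split; [now apply pow_lt|]. intros y Hy.
  replace y with (N * (y / N)) at 1 by (field; lra). rewrite Rpow_mult_distr.
  apply Rmult_le_compat_l; [left; now apply pow_lt|].
  replace (exp y) with (exp (y / N) ^ S n).
  + apply pow_incr. split; [apply Rdiv_le_0_compat; lra|]. pose proof (exp_ineq1_le (y / N)). lra.
  + rewrite <- Rpower_pow by apply exp_pos. unfold Rpower. rewrite ln_exp. f_equal. fold N. field; lra.
Qed.

(** In the application [s^16] is the distance to the nearer end point: the transforms have size
    [s^(-14)] and the barrier [s^(-15)]. With [y = 1 / s] the exponent is at most [M - y], and
    [exp (- y)] decays faster than any power of [s]. *)
Lemma exp_beats_pow (K kap : R) (n : nat) : 0 < kap -> exists C, 0 < C /\
  forall s, 0 < s <= 2 -> exp (K / s ^ 14 - kap / s ^ 15) <= C * s ^ n.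
Proof.
intros Hk.
destruct (pow_le_exp n) as [C [HC HP]].
set (K1 := Rabs K + 8192). assert (HK1 : 8192 <= K1) by (unfold K1; pose proof (Rabs_pos K); lra).
set (M := K1 * (K1 / kap) ^ 14).
assert (HM : 0 <= M) by (apply Rmult_le_pos; [lra|apply pow_le, Rdiv_le_0_compat; lra]).
exists (C * exp M). split; [apply Rmult_lt_0_compat; trivial; apply exp_pos|].
intros s Hs.
set (y := / s). assert (Hy : 1 / 2 <= y) by (unfold y; replace (1 / 2) with (/ 2) by field; apply Rinv_le_contravar; lra).
assert (E : y + (K / s ^ 14 - kap / s ^ 15) <= M).
{ replace (K / s ^ 14) with (K * y ^ 14) by (unfold y; field; lra).
  replace (kap / s ^ 15) with (kap * y ^ 15) by (unfold y; field; lra).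
  assert (H14 : 0 < y ^ 14) by (apply pow_lt; lra).
  (* [y >= 1/2] and [8192 = 2^13]. *)
  assert (A : y <= 8192 * y ^ 14).
  { replace (y ^ 14) with (y * y ^ 13) by ring. assert ((1 / 2) ^ 13 <= y ^ 13) by (apply pow_incr; lra). nra. }
  pose proof (Rle_abs K). assert (B : K * y ^ 14 <= Rabs K * y ^ 14) by nra.
  replace (y ^ 15) with (y * y ^ 14) by ring.
  apply Rle_trans with (y ^ 14 * (K1 - kap * y)); [unfold K1; nra|].
  destruct (Rle_dec K1 (kap * y)) as [H1|H1].
  - apply Rle_trans with 0; [nra|trivial].
  - assert (Hy2 : y <= K1 / kap) by (apply Rmult_le_reg_r with kap; trivial; replace (K1 / kap * kap) with K1 by (field; lra); lra).
    assert (y ^ 14 <= (K1 / kap) ^ 14) by (apply pow_incr; lra).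
    assert (0 <= kap * y) by nra.
    unfold M. rewrite (Rmult_comm K1). apply Rmult_le_compat; lra. }
assert (P := HP y ltac:(lra)).
assert (Hsn : 0 < s ^ n) by (apply pow_lt; lra).
assert (Hyn : y ^ n * s ^ n = 1).
{ rewrite <- Rpow_mult_distr. unfold y. rewrite Rinv_l by lra. apply pow1. }
set (X := K / s ^ 14 - kap / s ^ 15) in *.
assert (EX : exp X <= exp M * exp (- y)).
{ rewrite <- exp_plus. destruct (Rle_lt_or_eq_dec X (M + - y) ltac:(lra)) as [Hl|He]; [left; now apply exp_increasing|rewrite He; lra]. }
assert (Ey : exp y * exp (- y) = 1) by (rewrite <- exp_plus, Rplus_opp_r; apply exp_0).
pose proof (exp_pos (- y)). pose proof (exp_pos M).
assert (Q : exp (- y) <= C * s ^ n).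
{ apply (Rmult_le_compat_r (s ^ n * exp (- y))) in P; [|nra].
  replace (y ^ n * (s ^ n * exp (- y))) with ((y ^ n * s ^ n) * exp (- y)) in P by ring.
  replace (C * exp y * (s ^ n * exp (- y))) with ((exp y * exp (- y)) * (C * s ^ n)) in P by ring.
  rewrite Hyn, Ey in P. lra. }
apply Rle_trans with (exp M * (C * s ^ n)); [|right; ring]. nra.
Qed.

(** The principal value of [(1 - z/p)^(-15/16)], as [Cconj p] is the inverse of [p] on the unit
    circle. *)
Definition barrier (p z : C) : C := Cexp (- (15 / 16)%R * Clog (1 - z * Cconj p)).

Lemma conj_unit (p : C) : Cmod p = 1 -> (p * Cconj p)%C = 1%C.
Proof. intros Hp. rewrite <- Cmod2_conj, Hp. unfold RtoC. f_equal; ring. Qed.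

Section Barrier.
Context (p : C) (Hp : Cmod p = 1).

Lemma one_minus_mod (z : C) : Cmod (1 - z * Cconj p) = Cmod (z - p).
Proof.
rewrite <- (conj_unit p Hp). replace (p * Cconj p - z * Cconj p)%C with (- ((z - p) * Cconj p))%C by ring.
rewrite Cmod_opp, Cmod_mult, Cmod_conj, Hp. ring.
Qed.

Lemma one_minus_Re (z : C) : Cmod z < 1 -> 0 < Re (1 - z * Cconj p).
Proof.
intros Hz. pose proof (re_le_Cmod (z * Cconj p)) as A. rewrite Cmod_mult, Cmod_conj, Hp in A.
pose proof (Rle_abs (Re (z * Cconj p))).
replace (Re (1 - z * Cconj p)) with (1 - Re (z * Cconj p)) by (unfold Re; simpl; ring). lra.
Qed.

Lemma one_minus_slit (z : C) : Cmod z < 1 -> slit (1 - z * Cconj p)%C.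
Proof. intros Hz. unfold slit. pose proof (one_minus_Re z Hz). pose proof (Cmod_ge_0 (1 - z * Cconj p)). lra. Qed.

Lemma cos_15_32 : 0 < cos (15 / 32 * PI).
Proof. pose proof PI_RGT_0. apply cos_gt_0; lra. Qed.

(** [1 - z Cconj p] lies in the right half-plane, so the argument of its power is at most [15/32 PI]
    in absolute value. The cosine of that angle is the positive constant. *)
Lemma Re_barrier (z : C) (s : R) : Cmod z < 1 -> 0 < s -> s ^ 16 = Cmod (z - p) ->
  cos (15 / 32 * PI) / s ^ 15 <= Re (barrier p z) /\ Cmod (barrier p z) = / s ^ 15.
Proof.
intros Hz Hs Hs16. pose proof (one_minus_Re z Hz) as HR. pose proof (one_minus_mod z) as HM.
set (v := (1 - z * Cconj p)%C) in *.
assert (Hs15 : 0 < s ^ 15) by now apply pow_lt.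
assert (Hv0 : 0 < Cmod v) by (rewrite HM, <- Hs16; now apply pow_lt).
assert (Eexp : exp (- (15 / 16) * ln (Cmod v)) = / s ^ 15).
{ rewrite HM, <- Hs16, <- Rpower_pow by trivial. unfold Rpower. rewrite ln_exp.
  rewrite <- (Rpower_pow 15) by trivial. unfold Rpower. rewrite <- exp_Ropp. f_equal. simpl INR. field. }
assert (HRe : Re (- (15 / 16)%R * Clog v) = - (15 / 16) * ln (Cmod v)) by (unfold Re, Clog; simpl; ring).
assert (HIm : Im (- (15 / 16)%R * Clog v) = - (15 / 16 * (2 * atan (Im v / (Cmod v + Re v))))) by (unfold Im, Clog; simpl; ring).
split.
- unfold barrier. fold v. unfold Cexp at 1. unfold Re at 1. cbn [fst]. rewrite HRe, HIm, Eexp, cos_neg.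
  unfold Rdiv at 1. rewrite Rmult_comm. apply Rmult_le_compat_l; [left; now apply Rinv_0_lt_compat|].
  set (a := 2 * atan (Im v / (Cmod v + Re v))).
  assert (Ha : - (PI / 2) <= a <= PI / 2).
  { pose proof (Im_le_Cmod v) as I. apply Rabs_le_between in I.
    (* For [Re v > 0] the half-angle tangent lies in [[-1, 1]], that is, the half-angle is at most
       [PI / 4]. *)
    assert (T : -1 <= Im v / (Cmod v + Re v) <= 1).
    { split; [apply Rle_div_r|apply Rle_div_l]; lra. }
    assert (A1 : atan (Im v / (Cmod v + Re v)) <= atan 1).
    { destruct (Rle_lt_or_eq_dec _ _ (proj2 T)) as [Hl|He]; [left; now apply atan_increasing|rewrite He; lra]. }
    assert (A2 : atan (-1) <= atan (Im v / (Cmod v + Re v))).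
    { destruct (Rle_lt_or_eq_dec _ _ (proj1 T)) as [Hl|He]; [left; now apply atan_increasing|rewrite <- He; lra]. }
    replace (-1) with (- (1)) in A2 by ring. rewrite atan_opp in A2. rewrite atan_1 in A1, A2. unfold a. lra. }
  pose proof PI_RGT_0.
  destruct (Rle_dec 0 a).
  + apply cos_decr_1; lra.
  + rewrite <- (cos_neg (15 / 16 * a)). apply cos_decr_1; lra.
- unfold barrier. fold v. rewrite Cmod_Cexp, HRe. exact Eexp.
Qed.

Lemma holo_barrier : holo (fun z => Cmod z < 1) (barrier p)
  (fun z => barrier p z * (- (15 / 16)%R * (/ (1 - z * Cconj p) * (0 - (1 * Cconj p + z * 0)))))%C.
Proof.
unfold barrier. apply holo_Cexp. apply holo_scal. apply (holo_Clog _ (fun z => 1 - z * Cconj p)%C).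
- apply holo_minus; [apply holo_const|]. apply holo_mult; [apply holo_id|apply holo_const].
- apply one_minus_slit.
Qed.

Lemma barrier_derive_bound (z : C) (s : R) : Cmod z < 1 -> 0 < s -> s ^ 16 = Cmod (z - p) ->
  Cmod (barrier p z * (- (15 / 16)%R * (/ (1 - z * Cconj p) * (0 - (1 * Cconj p + z * 0)))))%C <= / s ^ 31.
Proof.
intros Hz Hs Hs16. destruct (Re_barrier z s Hz Hs Hs16) as [_ HB].
assert (Hv : (1 - z * Cconj p)%C <> 0%C).
{ intros E; pose proof (one_minus_Re z Hz) as H. rewrite E in H. simpl in H; lra. }
rewrite !Cmod_mult, HB, Cmod_opp, Cmod_R, Cmod_inv, one_minus_mod, <- Hs16 by trivial.
replace (0 - (1 * Cconj p + z * 0))%C with (- Cconj p)%C by ring.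
rewrite Cmod_opp, Cmod_conj, Hp, Rabs_pos_eq by lra.
assert (0 < / s ^ 31) by (apply Rinv_0_lt_compat; now apply pow_lt).
replace (/ s ^ 15 * (15 / 16 * (/ s ^ 16 * 1))) with (15 / 16 * / s ^ 31) by (field; lra). lra.
Qed.
End Barrier.

(** * The factor attached to an arc *)

Lemma openC_cap (xi : C) (del : R) : openC (cap xi del).
Proof.
intros z [H1 H2]. exists (Rmin (1 - Cmod z) (del - Cmod (z - xi))). split; [apply Rmin_pos; lra|].
intros w Hw.
assert (W1 := Rlt_le_trans _ _ _ Hw (Rmin_l _ _)). assert (W2 := Rlt_le_trans _ _ _ Hw (Rmin_r _ _)).
pose proof (Cmod_triangle_rev w z). pose proof (Cmod_dist_triangle w z xi). split; lra.
Qed.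

Lemma convexC_cap (xi : C) (del : R) : convexC (cap xi del).
Proof.
intros a b t [A1 A2] [B1 B2] Ht. split.
- eapply Rle_lt_trans; [now apply seg_Cmod|].
  assert (Cmod a <= Rmax (Cmod a) (Cmod b)) by apply Rmax_l. assert (Cmod b <= Rmax (Cmod a) (Cmod b)) by apply Rmax_r.
  assert (Rmax (Cmod a) (Cmod b) < 1) by (apply Rmax_lub_lt; trivial). nra.
- eapply Rle_lt_trans; [apply (seg_dist a b xi t (Rmax (Cmod (a - xi)) (Cmod (b - xi)))); trivial|].
  + apply Rmax_l.
  + apply Rmax_r.
  + apply Rmax_lub_lt; trivial.
Qed.

(** * Geometry of one arc with middle [u], whose half-angle has sine [s] and cosine [c] *)

Section Arc.
Context (u : C) (s c : R) (Hu : Cmod u = 1) (Hs : 0 < s) (Hsc : s <= c) (Hpy : s * s + c * c = 1).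

(* The affine chart sends the end points of the arc to 1 and -1, the middle of the chord to 0 and
   the outward normal to the upper half-plane. *)
Definition arc_start : C := (u * (c - Ci * s))%C.
Definition arc_end : C := (u * (c + Ci * s))%C.
Definition mid : C := (u * c)%C.
Definition dir : C := (u * - (Ci * s))%C.
Definition chart (z : C) : C := ((z - mid) * / dir)%C.
Definition unchart (w : C) : C := (mid + dir * w)%C.

Lemma Cmod_dir : Cmod dir = s.
Proof.
unfold dir. rewrite Cmod_mult, Hu, Cmod_opp, Cmod_mult, Cmod_Ci, Cmod_R, Rabs_pos_eq; lra.
Qed.

Lemma dir_ne0 : dir <> 0%C.
Proof. apply Cmod_gt_0; rewrite Cmod_dir; trivial. Qed.

Lemma unchart_chart (z : C) : unchart (chart z) = z.
Proof. unfold unchart, chart. field. apply dir_ne0. Qed.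

Lemma chart_unchart (w : C) : chart (unchart w) = w.
Proof. unfold unchart, chart. field. apply dir_ne0. Qed.

Lemma unchart_start (w : C) : Cmod (unchart w - arc_start) = s * Cmod (w - 1).
Proof.
rewrite <- Cmod_dir, <- Cmod_mult. f_equal. unfold unchart, arc_start, mid, dir. ring.
Qed.

Lemma unchart_end (w : C) : Cmod (unchart w - arc_end) = s * Cmod (w + 1).
Proof.
rewrite <- Cmod_dir, <- Cmod_mult. f_equal. unfold unchart, arc_end, mid, dir. ring.
Qed.

(** The source of all height estimates: for [y <= 0] the term with [s c y] increases the height, and
    [s <= c] lets it dominate the quadratic terms. *)
Lemma unchart_mod (x y : R) : Cmod (unchart (x, y)) ^ 2 = 1 - (s * s * (1 - x * x - y * y) - 2 * (s * c * y)).
Proof.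
unfold unchart, mid, dir. replace (u * c + u * - (Ci * s) * (x, y))%C with (u * ((c + s * y)%R, (- (s * x))%R))%C.
- rewrite Cmod_mult, Hu, Rmult_1_l, Cmod2_alt. unfold Re, Im; simpl.
  replace 1 with (s * s + c * c) at 3 by exact Hpy. ring.
- transitivity (u * (c + - (Ci * s) * (x, y)))%C; [|ring]. f_equal. unfold Cplus, Cmult, RtoC; simpl; f_equal; ring.
Qed.

Lemma unit_start : Cmod arc_start = 1.
Proof.
unfold arc_start. rewrite Cmod_mult, Hu.
pose proof (Cmod2_alt (c - Ci * s)) as E. pose proof (Cmod_ge_0 (c - Ci * s)) as P.
replace (Re (c - Ci * s)) with c in E by (unfold Re; simpl; ring).
replace (Im (c - Ci * s)) with (- s) in E by (unfold Im; simpl; ring). simpl in E. nra.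
Qed.

Lemma unit_end : Cmod arc_end = 1.
Proof.
unfold arc_end. rewrite Cmod_mult, Hu.
pose proof (Cmod2_alt (c + Ci * s)) as E. pose proof (Cmod_ge_0 (c + Ci * s)) as P.
replace (Re (c + Ci * s)) with c in E by (unfold Re; simpl; ring).
replace (Im (c + Ci * s)) with (0 + s) in E by (unfold Im; simpl; ring). simpl in E. nra.
Qed.

(** The boundary between the inside and the outside is the line halfway between the two paths of
    integration. Points of that line belong to both, hence enjoy the bounds of either side. *)
Definition arc_inside (z : C) : Prop := - (1 - Rabs (Re (chart z))) / 2 <= Im (chart z).
Definition arc_outside (z : C) : Prop := Im (chart z) <= - (1 - Rabs (Re (chart z))) / 2.
(** The sector with apex 0 spanned by the arc: its sides are the lines through 0 and the points with
    chart coordinates 1 and -1. *)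
Definition arc_sector (z : C) : Prop := s * Im (chart z) + c >= c * Rabs (Re (chart z)).

Lemma disc_chart (z : C) : Cmod z < 1 ->
  2 * (c * Im (chart z)) < s * (1 - Re (chart z) * Re (chart z) - Im (chart z) * Im (chart z)).
Proof.
intros Hz. pose proof (unchart_mod (Re (chart z)) (Im (chart z))) as E.
rewrite <- (surjective_pairing (chart z) : chart z = (Re (chart z), Im (chart z))), unchart_chart in E.
set (x := Re (chart z)) in *. set (y := Im (chart z)) in *.
pose proof (Cmod_ge_0 z). assert (Cmod z ^ 2 < 1) by (simpl; nra).
apply Rmult_lt_reg_l with s; trivial. lra.
Qed.

Lemma disc_upper (z : C) : Cmod z < 1 -> 0 <= Im (chart z) -> Rabs (Re (chart z)) < 1 /\ Im (chart z) <= 1.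
Proof.
intros Hz Hy. pose proof (disc_chart z Hz) as H.
set (x := Re (chart z)) in *. set (y := Im (chart z)) in *.
assert (Q : 0 < 1 - x * x - y * y).
{ apply Rnot_le_lt; intros N. assert (s * (1 - x * x - y * y) <= 0) by nra. assert (0 <= c * y) by nra. lra. }
split; [|nra]. unfold Rabs; destruct (Rcase_abs x); nra.
Qed.

Lemma outside_lower (z : C) : Cmod z < 1 -> arc_outside z -> Im (chart z) < 0.
Proof.
intros Hz HR. unfold arc_outside in HR. apply Rnot_le_lt. intros Hy.
destruct (disc_upper z Hz Hy). lra.
Qed.

Lemma inside_bounds (z : C) : Cmod z < 1 -> arc_inside z ->
  Rabs (Re (chart z)) < 1 /\ Rabs (Im (chart z)) <= 1 /\ - (1 - Rabs (Re (chart z))) < Im (chart z).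
Proof.
unfold arc_inside; intros Hz HR. pose proof (Rabs_pos (Re (chart z))).
destruct (Rle_dec 0 (Im (chart z))) as [Hy|Hy].
- destruct (disc_upper z Hz Hy). rewrite (Rabs_pos_eq (Im (chart z))) by trivial. lra.
- rewrite (Rabs_left (Im (chart z))) by lra. lra.
Qed.

(** The triangle is nontangential at its two corners: [(1 - Rabs x) + Rabs y] dominates the distance
    to the nearer one. *)
Lemma Tri_height (x y : R) : Tri (x, y) ->
  s * s / 2 * ((1 - Rabs x) + Rabs y) <= 1 - Cmod (unchart (x, y)) /\ Cmod (unchart (x, y)) < 1.
Proof.
intros [T1 [T2 T3]]. unfold Re, Im in *; cbn [fst snd] in *.
pose proof (unchart_mod x y) as E. pose proof (Cmod_ge_0 (unchart (x, y))) as P.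
set (m := Cmod (unchart (x, y))) in *.
rewrite (Rabs_left1 y) by trivial.
assert (X : x * x = Rabs x * Rabs x) by (unfold Rabs; destruct (Rcase_abs x); ring).
pose proof (Rabs_pos x). set (X1 := Rabs x) in *.
assert (B : s * s * ((1 - X1) + - y) <= 1 - m ^ 2).
{ rewrite E, X.
  assert (S1 : s * s * (- y) <= s * c * (- y)) by (apply Rmult_le_compat_r; nra).
  assert (S2 : 0 <= s * s) by nra.
  assert (S3 : 0 <= (1 - X1) * X1) by nra. assert (S4 : 0 <= - y * (1 + y)) by nra.
  nra. }
assert (Q : 0 < s * s * ((1 - X1) + - y)) by (apply Rmult_lt_0_compat; nra).
assert (m < 1) by (simpl in B; nra).
split; trivial. simpl in B. nra.
Qed.

(** The part of the sector outside the arc region is nontangential at the corners too. This turns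
    smallness in terms of [corner_dist] into smallness in terms of the height. *)
Lemma sector_height (z : C) : Cmod z < 1 -> arc_outside z -> arc_sector z ->
  s * s / 2 * corner_dist (chart z) <= 1 - Cmod z.
Proof.
intros Hz HR HS. pose proof (outside_lower z Hz HR) as Hy. unfold arc_sector, arc_outside in *.
pose proof (unchart_mod (Re (chart z)) (Im (chart z))) as E.
pose proof (corner_dist_coord (Re (chart z)) (Im (chart z))) as D.
rewrite <- (surjective_pairing (chart z) : chart z = (Re (chart z), Im (chart z))) in E, D.
rewrite unchart_chart in E.
set (x := Re (chart z)) in *. set (y := Im (chart z)) in *.
pose proof (Cmod_ge_0 z) as P. set (m := Cmod z) in *.
rewrite (Rabs_left y) in D by trivial.
assert (X : x * x = Rabs x * Rabs x) by (unfold Rabs; destruct (Rcase_abs x); ring).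
pose proof (Rabs_pos x). set (X1 := Rabs x) in *.
assert (HX : X1 <= 1) by nra.
rewrite (Rabs_pos_eq (1 - X1)) in D by lra.
assert (Hyc : - (s * y) <= c * (1 - X1)) by lra.
assert (B : s * s * ((1 - X1) + - y) <= 1 - m ^ 2).
{ rewrite E, X.
  assert (S2 : 0 <= s * s) by nra.
  assert (S3 : 0 <= (1 - X1) * X1) by nra.
  assert (S5 : s * s * (y * y) <= s * c * (- y)).
  { replace (s * s * (y * y)) with (s * (- y) * (- (s * y))) by ring.
    replace (s * c * - y) with (s * (- y) * c) by ring. apply Rmult_le_compat_l; nra. }
  assert (S1 : s * s * (- y) <= s * c * (- y)) by (apply Rmult_le_compat_r; nra).
  nra. }
assert (s * s * corner_dist (chart z) <= s * s * (1 - X1 + - y)) by (apply Rmult_le_compat_l; nra).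
simpl in B. nra.
Qed.

Context (xi : C) (del m : R) (H1 : Cmod (arc_start - xi) <= m) (H2 : Cmod (arc_end - xi) <= m) (Hm : 3 * m < del).

(** The middle of the chord is within [m] of [xi], half the chord [s] is at most [m], and the unit
    square of the chart has radius at most [2 s]: this makes [3 m]. *)
Lemma near_cap (z : C) : Cmod z < 1 -> Rabs (Re (chart z)) <= 1 -> Rabs (Im (chart z)) <= 1 -> cap xi del z.
Proof.
intros Hz Hx Hy. split; trivial.
assert (A : Cmod (mid - xi) <= m).
{ replace (mid - xi)%C with (/ 2 * ((arc_start - xi) + (arc_end - xi)))%C.
  - rewrite Cmod_mult. rewrite <- RtoC_inv, Cmod_R, Rabs_pos_eq by lra.
    pose proof (Cmod_triangle (arc_start - xi) (arc_end - xi)). lra.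
  - unfold mid, arc_start, arc_end. field. }
assert (B : 2 * s <= 2 * m).
{ assert (E := unchart_start (- (1))%C). assert (E2 : unchart (- (1))%C = arc_end).
  { unfold unchart, mid, dir, arc_end. ring. }
  rewrite E2 in E. replace (- (1) - 1)%C with (RtoC (-2)) in E by (unfold Cminus, Cplus, Copp, RtoC; simpl; f_equal; ring).
  rewrite Cmod_R, Rabs_left in E by lra.
  pose proof (Cmod_triangle_sub (arc_end - xi) (arc_start - xi)) as T.
  replace (arc_end - xi - (arc_start - xi))%C with (arc_end - arc_start)%C in T by ring. lra. }
assert (D : Cmod (z - mid) <= 2 * s).
{ replace (z - mid)%C with (dir * chart z)%C by (unfold chart; field; apply dir_ne0).
  rewrite Cmod_mult, Cmod_dir. pose proof (Cmod_le_Re_Im (chart z)). nra. }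
pose proof (Cmod_dist_triangle z mid xi). lra.
Qed.

Context (L L' : C -> C) (HL : holo (cap xi del) L L').
Context (G1 : stolz_growth xi del arc_start L) (G2 : stolz_growth xi del arc_end L).

(** By [Tri_height] each half of the triangle lies in a Stolz angle of aperture [s / 2] at its
    corner. The chart scales distances by [1 / s], which is compensated by the eighth root [sg] of
    [s]. *)
Lemma Tri_growth : exists K, forall w q, Tri w -> 0 < q -> q ^ 8 <= corner_dist w -> Cmod (L (unchart w)) * q ^ 6 <= K.
Proof.
destruct (G1 (s / 2) ltac:(lra)) as [K1 HK1]. destruct (G2 (s / 2) ltac:(lra)) as [K2 HK2].
destruct (nth_root 7 s Hs) as [sg [Hsg Hsg8]].
assert (Hsg6 : 0 < sg ^ 6) by now apply pow_lt.
exists ((Rabs K1 + Rabs K2) / sg ^ 6). intros w q HT Hq Hq8.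
assert (HT' := HT). rewrite (surjective_pairing w) in HT'. change (Tri (Re w, Im w)) in HT'.
destruct (Tri_height (Re w) (Im w) HT') as [Hh Hlt].
rewrite <- (surjective_pairing w : w = (Re w, Im w)) in Hh, Hlt.
destruct HT as [T1 [T2 T3]].
assert (Hcap : cap xi del (unchart w)).
{ apply near_cap; trivial; rewrite chart_unchart; [lra|]. rewrite Rabs_left1 by trivial. pose proof (Rabs_pos (Re w)). lra. }
assert (Key : forall K, Cmod (L (unchart w)) * (q * sg) ^ 6 <= K -> Cmod (L (unchart w)) * q ^ 6 <= Rabs K / sg ^ 6).
{ intros K HK. apply Rmult_le_reg_r with (sg ^ 6); trivial.
  replace (Rabs K / sg ^ 6 * sg ^ 6) with (Rabs K) by (field; lra). rewrite Rpow_mult_distr in HK. pose proof (Rle_abs K). lra. }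
assert (Hsum : forall K, K = K1 \/ K = K2 -> Rabs K / sg ^ 6 <= (Rabs K1 + Rabs K2) / sg ^ 6).
{ intros K HKK. apply Rmult_le_compat_r; [left; now apply Rinv_0_lt_compat|].
  pose proof (Rabs_pos K1). pose proof (Rabs_pos K2). destruct HKK as [-> | ->]; lra. }
assert (Hqs : 0 < q * sg) by (apply Rmult_lt_0_compat; lra).
destruct (Rle_dec 0 (Re w)) as [Hx|Hx].
- eapply Rle_trans; [apply (Key K1)|apply Hsum; auto]. apply HK1; trivial.
  + rewrite unchart_start.
    assert (Cmod (w - 1) <= (1 - Rabs (Re w)) + Rabs (Im w)).
    { eapply Rle_trans; [apply Cmod_le_Re_Im|]. replace (Re (w - 1)) with (- (1 - Re w)) by (unfold Re; simpl; ring).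
      replace (Im (w - 1)) with (Im w) by (unfold Im; simpl; ring). rewrite Rabs_Ropp, (Rabs_pos_eq (Re w)) in * by trivial.
      rewrite Rabs_pos_eq; lra. }
    eapply Rle_trans; [|exact Hh]. replace (s / 2 * (s * Cmod (w - 1))) with (s * s / 2 * Cmod (w - 1)) by field.
    apply Rmult_le_compat_l; nra.
  + rewrite unchart_start, Rpow_mult_distr, Hsg8, Rmult_comm. apply Rmult_le_compat_l; [lra|].
    eapply Rle_trans; [exact Hq8|apply Rmin_l].
- eapply Rle_trans; [apply (Key K2)|apply Hsum; auto]. apply HK2; trivial.
  + rewrite unchart_end.
    assert (Cmod (w + 1) <= (1 - Rabs (Re w)) + Rabs (Im w)).
    { eapply Rle_trans; [apply Cmod_le_Re_Im|]. replace (Re (w + 1)) with (1 + Re w) by (unfold Re; simpl; ring).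
      replace (Im (w + 1)) with (Im w) by (unfold Im; simpl; ring). rewrite (Rabs_left (Re w)) in * by lra.
      rewrite Rabs_pos_eq; lra. }
    eapply Rle_trans; [|exact Hh]. replace (s / 2 * (s * Cmod (w + 1))) with (s * s / 2 * Cmod (w + 1)) by field.
    apply Rmult_le_compat_l; nra.
  + rewrite unchart_end, Rpow_mult_distr, Hsg8, Rmult_comm. apply Rmult_le_compat_l; [lra|].
    eapply Rle_trans; [exact Hq8|apply Rmin_r].
Qed.
End Arc.

Definition barrier_derive (p z : C) : C :=
  (barrier p z * (- (15 / 16)%R * (/ (1 - z * Cconj p) * (0 - (1 * Cconj p + z * 0)))))%C.

(** The barrier of the nearer end point beats [V], and the other barrier has nonnegative real part.
    The exponential decay absorbs the [sg^(-32)] of the derivatives. The power [sg^32] is the square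
    of the distance, matching the two factors [1 / (1 - |z|)] of [f1' f2']. *)
Lemma damped_bounds (p1 p2 : C) (K' : R) : Cmod p1 = 1 -> Cmod p2 = 1 -> 0 <= K' ->
  exists K, 0 <= K /\ forall z V V' sg, Cmod z < 1 -> 0 < sg -> sg ^ 16 = Rmin (Cmod (z - p1)) (Cmod (z - p2)) ->
   Cmod V * sg ^ 14 <= K' -> Cmod V' * sg ^ 32 <= K' ->
   Cmod (Cexp (V - (barrier p1 z + barrier p2 z))) <= K * sg ^ 32 /\
   Cmod (Cexp (V - (barrier p1 z + barrier p2 z)) * (V' - (barrier_derive p1 z + barrier_derive p2 z))) <= K.
Proof.
intros Hp1 Hp2 HK'.
set (kap := cos (15 / 32 * PI)). assert (Hkap : 0 < kap) by apply cos_15_32.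
destruct (exp_beats_pow K' kap 32 Hkap) as [C0 [HC0 HE]].
exists (C0 * (K' + 4) + C0). split; [nra|].
intros z V V' sg Hz Hsg Hs16 HV HV'.
assert (Hz1 : 0 < Cmod (z - p1)) by (pose proof (pow_lt sg 16 Hsg); pose proof (Rmin_l (Cmod (z - p1)) (Cmod (z - p2))); lra).
assert (Hz2 : 0 < Cmod (z - p2)) by (pose proof (pow_lt sg 16 Hsg); pose proof (Rmin_r (Cmod (z - p1)) (Cmod (z - p2))); lra).
destruct (nth_root 15 _ Hz1) as [s1 [Hs1 Es1]]. destruct (nth_root 15 _ Hz2) as [s2 [Hs2 Es2]].
assert (L1 : sg <= s1) by (apply (pow_le_inv 15); try lra; rewrite Es1, Hs16; apply Rmin_l).
assert (L2 : sg <= s2) by (apply (pow_le_inv 15); try lra; rewrite Es2, Hs16; apply Rmin_r).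
assert (Hsg2 : sg <= 2).
{ apply (pow_le_inv 15); try lra. pose proof (Cmod_triangle_sub z p1). pose proof (Rmin_l (Cmod (z - p1)) (Cmod (z - p2))). lra. }
destruct (Re_barrier p1 Hp1 z s1 Hz Hs1 Es1) as [B1 _]. destruct (Re_barrier p2 Hp2 z s2 Hz Hs2 Es2) as [B2 _].
fold kap in B1, B2.
assert (P1 : 0 <= kap / s1 ^ 15) by (apply Rdiv_le_0_compat; [lra|now apply pow_lt]).
assert (P2 : 0 <= kap / s2 ^ 15) by (apply Rdiv_le_0_compat; [lra|now apply pow_lt]).
assert (BB : kap / sg ^ 15 <= Re (barrier p1 z) + Re (barrier p2 z)).
{ destruct (Rle_dec (Cmod (z - p1)) (Cmod (z - p2))) as [Hl|Hl].
  - rewrite Rmin_left in Hs16 by trivial. destruct (Re_barrier p1 Hp1 z sg Hz Hsg Hs16) as [B3 _]. fold kap in B3. lra.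
  - rewrite Rmin_right in Hs16 by lra. destruct (Re_barrier p2 Hp2 z sg Hz Hsg Hs16) as [B3 _]. fold kap in B3. lra. }
assert (S14 : 0 < sg ^ 14) by now apply pow_lt.
assert (S31 : 0 < sg ^ 31) by now apply pow_lt.
assert (S32 : 0 < sg ^ 32) by now apply pow_lt.
assert (HReV : Re V <= K' / sg ^ 14).
{ apply Rmult_le_reg_r with (sg ^ 14); trivial. replace (K' / sg ^ 14 * sg ^ 14) with K' by (field; lra).
  apply Rle_trans with (Cmod V * sg ^ 14); trivial. apply Rmult_le_compat_r; [lra|].
  pose proof (re_le_Cmod V). pose proof (Rle_abs (Re V)). lra. }
assert (M1 : Cmod (Cexp (V - (barrier p1 z + barrier p2 z))) <= C0 * sg ^ 32).
{ rewrite Cmod_Cexp.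
  replace (Re (V - (barrier p1 z + barrier p2 z))) with (Re V - (Re (barrier p1 z) + Re (barrier p2 z))) by (unfold Re; simpl; ring).
  eapply Rle_trans; [|apply (HE sg); lra].
  destruct (Rle_lt_or_eq_dec (Re V - (Re (barrier p1 z) + Re (barrier p2 z))) (K' / sg ^ 14 - kap / sg ^ 15) ltac:(lra)) as [Hl|He];
    [left; now apply exp_increasing|rewrite He; lra]. }
split.
{ eapply Rle_trans; [exact M1|]. apply Rmult_le_compat_r; [lra|]. assert (0 <= C0 * (K' + 4)) by (apply Rmult_le_pos; lra). lra. }
rewrite Cmod_mult.
assert (D1 : Cmod (barrier_derive p1 z) <= 2 / sg ^ 32).
{ eapply Rle_trans; [apply (barrier_derive_bound p1 Hp1 z s1 Hz Hs1 Es1)|].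
  apply Rle_trans with (/ sg ^ 31); [apply Rinv_le_contravar; [trivial|apply pow_incr; lra]|].
  apply Rmult_le_reg_r with (sg ^ 32); trivial. replace (/ sg ^ 31 * sg ^ 32) with sg by (field; lra).
  replace (2 / sg ^ 32 * sg ^ 32) with 2 by (field; lra). trivial. }
assert (D2 : Cmod (barrier_derive p2 z) <= 2 / sg ^ 32).
{ eapply Rle_trans; [apply (barrier_derive_bound p2 Hp2 z s2 Hz Hs2 Es2)|].
  apply Rle_trans with (/ sg ^ 31); [apply Rinv_le_contravar; [trivial|apply pow_incr; lra]|].
  apply Rmult_le_reg_r with (sg ^ 32); trivial. replace (/ sg ^ 31 * sg ^ 32) with sg by (field; lra).
  replace (2 / sg ^ 32 * sg ^ 32) with 2 by (field; lra). trivial. }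
assert (D : Cmod (V' - (barrier_derive p1 z + barrier_derive p2 z)) <= (K' + 4) / sg ^ 32).
{ pose proof (Cmod_triangle_sub V' (barrier_derive p1 z + barrier_derive p2 z)).
  pose proof (Cmod_triangle (barrier_derive p1 z) (barrier_derive p2 z)).
  assert (Cmod V' <= K' / sg ^ 32).
  { apply Rmult_le_reg_r with (sg ^ 32); trivial. replace (K' / sg ^ 32 * sg ^ 32) with K' by (field; lra). trivial. }
  replace ((K' + 4) / sg ^ 32) with (K' / sg ^ 32 + 2 / sg ^ 32 + 2 / sg ^ 32) by (field; lra). lra. }
apply Rle_trans with (C0 * sg ^ 32 * ((K' + 4) / sg ^ 32)).
- apply Rmult_le_compat; trivial; apply Cmod_ge_0.
- replace (C0 * sg ^ 32 * ((K' + 4) / sg ^ 32)) with (C0 * (K' + 4)) by (field; lra). lra.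
Qed.

(** * Construction of the factor of one arc *)

Section ArcFactor.
Context (u : C) (s c : R) (Hu : Cmod u = 1) (Hs : 0 < s) (Hsc : s <= c) (Hpy : s * s + c * c = 1).
Context (xi : C) (del m : R) (H1 : Cmod (arc_start u s c - xi) <= m) (H2 : Cmod (arc_end u s c - xi) <= m) (Hm : 3 * m < del).
Context (L L' : C -> C) (HL : holo (cap xi del) L L').
Context (G1 : stolz_growth xi del (arc_start u s c) L) (G2 : stolz_growth xi del (arc_end u s c) L).

Let ch := chart u s c.

Lemma holo_chart (U : C -> Prop) : holo U ch (fun _ => / dir u s)%C.
Proof.
eapply holo_ext; [|apply (holo_mult U (fun z => z - mid u c)%C (fun _ => 1 - 0)%C (fun _ => / dir u s)%C (fun _ => 0%C))].
2:{ apply holo_minus; [apply holo_id|apply holo_const]. }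
2:{ apply holo_const. }
intros z; simpl; ring.
Qed.

Lemma chart_dist (v z : C) : Cmod (ch v - ch z) = Cmod (v - z) / s.
Proof.
unfold ch, chart. replace ((v - mid u c) * / dir u s - (z - mid u c) * / dir u s)%C with ((v - z) * / dir u s)%C by ring.
rewrite Cmod_mult, Cmod_inv, (Cmod_dir u s Hu Hs); trivial. now apply dir_ne0.
Qed.

Lemma openC_level (phi : C -> R) : (forall a b, phi a - phi b <= 2 * Cmod (a - b)) ->
  openC (fun z => Cmod z < 1 /\ phi (ch z) < 0).
Proof.
intros Hphi z [Hz1 Hz2].
exists (Rmin (1 - Cmod z) (- phi (ch z) * s / 4)). split.
- apply Rmin_pos; [lra|]. apply Rdiv_lt_0_compat; [|lra]. apply Rmult_lt_0_compat; lra.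
- intros v Hv. assert (W1 := Rlt_le_trans _ _ _ Hv (Rmin_l _ _)). assert (W2 := Rlt_le_trans _ _ _ Hv (Rmin_r _ _)).
  split; [pose proof (Cmod_triangle_rev v z); lra|].
  specialize (Hphi (ch v) (ch z)). rewrite chart_dist in Hphi.
  assert (Cmod (v - z) / s < - phi (ch z) / 4).
  { apply Rmult_lt_reg_r with s; trivial. replace (Cmod (v - z) / s * s) with (Cmod (v - z)) by (field; lra). lra. }
  lra.
Qed.

Lemma upper_side_cap (z : C) : Cmod z < 1 -> - (1 - Rabs (Re (ch z))) < Im (ch z) ->
  Rabs (Re (ch z)) < 1 /\ cap xi del z.
Proof.
intros Hz HV.
assert (B : Rabs (Re (ch z)) < 1 /\ Rabs (Im (ch z)) <= 1).
{ destruct (Rle_dec 0 (Im (ch z))) as [Hy|Hy].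
  - destruct (disc_upper u s c Hu Hs Hsc Hpy z Hz Hy) as [B1 B2]. split; trivial. rewrite Rabs_pos_eq; trivial.
  - pose proof (Rabs_pos (Re (ch z))). rewrite (Rabs_left (Im (ch z))) by lra. lra. }
split; [tauto|]. apply (near_cap u s c Hu Hs xi del m); trivial; unfold ch in *; lra.
Qed.

(** The exponent of [E] is [lo] away from the arc and [up - L] near it, minus both barriers. The two
    expressions agree where both are defined. Near the arc [Cexp L] cancels the logarithm and leaves
    the damped exponential of [up]. *)
Lemma arc_factor : exists E E' K, 0 <= K /\ holo (fun z => Cmod z < 1) E E' /\
  (forall z, E z <> 0%C) /\
  (forall z, Cmod z < 1 -> arc_outside u s c z -> Cmod (E z) <= K /\ Cmod (E' z) <= K) /\
  (forall z, Cmod z < 1 -> arc_outside u s c z -> arc_sector u s c z -> Cmod (E z) <= K * (1 - Cmod z) ^ 2) /\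
  (forall z, Cmod z < 1 -> arc_inside u s c z -> cap xi del z /\
     Cmod (Cexp (L z) * E z) <= K /\ Cmod (Cexp (L z) * (L' z * E z + E' z)) <= K).
Proof.
set (p1 := arc_start u s c). set (p2 := arc_end u s c).
assert (Hp1 : Cmod p1 = 1) by now apply unit_start.
assert (Hp2 : Cmod p2 = 1) by now apply unit_end.
assert (Hs1 : s <= 1) by nra.
destruct (Tri_growth u s c Hu Hs Hsc Hpy xi del m H1 H2 Hm L G1 G2) as [KT HKT].
set (Om := fun w => cap xi del (unchart u s c w)).
assert (UD : forall a b, Cmod (unchart u s c a - unchart u s c b) = s * Cmod (a - b)).
{ intros a b. unfold unchart. replace (mid u c + dir u s * a - (mid u c + dir u s * b))%C with (dir u s * (a - b))%C by ring.
  now rewrite Cmod_mult, (Cmod_dir u s Hu Hs). }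
assert (OmO : openC Om).
{ intros w Hw. destruct (openC_cap xi del _ Hw) as [r [Hr Hb]]. exists (r / s). split; [now apply Rdiv_lt_0_compat|].
  intros v Hv. apply Hb. rewrite UD. apply (Rmult_lt_compat_l s) in Hv; trivial. replace (s * (r / s)) with r in Hv by (field; lra). trivial. }
assert (OmC : convexC Om).
{ intros a b t Ha Hb Ht. unfold Om. replace (unchart u s c (a + t * (b - a))) with (unchart u s c a + t * (unchart u s c b - unchart u s c a))%C.
  - now apply convexC_cap.
  - unfold unchart; ring. }
assert (Hun : holo Om (unchart u s c) (fun _ => dir u s)).
{ eapply holo_ext; [|apply holo_plus; [apply holo_const|apply holo_scal, holo_id]]. intros z; simpl; ring. }
assert (HLt : holo Om (fun w => L (unchart u s c w)) (fun w => L' (unchart u s c w) * dir u s)%C).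
{ apply (holo_comp Om (cap xi del) L L' (unchart u s c)); trivial. }
assert (HTriOm : forall w, Tri w -> Om w).
{ intros w HT. assert (HT' := HT). rewrite (surjective_pairing w) in HT'. change (Tri (Re w, Im w)) in HT'.
  destruct (Tri_height u s c Hu Hs Hsc Hpy (Re w) (Im w) HT') as [_ Hlt].
  rewrite <- (surjective_pairing w : w = (Re w, Im w)) in Hlt. destruct HT as [T1 [T2 T3]].
  apply (near_cap u s c Hu Hs xi del m); trivial; rewrite (chart_unchart u s c Hu Hs); [lra|].
  rewrite Rabs_left1 by trivial. pose proof (Rabs_pos (Re w)). lra. }
destruct (cauchy_splitting Om _ _ KT OmO OmC HLt HTriOm HKT) as [lo [lo' [up [up' [K' [Hlo [Hup [Hj [Blo Bup]]]]]]]]].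
set (D := fun z => Cmod z < 1).
set (V1 := fun z => Im (ch z) < 0). set (V2 := fun z => - (1 - Rabs (Re (ch z))) < Im (ch z)).
set (h1 := fun z => lo (ch z)). set (h2 := fun z => (up (ch z) - L z)%C).
(* The case distinction runs inside the overlap of [V1] and [V2], so either formula is valid on a
   neighbourhood of the dividing line. *)
set (h := fun z => if excluded_middle_informative (arc_inside u s c z) then h2 z else h1 z).
assert (HV2R : forall z, D z -> arc_inside u s c z -> V2 z).
{ intros z Hz HR. now apply (inside_bounds u s c Hu Hs Hsc Hpy). }
assert (HV1R : forall z, D z -> arc_outside u s c z -> V1 z).
{ intros z Hz HR. now apply (outside_lower u s c Hu Hs Hsc Hpy). }
assert (Tot : forall z, ~ arc_inside u s c z -> arc_outside u s c z).
{ intros z HR. unfold arc_inside, arc_outside in *. lra. }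
assert (Hagree : forall z, D z -> V1 z -> V2 z -> h1 z = h2 z).
{ intros z Hz Z1 Z2. unfold h1, h2. destruct (upper_side_cap z Hz Z2) as [X _].
  rewrite (Hj (ch z) X (conj Z2 Z1)). unfold ch. now rewrite (unchart_chart u s c Hu Hs). }
assert (Eh1 : forall z, D z /\ V1 z -> h1 z = h z).
{ intros z [Hz Z1]. unfold h. destruct (excluded_middle_informative _); trivial. apply Hagree; auto. }
assert (Eh2 : forall z, D z /\ V2 z -> h2 z = h z).
{ intros z [Hz Z2]. unfold h. destruct (excluded_middle_informative _); trivial. symmetry; apply Hagree; auto. }
assert (OV1 : openC (fun z => D z /\ V1 z)).
{ apply (openC_level (fun w => Im w)). intros a b. destruct (dist_coord a b) as [_ A]. pose proof (Rle_abs (Im a - Im b)). pose proof (Cmod_ge_0 (a - b)). lra. }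
assert (OV2 : openC (fun z => D z /\ V2 z)).
{ assert (O := openC_level (fun w => - (1 - Rabs (Re w)) - Im w)).
  intros z [Hz Z2]. destruct O with (z := z) as [r [Hr Hb]].
  - intros a b. destruct (dist_coord a b) as [A1 A2]. pose proof (Rabs_triang_inv (Re a) (Re b)). pose proof (Rle_abs (- (Im a - Im b))) as Q. rewrite Rabs_Ropp in Q. lra.
  - unfold V2 in Z2. split; [trivial|lra].
  - exists r; split; trivial. intros v Hv. destruct (Hb v Hv) as [B1 B2]. unfold V2. split; [exact B1|lra]. }
assert (Hh1 : holo (fun z => D z /\ V1 z) h1 (fun z => lo' (ch z) * / dir u s)%C).
{ apply (holo_comp _ (fun w => Im w < 0) lo lo' ch); trivial; [apply holo_chart|]. intros z [_ Z1]; exact Z1. }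
assert (Hh2 : holo (fun z => D z /\ V2 z) h2 (fun z => up' (ch z) * / dir u s - L' z)%C).
{ apply holo_minus.
  - apply (holo_comp _ (fun w => - (1 - Rabs (Re w)) < Im w) up up' ch); trivial; [apply holo_chart|]. intros z [_ Z2]; exact Z2.
  - apply (holo_sub (cap xi del)); trivial. intros z [Hz Z2]. now apply upper_side_cap. }
assert (Hh : holo D h (C_derive h)).
{ apply (fun Cov => holo_glue D V1 V2 h h1 _ h2 _ OV1 OV2 Cov Hh1 Hh2 Eh1 Eh2).
  intros z Hz. destruct (excluded_middle_informative (arc_inside u s c z)); [right|left]; auto. }
assert (Dh1 : forall z, D z -> V1 z -> C_derive h z = (lo' (ch z) * / dir u s)%C).
{ intros z Hz Z1. apply (is_Cderive_unique h z); [now apply Hh|].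
  apply (holo_ext_fun (fun z => D z /\ V1 z) h1 h (fun z => lo' (ch z) * / dir u s)%C); trivial. split; trivial. }
assert (Dh2 : forall z, D z -> V2 z -> C_derive h z = (up' (ch z) * / dir u s - L' z)%C).
{ intros z Hz Z2. apply (is_Cderive_unique h z); [now apply Hh|].
  apply (holo_ext_fun (fun z => D z /\ V2 z) h2 h (fun z => up' (ch z) * / dir u s - L' z)%C); trivial. split; trivial. }
set (E := fun z => Cexp (h z - (barrier p1 z + barrier p2 z))).
set (E' := fun z => (E z * (C_derive h z - (barrier_derive p1 z + barrier_derive p2 z)))%C).
assert (HE : holo D E E').
{ apply holo_Cexp, holo_minus; trivial. apply holo_plus; now apply holo_barrier. }
set (K2 := Rabs K' / s).
assert (HK2 : 0 <= K2) by (apply Rdiv_le_0_compat; [apply Rabs_pos|trivial]).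
assert (HKK2 : Rabs K' <= K2).
{ unfold K2. apply Rmult_le_reg_r with s; trivial. replace (Rabs K' / s * s) with (Rabs K') by (field; lra). pose proof (Rabs_pos K'). nra. }
destruct (damped_bounds p1 p2 K2 Hp1 Hp2 HK2) as [K3 [HK3 HB]].
(* One root serves two purposes: [sg^16] is the distance for the barriers, and [q = sg^2] is
   admissible in the splitting bounds, since [s <= 1]. *)
assert (Root : forall z, D z -> exists sg, 0 < sg /\ sg ^ 16 = Rmin (Cmod (z - p1)) (Cmod (z - p2)) /\ sg ^ 16 = s * corner_dist (ch z)).
{ intros z Hz.
  assert (Emin : Rmin (Cmod (z - p1)) (Cmod (z - p2)) = s * corner_dist (ch z)).
  { assert (Q1 := unchart_start u s c Hu Hs (ch z)). assert (Q2 := unchart_end u s c Hu Hs (ch z)).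
    unfold ch in Q1 at 1, Q2 at 1. rewrite (unchart_chart u s c Hu Hs) in Q1, Q2. fold p1 in Q1. fold p2 in Q2.
    rewrite Q1, Q2. unfold corner_dist.
    set (a := Cmod (ch z - 1)). set (b := Cmod (ch z + 1)).
  destruct (Rle_dec a b) as [Hab|Hab].
  - assert (s * a <= s * b) by (apply Rmult_le_compat_l; lra). rewrite (Rmin_left (s * a)), (Rmin_left a) by lra. reflexivity.
  - assert (s * b <= s * a) by (apply Rmult_le_compat_l; lra). rewrite (Rmin_right (s * a)), (Rmin_right a) by lra. reflexivity. }
  assert (Pos : 0 < Rmin (Cmod (z - p1)) (Cmod (z - p2))).
  { unfold D in Hz. pose proof (Cmod_triangle_rev p1 z). pose proof (Cmod_triangle_rev p2 z).
    rewrite Cmod_sub_sym in H. rewrite Cmod_sub_sym in H0. apply Rmin_pos; lra. }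
  destruct (nth_root 15 _ Pos) as [sg [Hsg Es]]. exists sg. rewrite <- Emin. auto. }
assert (Base : forall z V V' sg, D z -> 0 < sg -> sg ^ 16 = Rmin (Cmod (z - p1)) (Cmod (z - p2)) -> sg ^ 16 = s * corner_dist (ch z) ->
   (forall q, 0 < q -> q ^ 8 <= corner_dist (ch z) -> Cmod V * q ^ 7 <= K' /\ Cmod V' * q ^ 16 <= K') ->
   Cmod (Cexp (V - (barrier p1 z + barrier p2 z))) <= K3 * sg ^ 32 /\
   Cmod (Cexp (V - (barrier p1 z + barrier p2 z)) * (V' * / dir u s - (barrier_derive p1 z + barrier_derive p2 z))) <= K3).
{ intros z V V' sg Hz Hsg Es1 Es2 HVV.
  assert (Hdd : 0 <= corner_dist (ch z)) by (apply Rmin_glb; apply Cmod_ge_0).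
  destruct (HVV (sg ^ 2)) as [A1 A2]; [now apply pow_lt| |].
  { replace ((sg ^ 2) ^ 8) with (sg ^ 16) by ring. rewrite Es2. nra. }
  replace ((sg ^ 2) ^ 7) with (sg ^ 14) in A1 by ring. replace ((sg ^ 2) ^ 16) with (sg ^ 32) in A2 by ring.
  pose proof (Rle_abs K'). apply HB; trivial; [lra|].
  rewrite Cmod_mult, Cmod_inv, (Cmod_dir u s Hu Hs) by (now apply dir_ne0).
  unfold K2. replace (Cmod V' * / s * sg ^ 32) with (Cmod V' * sg ^ 32 / s) by (field; lra).
  apply Rmult_le_compat_r; [left; now apply Rinv_0_lt_compat|lra]. }
assert (Hsmall : forall sg z, D z -> 0 < sg -> sg ^ 16 = Rmin (Cmod (z - p1)) (Cmod (z - p2)) -> sg ^ 32 <= 4).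
{ intros sg z Hz Hsg Es. pose proof (Cmod_triangle_sub z p1). pose proof (Rmin_l (Cmod (z - p1)) (Cmod (z - p2))).
  unfold D in Hz. replace (sg ^ 32) with (sg ^ 16 * sg ^ 16) by ring. assert (0 < sg ^ 16) by now apply pow_lt. nra. }
assert (Out : forall z, D z -> arc_outside u s c z -> exists sg, 0 < sg /\ sg ^ 16 = s * corner_dist (ch z) /\ sg ^ 32 <= 4 /\ Cmod (E z) <= K3 * sg ^ 32 /\ Cmod (E' z) <= K3).
{ intros z Hz HR. destruct (Root z Hz) as [sg [Hsg [Es1 Es2]]]. exists sg. split; [trivial|split; [trivial|split; [now apply (Hsmall sg z)|]]].
  assert (Z1 := HV1R z Hz HR).
  unfold E', E. rewrite (Dh1 z Hz Z1), <- (Eh1 z (conj Hz Z1)).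
  apply Base; trivial. intros q Hq Hq8. apply Blo; trivial. }
exists E, E', (4 * K3 + K3 * (4 / (s * s))).
assert (HKs : 0 <= K3 * (4 / (s * s))) by (apply Rmult_le_pos; [trivial|apply Rdiv_le_0_compat; nra]).
split; [lra|split; [exact HE|split; [intros z; apply Cexp_ne0|split; [|split]]]].
- intros z Hz HR. destruct (Out z Hz HR) as [sg [Hsg [_ [S4 [A1 A2]]]]].
  assert (K3 * sg ^ 32 <= K3 * 4) by (apply Rmult_le_compat_l; lra). split; lra.
- intros z Hz HR HS. destruct (Out z Hz HR) as [sg [Hsg [Es [_ [A1 _]]]]].
  assert (F := sector_height u s c Hu Hs Hsc Hpy z Hz HR HS). fold ch in F.
  assert (Hdd : 0 <= corner_dist (ch z)) by (apply Rmin_glb; apply Cmod_ge_0).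
  assert (F2 : s * corner_dist (ch z) <= 2 / s * (1 - Cmod z)).
  { apply Rmult_le_reg_r with (s / 2); [lra|]. replace (2 / s * (1 - Cmod z) * (s / 2)) with (1 - Cmod z) by (field; lra). lra. }
  assert (Hz' : 0 < 1 - Cmod z) by lra.
  (* By [sector_height] the distance [sg^16] is at most [2 / s] times the height; squaring gives the
     constant. *)
  assert (F3 : sg ^ 32 <= 4 / (s * s) * (1 - Cmod z) ^ 2).
  { replace (sg ^ 32) with (sg ^ 16 * sg ^ 16) by ring. rewrite Es.
    replace (4 / (s * s) * (1 - Cmod z) ^ 2) with ((2 / s * (1 - Cmod z)) * (2 / s * (1 - Cmod z))) by (field; lra).
    apply Rmult_le_compat; trivial; nra. }
  apply Rle_trans with (K3 * (4 / (s * s) * (1 - Cmod z) ^ 2)).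
  + apply Rle_trans with (K3 * sg ^ 32); [trivial|now apply Rmult_le_compat_l].
  + pose proof (pow2_ge_0 (1 - Cmod z)). rewrite <- Rmult_assoc. apply Rmult_le_compat_r; lra.
- intros z Hz HR. assert (Z2 := HV2R z Hz HR). destruct (upper_side_cap z Hz Z2) as [_ Hcap]. split; [trivial|].
  destruct (Root z Hz) as [sg [Hsg [Es1 Es2]]].
  assert (S4 := Hsmall sg z Hz Hsg Es1).
  destruct (Base z (up (ch z)) (up' (ch z)) sg Hz Hsg Es1 Es2) as [A1 A2].
  { intros q Hq Hq8. apply Bup; trivial. }
  assert (EE : (Cexp (L z) * E z)%C = Cexp (up (ch z) - (barrier p1 z + barrier p2 z))).
  { unfold E. rewrite <- Cexp_plus, <- (Eh2 z (conj Hz Z2)). unfold h2. f_equal; ring. }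
  split.
  + rewrite EE. assert (K3 * sg ^ 32 <= K3 * 4) by (apply Rmult_le_compat_l; lra). lra.
  + unfold E'. rewrite (Dh2 z Hz Z2).
    replace (Cexp (L z) * (L' z * E z + E z * (up' (ch z) * / dir u s - L' z - (barrier_derive p1 z + barrier_derive p2 z))))%C
      with ((Cexp (L z) * E z) * (up' (ch z) * / dir u s - (barrier_derive p1 z + barrier_derive p2 z)))%C by ring.
    rewrite EE. lra.
Qed.
End ArcFactor.

(** * Covering the disc by sectors *)

Lemma eit_plus (a b : R) : eit (a + b) = (eit a * eit b)%C.
Proof. unfold eit, Cmult; simpl. rewrite cos_plus, sin_plus. f_equal; ring. Qed.

Lemma eit_conj (a : R) : Cconj (eit a) = eit (- a).
Proof. unfold eit, Cconj; simpl. now rewrite cos_neg, sin_neg. Qed.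

(** Rotating by [- a - PI] carries the prescribed range of angles to [[-PI, PI]], where the
    half-angle formula applies; the negative axis is treated apart. *)
Lemma polar (a : R) (z : C) : exists t, a <= t <= a + 2 * PI /\ z = (Cmod z * eit t)%C.
Proof.
pose proof PI_RGT_0 as HPI.
set (v := (z * eit (- a - PI))%C).
assert (Hv : exists t, - PI <= t <= PI /\ v = (Cmod v * eit t)%C).
{ destruct (Rlt_dec 0 (Cmod v + Re v)) as [H|H].
  - exists (2 * atan (Im v / (Cmod v + Re v))). split.
    + pose proof (atan_bound (Im v / (Cmod v + Re v))). lra.
    + rewrite <- (Cexp_Clog v H) at 1. unfold Cexp, Clog, eit; cbn [Re Im fst snd].
      pose proof (slit_Cmod_pos v H). rewrite exp_ln by trivial. unfold Cmult, RtoC; cbn [fst snd]. f_equal; ring.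
  - exists PI. split; [lra|]. unfold eit. rewrite cos_PI, sin_PI.
    pose proof (re_le_Cmod v) as A. pose proof (Rabs_maj2 (Re v)).
    assert (E : Re v = - Cmod v) by lra.
    pose proof (Cmod2_alt v) as M. rewrite E in M.
    assert (I : Im v = 0) by nra.
    rewrite (surjective_pairing v) at 1. unfold Re, Im in *. rewrite E, I. unfold Cmult, RtoC; cbn [fst snd]. f_equal; ring. }
destruct Hv as [t [Ht E]].
assert (Hm : Cmod v = Cmod z) by (unfold v; rewrite Cmod_mult, Cmod_eit; ring).
exists (t + a + PI). split; [lra|].
rewrite eit_plus, eit_plus, <- Hm.
replace (Cmod v * (eit t * eit a * eit PI))%C with (Cmod v * eit t * (eit a * eit PI))%C by ring.
rewrite <- E, <- eit_plus. unfold v.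
replace (z * eit (- a - PI) * eit (a + PI))%C with (z * (eit (- a - PI) * eit (a + PI)))%C by ring.
rewrite <- eit_plus. replace (- a - PI + (a + PI)) with 0 by ring.
unfold eit. rewrite cos_0, sin_0. unfold Cmult; destruct z; cbn [fst snd]. f_equal; ring.
Qed.

Lemma chart_affine (u : C) (s c t : R) (a b : C) :
  chart u s c (a + t * (b - a)) = (chart u s c a + t * (chart u s c b - chart u s c a))%C.
Proof. unfold chart; ring. Qed.

Section ChartGeometry.
Context (u : C) (s c : R) (Hu : Cmod u = 1) (Hs : 0 < s) (Hsc : s <= c) (Hpy : s * s + c * c = 1).

Definition strict_sector (z : C) : Prop := c * Rabs (Re (chart u s c z)) < s * Im (chart u s c z) + c.

(** Although the chart is affine, these combinations are linear in [z]: they are, up to sign, the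
    coordinates in the frame turned by [u]. So sectors are described by homogeneous conditions. *)
Lemma chart_rotated (z : C) :
  c + s * Im (chart u s c z) = Re (z * Cconj u) /\ s * Re (chart u s c z) = - Im (z * Cconj u).
Proof.
set (w := chart u s c z).
assert (E : (z * Cconj u)%C = (c - Ci * s * w)%C).
{ rewrite <- (unchart_chart u s c Hu Hs z). fold w. unfold unchart, mid, dir.
  replace ((u * c + u * - (Ci * s) * w) * Cconj u)%C with ((u * Cconj u) * (c - Ci * s * w))%C by ring.
  rewrite (conj_unit u Hu). ring. }
rewrite E. unfold Re, Im, Ci, Cminus, Cplus, Copp, Cmult, RtoC; cbn [fst snd]. split; ring.
Qed.

Lemma chart_scale (t : R) (z : C) :
  c + s * Im (chart u s c (t * z)) = t * (c + s * Im (chart u s c z)) /\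
  Re (chart u s c (t * z)) = t * Re (chart u s c z).
Proof.
destruct (chart_rotated z) as [A B]. destruct (chart_rotated (t * z)) as [A' B'].
assert (E : (t * z * Cconj u)%C = (t * (z * Cconj u))%C) by ring.
assert (E1 : Re (t * z * Cconj u) = t * Re (z * Cconj u)) by (rewrite E; unfold Re; simpl; ring).
assert (E2 : Im (t * z * Cconj u) = t * Im (z * Cconj u)) by (rewrite E; unfold Im; simpl; ring).
rewrite A', E1, A. split; trivial.
apply Rmult_eq_reg_l with s; [|lra]. rewrite B', E2. replace (s * (t * Re (chart u s c z))) with (t * (s * Re (chart u s c z))) by ring.
rewrite B. ring.
Qed.

(** The complement of an arc region is star-shaped about 0; this allows integration along radii
    later on. *)
Lemma outside_scale (t : R) (z : C) : 0 <= t <= 1 -> arc_outside u s c z -> arc_outside u s c (t * z)%C.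
Proof.
unfold arc_outside. intros Ht H. destruct (chart_scale t z) as [A B]. rewrite B, Rabs_mult, (Rabs_pos_eq t) by lra.
set (y' := Im (chart u s c (t * z))) in *. set (y := Im (chart u s c z)) in *. set (X := Rabs (Re (chart u s c z))) in *.
assert (s * y' <= s * (- (1 - t * X) / 2)); [|nra].
assert (H1 : 2 * (s * y) <= - s + s * X) by nra.
assert (t * (2 * (s * y)) <= t * (- s + s * X)) by (apply Rmult_le_compat_l; lra).
assert (t * (2 * c - s) <= 2 * c - s) by nra. nra.
Qed.

Lemma inside_strict (z : C) : Cmod z < 1 -> arc_inside u s c z -> strict_sector z.
Proof.
intros Hz HI. destruct (inside_bounds u s c Hu Hs Hsc Hpy z Hz HI) as [Hx _].
unfold arc_inside, strict_sector in *. set (y := Im _) in *. set (X := Rabs _) in *.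
assert (s * (- (1 - X) / 2) <= s * y) by (apply Rmult_le_compat_l; lra).
assert (s * (1 - X) <= c * (1 - X)) by (apply Rmult_le_compat_r; lra). nra.
Qed.
End ChartGeometry.

Section Sectors.
Context (th : nat -> R) (N : nat).
Context (Hth : forall k, (k < N)%nat -> 0 < th (S k) - th k <= PI / 2).
Context (HthN : th N = th O + 2 * PI).

Definition half_angle (k : nat) : R := (th (S k) - th k) / 2.
Definition arc_dir (k : nat) : C := eit ((th k + th (S k)) / 2).
Definition arc_sin (k : nat) : R := sin (half_angle k).
Definition arc_cos (k : nat) : R := cos (half_angle k).

Lemma arc_dir_unit (k : nat) : Cmod (arc_dir k) = 1.
Proof. apply Cmod_eit. Qed.

Lemma arc_pyth (k : nat) : arc_sin k * arc_sin k + arc_cos k * arc_cos k = 1.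
Proof. exact (sin2_cos2 (half_angle k)). Qed.

Lemma half_angle_bounds (k : nat) : (k < N)%nat -> 0 < half_angle k <= PI / 4.
Proof. intros Hk; specialize (Hth k Hk); unfold half_angle; lra. Qed.

Lemma arc_sin_pos (k : nat) : (k < N)%nat -> 0 < arc_sin k.
Proof. intros Hk; pose proof (half_angle_bounds k Hk); pose proof PI_RGT_0. apply sin_gt_0; lra. Qed.

Lemma arc_sin_le_cos (k : nat) : (k < N)%nat -> arc_sin k <= arc_cos k.
Proof.
intros Hk; pose proof (half_angle_bounds k Hk); pose proof PI_RGT_0. unfold arc_sin, arc_cos.
rewrite <- cos_shift. apply cos_decr_1; lra.
Qed.

Lemma arc_start_eit (k : nat) : arc_start (arc_dir k) (arc_sin k) (arc_cos k) = eit (th k).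
Proof.
unfold arc_start, arc_dir, arc_sin, arc_cos.
replace (cos (half_angle k) - Ci * sin (half_angle k))%C with (eit (- half_angle k)).
- rewrite <- eit_plus. f_equal. unfold half_angle. field.
- unfold eit. rewrite cos_neg, sin_neg. unfold Ci, Cminus, Cplus, Copp, Cmult, RtoC; cbn [fst snd]. f_equal; ring.
Qed.

Lemma arc_end_eit (k : nat) : arc_end (arc_dir k) (arc_sin k) (arc_cos k) = eit (th (S k)).
Proof.
unfold arc_end, arc_dir, arc_sin, arc_cos.
replace (cos (half_angle k) + Ci * sin (half_angle k))%C with (eit (half_angle k)).
- rewrite <- eit_plus. f_equal. unfold half_angle. field.
- unfold eit, Ci, Cplus, Cmult, RtoC; cbn [fst snd]. f_equal; ring.
Qed.

Lemma sector_polar (k : nat) (z : C) (t : R) : (k < N)%nat -> z = (Cmod z * eit t)%C ->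
  arc_sin k * (arc_cos k + arc_sin k * Im (chart (arc_dir k) (arc_sin k) (arc_cos k) z)) -
    arc_cos k * (arc_sin k * Re (chart (arc_dir k) (arc_sin k) (arc_cos k) z)) = Cmod z * sin (t - th k) /\
  arc_sin k * (arc_cos k + arc_sin k * Im (chart (arc_dir k) (arc_sin k) (arc_cos k) z)) +
    arc_cos k * (arc_sin k * Re (chart (arc_dir k) (arc_sin k) (arc_cos k) z)) = Cmod z * sin (th (S k) - t).
Proof.
intros Hk Hz.
destruct (chart_rotated (arc_dir k) (arc_sin k) (arc_cos k) (arc_dir_unit k) (arc_sin_pos k Hk) z) as [A B].
rewrite A, B.
set (psi := t - (th k + th (S k)) / 2).
assert (E : (z * Cconj (arc_dir k))%C = (Cmod z * eit psi)%C).
{ rewrite Hz at 1. unfold arc_dir. rewrite eit_conj, <- Cmult_assoc, <- eit_plus. do 2 f_equal. }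
rewrite E. unfold eit, Re, Im, Cmult, RtoC; cbn [fst snd].
replace (t - th k) with (half_angle k + psi) by (unfold psi, half_angle; field).
replace (th (S k) - t) with (half_angle k - psi) by (unfold psi, half_angle; field).
rewrite sin_plus, sin_minus. unfold arc_sin, arc_cos. split; ring.
Qed.

Definition in_arc (k : nat) : C -> Prop := arc_inside (arc_dir k) (arc_sin k) (arc_cos k).
Definition off_arc (k : nat) : C -> Prop := arc_outside (arc_dir k) (arc_sin k) (arc_cos k).
Definition in_strict_sector (k : nat) : C -> Prop := strict_sector (arc_dir k) (arc_sin k) (arc_cos k).
Definition in_sector (k : nat) : C -> Prop := arc_sector (arc_dir k) (arc_sin k) (arc_cos k).

Lemma strict_sector_sin (k : nat) (z : C) (t : R) : (k < N)%nat -> z = (Cmod z * eit t)%C -> in_strict_sector k z ->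
  0 < sin (t - th k) /\ 0 < sin (th (S k) - t).
Proof.
intros Hk Hz HS. destruct (sector_polar k z t Hk Hz) as [A B].
unfold in_strict_sector, strict_sector in HS.
pose proof (arc_sin_pos k Hk) as Hs. set (x := Re (chart _ _ _ z)) in *. set (y := Im (chart _ _ _ z)) in *.
pose proof (Rle_abs x). pose proof (Rabs_maj2 x). pose proof (Cmod_ge_0 z).
assert (Hc : 0 < arc_cos k) by (pose proof (arc_sin_le_cos k Hk); lra).
assert (M1 : arc_cos k * x <= arc_cos k * Rabs x) by (apply Rmult_le_compat_l; lra).
assert (M2 : arc_cos k * - x <= arc_cos k * Rabs x) by (apply Rmult_le_compat_l; lra).
assert (Q1 : 0 < arc_sin k * (arc_cos k + arc_sin k * y - arc_cos k * x)) by (apply Rmult_lt_0_compat; lra).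
assert (Q2 : 0 < arc_sin k * (arc_cos k + arc_sin k * y + arc_cos k * x)) by (apply Rmult_lt_0_compat; lra).
assert (P1 : 0 < Cmod z * sin (t - th k)) by lra.
assert (P2 : 0 < Cmod z * sin (th (S k) - t)) by lra.
split; apply Rnot_le_lt; intros Hn; nra.
Qed.

Lemma sector_of_angle (k : nat) (z : C) (t : R) : (k < N)%nat -> z = (Cmod z * eit t)%C -> th k <= t <= th (S k) -> in_sector k z.
Proof.
intros Hk Hz Ht. destruct (sector_polar k z t Hk Hz) as [A B].
unfold in_sector, arc_sector.
pose proof (arc_sin_pos k Hk) as Hs. set (x := Re (chart _ _ _ z)) in *. set (y := Im (chart _ _ _ z)) in *.
pose proof (Hth k Hk). pose proof PI_RGT_0. pose proof (Cmod_ge_0 z).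
assert (S1 : 0 <= sin (t - th k)) by (apply sin_ge_0; lra).
assert (S2 : 0 <= sin (th (S k) - t)) by (apply sin_ge_0; lra).
assert (P1 : 0 <= Cmod z * sin (t - th k)) by (apply Rmult_le_pos; trivial).
assert (P2 : 0 <= Cmod z * sin (th (S k) - t)) by (apply Rmult_le_pos; trivial).
rewrite <- A in P1. rewrite <- B in P2.
apply Rle_ge, Rmult_le_reg_l with (arc_sin k); trivial.
unfold Rabs; destruct (Rcase_abs x); lra.
Qed.

Lemma th_mono (j k : nat) : (j <= k)%nat -> (k <= N)%nat -> th j <= th k.
Proof.
intros Hjk HkN. induction Hjk as [|k Hjk IH]; [lra|]. specialize (IH ltac:(lia)). pose proof (Hth k ltac:(lia)). lra.
Qed.

Lemma angle_in_some_arc (t : R) : th O <= t <= th O + 2 * PI -> exists k, (k < N)%nat /\ th k <= t <= th (S k).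
Proof.
intros Ht. rewrite <- HthN in Ht.
assert (Gen : forall n, (n <= N)%nat -> t <= th n -> (0 < n)%nat -> exists k, (k < N)%nat /\ th k <= t <= th (S k)).
{ induction n as [|n IH]; [lia|]. intros Hn Htn _. destruct (Rle_dec (th n) t) as [H|H]; [exists n; split; [lia|lra]|].
  destruct n as [|n]; [lra|]. apply IH; [lia|lra|lia]. }
apply (Gen N); [lia|lra|]. destruct N; [pose proof PI_RGT_0; lra|lia].
Qed.

(** All angles lie within one turn. If [j] and [k] differ, a positive first sine forces an angle
    difference beyond [PI]; the other difference then lies in [[PI, 2 PI]], where the sine is
    nonpositive. *)
Lemma strict_sector_angle (j k : nat) (z : C) (t : R) : (j < N)%nat -> (k < N)%nat -> z = (Cmod z * eit t)%C ->
  th j <= t <= th (S j) -> in_strict_sector k z -> j = k.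
Proof.
intros Hj Hk Hz Ht HS. destruct (strict_sector_sin k z t Hk Hz HS) as [S1 S2].
pose proof PI_RGT_0.
assert (Neg : forall x, PI <= x <= 2 * PI -> sin x <= 0) by (intros x Hx; apply sin_le_0; lra).
pose proof (Hth k Hk).
destruct (Nat.lt_trichotomy j k) as [Hlt|[->|Hgt]]; trivial; exfalso.
- assert (th (S j) <= th k) by (apply th_mono; lia).
  assert (th O <= th j) by (apply th_mono; lia).
  assert (th (S k) <= th N) by (apply th_mono; lia).
  assert (A : sin (th k - t) < 0) by (replace (th k - t) with (- (t - th k)) by ring; rewrite sin_neg; lra).
  assert (B : ~ (0 <= th k - t <= PI)) by (intros B; pose proof (sin_ge_0 (th k - t) ltac:(lra) ltac:(lra)); lra).
  specialize (Neg (th (S k) - t)). lra.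
- assert (th (S k) <= th j) by (apply th_mono; lia).
  assert (th O <= th k) by (apply th_mono; lia).
  assert (th (S j) <= th N) by (apply th_mono; lia).
  assert (A : sin (t - th (S k)) < 0) by (replace (t - th (S k)) with (- (th (S k) - t)) by ring; rewrite sin_neg; lra).
  assert (B : ~ (0 <= t - th (S k) <= PI)) by (intros B; pose proof (sin_ge_0 (t - th (S k)) ltac:(lra) ltac:(lra)); lra).
  specialize (Neg (t - th k)). lra.
Qed.

Lemma strict_sectors_disjoint (j k : nat) (z : C) : (j < N)%nat -> (k < N)%nat ->
  in_strict_sector j z -> in_strict_sector k z -> j = k.
Proof.
intros Hj Hk Sj Sk. destruct (polar (th O) z) as [t [Ht Hz]].
destruct (angle_in_some_arc t Ht) as [i [Hi Hti]].
rewrite <- (strict_sector_angle i j z t), <- (strict_sector_angle i k z t); trivial.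
Qed.

(** Each arc region lies in the open sector of its own arc. Hence at a point of one region every
    other factor is under control, and only one factor needs the help of its [Cexp L]. *)
Lemma strict_sector_off (j k : nat) (z : C) : (j < N)%nat -> (k < N)%nat -> Cmod z < 1 ->
  in_strict_sector j z -> j <> k -> off_arc k z.
Proof.
intros Hj Hk Hz Sj Hjk. apply NNPP; intros Ho. apply Hjk.
apply (strict_sectors_disjoint j k z); trivial.
apply (inside_strict _ _ _ (arc_dir_unit k) (arc_sin_pos k Hk) (arc_sin_le_cos k Hk) (arc_pyth k)); trivial.
unfold off_arc, arc_outside, arc_inside in *. lra.
Qed.

Lemma in_arc_strict (k : nat) (z : C) : (k < N)%nat -> Cmod z < 1 -> in_arc k z -> in_strict_sector k z.
Proof.
intros Hk. apply (inside_strict _ _ _ (arc_dir_unit k) (arc_sin_pos k Hk) (arc_sin_le_cos k Hk) (arc_pyth k)).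
Qed.

Lemma off_arc_or_in_arc (k : nat) (z : C) : off_arc k z \/ in_arc k z.
Proof. unfold off_arc, in_arc, arc_outside, arc_inside. lra. Qed.

(* From a point of an arc region one goes straight down, in the chart, to its lower boundary. *)
Lemma in_arc_descent (k : nat) (z : C) : (k < N)%nat -> Cmod z < 1 -> in_arc k z ->
  exists z0, Cmod z0 < 1 /\ (forall j, (j < N)%nat -> off_arc j z0) /\
    forall t : R, 0 <= t <= 1 -> Cmod (z0 + t * (z - z0)) < 1 /\ in_arc k (z0 + t * (z - z0))%C.
Proof.
intros Hk Hz HI.
pose proof (arc_dir_unit k) as Hu. pose proof (arc_sin_pos k Hk) as Hs. pose proof (arc_sin_le_cos k Hk) as Hsc. pose proof (arc_pyth k) as Hpy.
destruct (inside_bounds _ _ _ Hu Hs Hsc Hpy z Hz HI) as [Hx [Hy _]].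
set (u := arc_dir k) in *. set (s := arc_sin k) in *. set (c := arc_cos k) in *.
set (x := Re (chart u s c z)) in *. set (y := Im (chart u s c z)) in *.
(* This height is on the dividing line, so [z0] is both inside and outside the arc region [k]. *)
set (y0 := - (1 - Rabs x) / 2).
set (z0 := unchart u s c (x, y0)).
assert (Hch0 : chart u s c z0 = (x, y0)) by apply (chart_unchart u s c Hu Hs).
assert (Hz0 : Cmod z0 < 1).
{ apply (Tri_height u s c Hu Hs Hsc Hpy x y0). unfold Tri, Re, Im, y0; cbn [fst snd]. repeat split; lra. }
assert (Hpath : forall t : R, chart u s c (z0 + t * (z - z0)) = (x, y0 + t * (y - y0))).
{ intros t.
  rewrite chart_affine.
  rewrite Hch0, (surjective_pairing (chart u s c z)). fold x y.
  change (fst (chart u s c z)) with x. change (snd (chart u s c z)) with y.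
  unfold Cminus, Cplus, Copp, Cmult, RtoC; cbn [fst snd]. f_equal; ring. }
assert (Hin : forall t : R, 0 <= t <= 1 -> Cmod (z0 + t * (z - z0)) < 1 /\ in_arc k (z0 + t * (z - z0))%C).
{ intros t Ht. split.
  - eapply Rle_lt_trans; [now apply seg_Cmod|]. destruct (Req_dec t 0) as [->|]; [lra|]. nra.
  - unfold in_arc, arc_inside. fold u s c. rewrite Hpath. unfold Re, Im; cbn [fst snd]. fold y0.
    unfold in_arc, arc_inside in HI. fold u s c in HI. fold x y y0 in HI. nra. }
exists z0. split; [trivial|split; [|trivial]].
intros j Hj. destruct (Nat.eq_dec k j) as [->|Hkj].
- unfold off_arc, arc_outside. fold u s c. rewrite Hch0. unfold Re, Im; cbn [fst snd]. fold y0. lra.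
- apply (strict_sector_off k j); trivial. apply in_arc_strict; trivial.
  unfold in_arc, arc_inside. fold u s c. rewrite Hch0. unfold Re, Im; cbn [fst snd]. fold y0. lra.
Qed.
End Sectors.

(** * Finite products and their Leibniz derivatives *)

Fixpoint prodC (G : nat -> C) (n : nat) : C :=
  match n with O => 1%C | S m => (prodC G m * G m)%C end.

Fixpoint dprodC (G G' : nat -> C) (n : nat) : C :=
  match n with O => 0%C | S m => (dprodC G G' m * G m + prodC G m * G' m)%C end.

Lemma holo_prodC (U : C -> Prop) (E E' : nat -> C -> C) (n : nat) :
  (forall k, (k < n)%nat -> holo U (E k) (E' k)) ->
  holo U (fun z => prodC (fun k => E k z) n) (fun z => dprodC (fun k => E k z) (fun k => E' k z) n).
Proof.
induction n as [|n IH]; intros H; simpl; [apply holo_const|].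
apply holo_mult; [apply IH; intros; apply H; lia|apply H; lia].
Qed.

Lemma prodC_ne0 (G : nat -> C) (n : nat) : (forall k, (k < n)%nat -> G k <> 0%C) -> prodC G n <> 0%C.
Proof.
induction n as [|n IH]; intros H; simpl.
- intros E; apply RtoC_inj in E; lra.
- apply Cmult_neq_0; [apply IH; intros; apply H; lia|apply H; lia].
Qed.

Lemma prodC_bound (G G' : nat -> C) (K : R) (n : nat) : 1 <= K ->
  (forall k, (k < n)%nat -> Cmod (G k) <= K /\ Cmod (G' k) <= K) ->
  Cmod (prodC G n) <= K ^ n /\ Cmod (dprodC G G' n) <= INR n * K ^ n.
Proof.
intros HK; induction n as [|n IH]; intros H.
- simpl. rewrite Cmod_1, Cmod_0. lra.
- destruct IH as [A B]; [intros; apply H; lia|]. destruct (H n ltac:(lia)) as [C1 C2].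
  assert (0 < K ^ n) by (apply pow_lt; lra). pose proof (pos_INR n).
  pose proof (Cmod_ge_0 (prodC G n)). pose proof (Cmod_ge_0 (dprodC G G' n)). pose proof (Cmod_ge_0 (G n)). pose proof (Cmod_ge_0 (G' n)).
  rewrite S_INR. cbn [prodC dprodC pow]. split.
  + rewrite Cmod_mult, Rmult_comm. apply Rmult_le_compat; trivial.
  + eapply Rle_trans; [apply Cmod_triangle|]. rewrite !Cmod_mult.
    assert (Cmod (dprodC G G' n) * Cmod (G n) <= INR n * K ^ n * K) by (apply Rmult_le_compat; trivial).
    assert (Cmod (prodC G n) * Cmod (G' n) <= K ^ n * K) by (apply Rmult_le_compat; trivial). lra.
Qed.

(** Replaces the factor of index [k], the one to which [Cexp L] is attached. The product formulas
    then bound the whole product factor by factor. *)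
Definition absorb (G : nat -> C) (k : nat) (a : C) (l : nat) : C := if Nat.eq_dec l k then a else G l.

Lemma prodC_absorb (G G' : nat -> C) (k : nat) (a a' : C) (n : nat) : (k < n)%nat ->
  prodC (absorb G k (a * G k)%C) n = (a * prodC G n)%C /\
  dprodC (absorb G k (a * G k)%C) (absorb G' k (a' * G k + a * G' k)%C) n = (a' * prodC G n + a * dprodC G G' n)%C.
Proof.
assert (Low : forall b b' m, (m <= k)%nat -> prodC (absorb G k b) m = prodC G m /\ dprodC (absorb G k b) (absorb G' k b') m = dprodC G G' m).
{ intros b b'; induction m as [|m IH]; intros Hm; [simpl; auto|]. destruct IH as [A B]; [lia|].
  simpl. rewrite A, B. unfold absorb. destruct (Nat.eq_dec m k); [lia|auto]. }
induction n as [|n IH]; intros Hk; [lia|].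
destruct (Nat.eq_dec n k) as [->|Hne].
- destruct (Low (a * G k)%C (a' * G k + a * G' k)%C k (Nat.le_refl k)) as [A B]. simpl. rewrite A, B.
  unfold absorb. destruct (Nat.eq_dec k k); [|lia]. split; ring.
- destruct IH as [A B]; [lia|]. simpl. rewrite A, B. unfold absorb. destruct (Nat.eq_dec n k); [lia|]. split; ring.
Qed.

Lemma prodC_bound_one (G : nat -> C) (K x : R) (k n : nat) : 1 <= K -> 0 <= x -> (k < n)%nat ->
  (forall l, (l < n)%nat -> Cmod (G l) <= K) -> Cmod (G k) <= K * x -> Cmod (prodC G n) <= K ^ n * x.
Proof.
intros HK Hx. induction n as [|n IH]; intros Hk HG HGk; [lia|]. cbn [prodC pow]. rewrite Cmod_mult.
pose proof (Cmod_ge_0 (prodC G n)). pose proof (Cmod_ge_0 (G n)).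
destruct (Nat.eq_dec n k) as [->|Hne].
- destruct (prodC_bound G G K k HK) as [A _]; [intros l Hl; split; apply HG; lia|].
  replace (K * K ^ k * x) with (K ^ k * (K * x)) by ring. apply Rmult_le_compat; trivial.
- replace (K * K ^ n * x) with (K ^ n * x * K) by ring. apply Rmult_le_compat; trivial.
  + apply IH; [lia| |trivial]. intros l Hl; apply HG; lia.
  + apply HG; lia.
Qed.

Lemma uniform_bound (P : nat -> R -> Prop) (N : nat) : (forall k a b, a <= b -> P k a -> P k b) ->
  (forall k, (k < N)%nat -> exists K, P k K) -> exists K, 1 <= K /\ forall k, (k < N)%nat -> P k K.
Proof.
intros Hm; induction N as [|N IH]; intros H.
- exists 1; split; [lra|]. intros k Hk; lia.
- destruct IH as [K [HK1 HK]]; [intros; apply H; lia|]. destruct (H N ltac:(lia)) as [K2 HK2].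
  exists (Rmax K K2). split; [eapply Rle_trans; [exact HK1|apply Rmax_l]|].
  intros k Hk. destruct (Nat.eq_dec k N) as [->|Hne]; [apply (Hm _ K2); trivial; apply Rmax_r|].
  apply (Hm _ K); [apply Rmax_l|apply HK; lia].
Qed.

(** * Growth of derivatives, separation of closures and orders of zeros *)

Lemma eit_lip (a b : R) : Cmod (eit a - eit b) <= 2 * Rabs (a - b).
Proof.
assert (Gen : forall a b, a <= b -> Cmod (eit b - eit a) <= 2 * (b - a)).
{ intros x y Hxy. replace (2 * (y - x)) with (2 * 1 * (y - x)) by ring.
  apply (path_derive_mvt eit (fun t => Ci * eit t)%C x y 1 Hxy). intros t _; split; [apply path_derive_eit|].
  rewrite Cmod_mult, Cmod_Ci, Cmod_eit; lra. }
destruct (Rle_dec a b).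
- rewrite Cmod_sub_sym, Rabs_left1 by lra. specialize (Gen a b). lra.
- rewrite Rabs_pos_eq by lra. apply Gen; lra.
Qed.

Lemma eit_period (t : R) : eit (t - 2 * PI) = eit t.
Proof.
replace (t - 2 * PI) with (t + - (2 * PI)) by ring. rewrite eit_plus, <- eit_conj, eit_2PI.
unfold eit at 2. rewrite cos_0, sin_0. unfold Cconj, Cmult; cbn [fst snd]. destruct (eit t); cbn [fst snd]. f_equal; ring.
Qed.

(** The chord between angles [t] and [t0] has length [sqrt (2 - 2 cos (t - t0))], which increases
    with the difference on [[0, PI]]. *)
Lemma near_angle (t0 h : R) : 0 < h <= PI -> exists eps, 0 < eps /\ forall p, Cmod p = 1 -> Cmod (p - eit t0) < eps ->
  exists t, Rabs (t - t0) <= h /\ p = eit t.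
Proof.
intros Hh. pose proof PI_RGT_0.
assert (Hc : cos h < 1) by (rewrite <- cos_0; apply cos_decreasing_1; lra).
exists (sqrt (2 - 2 * cos h)). split; [apply sqrt_lt_R0; lra|].
intros p Hp Hd.
destruct (polar (t0 - PI) p) as [t [Ht E]]. rewrite Hp, Cmult_1_l in E.
exists t. split; [|trivial]. apply Rnot_lt_le; intros Hn.
apply (Rlt_not_le _ _ Hd). rewrite E.
assert (E1 : Cmod (eit t - eit t0) = sqrt (2 - 2 * cos (t - t0))).
{ replace (eit t - eit t0)%C with (eit t0 * (eit (t - t0) - 1))%C.
  - rewrite Cmod_mult, Cmod_eit, Rmult_1_l. unfold Cmod. f_equal. unfold eit, Cminus, Cplus, Copp, RtoC; cbn [fst snd].
    pose proof (sin2_cos2 (t - t0)) as Q. unfold Rsqr in Q. simpl. lra.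
  - replace (eit t0 * (eit (t - t0) - 1))%C with (eit t0 * eit (t - t0) - eit t0)%C by ring.
    rewrite <- eit_plus. do 2 f_equal. ring. }
rewrite E1. apply sqrt_le_1_alt.
assert (Hcos : cos (t - t0) <= cos h).
{ unfold Rabs in Hn. destruct (Rcase_abs (t - t0)).
  - rewrite <- (cos_neg (t - t0)). apply cos_decr_1; lra.
  - apply cos_decr_1; lra. }
lra.
Qed.

Lemma bounded_derive_growth (f f' : C -> C) (M : R) (z : C) : holo (fun z => Cmod z < 1) f f' ->
  (forall z, Cmod z < 1 -> Cmod (f z) <= M) -> Cmod z < 1 -> Cmod (f' z) * (1 - Cmod z) <= 16 * M.
Proof.
intros Hf HM Hz. set (r := (1 - Cmod z) / 2).
assert (In : forall v, Cmod (v - z) < 2 * r -> Cmod v < 1) by (intros v Hv; pose proof (Cmod_triangle_rev v z); unfold r in *; lra).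
assert (B := derive_bound_Re z r (2 * r) M f f' ltac:(unfold r; lra) ltac:(unfold r; lra)).
assert (D : Cmod (f' z) <= 4 / r * (M - Re (f z))).
{ apply B.
  - apply (holo_sub (fun z => Cmod z < 1)); trivial.
  - intros v Hv. pose proof (HM v (In v Hv)). pose proof (re_le_Cmod (f v)). pose proof (Rle_abs (Re (f v))). lra. }
assert (Q : M - Re (f z) <= 2 * M).
{ pose proof (HM z Hz). pose proof (re_le_Cmod (f z)). pose proof (Rabs_maj2 (Re (f z))). lra. }
assert (Hr : 0 < r) by (unfold r; lra).
replace (1 - Cmod z) with (2 * r) by (unfold r; field).
apply Rle_trans with (4 / r * (M - Re (f z)) * (2 * r)); [apply Rmult_le_compat_r; lra|].
replace (4 / r * (M - Re (f z)) * (2 * r)) with (8 * (M - Re (f z))) by (field; lra). lra.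
Qed.

(** With [q^8 <= 1 - |z|], the real part of the logarithm is at most [ln A - 8 ln q], and
    [- ln q <= 1 / q]; the factor [q^6 <= 1] leaves at most [ln A + 8]. *)
Lemma log_growth (L g : C -> C) (A : R) (U : C -> Prop) : 1 <= A -> (forall z, U z -> Cmod z < 1) ->
  (forall z, U z -> Cexp (L z) = g z) -> (forall z, U z -> Cmod (g z) * (1 - Cmod z) <= A) ->
  upper_growth U L (ln A + 8).
Proof.
intros HA HU HL Hg z q Hz Hq Hq8.
assert (Hq1 : q <= 1) by (apply (pow_le_inv 7); try lra; pose proof (Cmod_ge_0 z); lra).
assert (Q8 : 0 < q ^ 8) by now apply pow_lt. assert (Q6 : 0 < q ^ 6) by now apply pow_lt.
assert (E : exp (Re (L z)) * q ^ 8 <= A).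
{ rewrite <- Cmod_Cexp, (HL z Hz). eapply Rle_trans; [|apply (Hg z Hz)]. apply Rmult_le_compat_l; [apply Cmod_ge_0|trivial]. }
assert (Hln : Re (L z) + 8 * ln q <= ln A).
{ assert (exp (Re (L z) + 8 * ln q) <= A).
  { rewrite exp_plus. replace (exp (8 * ln q)) with (q ^ 8); trivial.
    rewrite <- Rpower_pow by trivial. unfold Rpower. f_equal. simpl INR. ring. }
  rewrite <- (ln_exp (Re (L z) + 8 * ln q)). apply ln_le; [apply exp_pos|trivial]. }
assert (Hq2 : - ln q <= / q).
{ pose proof (exp_ineq1_le (- ln q)) as I. rewrite exp_Ropp, exp_ln in I by trivial. lra. }
assert (HlnA : 0 <= ln A) by (rewrite <- ln_1; apply ln_le; lra).
assert (B : Re (L z) <= ln A + 8 * / q) by lra.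
apply Rle_trans with ((ln A + 8 * / q) * q ^ 6); [apply Rmult_le_compat_r; lra|].
replace ((ln A + 8 * / q) * q ^ 6) with (ln A * q ^ 6 + 8 * q ^ 5) by (field; lra).
assert (q ^ 6 <= 1) by (rewrite <- (pow1 6); apply pow_incr; lra).
assert (q ^ 5 <= 1) by (rewrite <- (pow1 5); apply pow_incr; lra). nra.
Qed.

(** Every point of the circle has a neighbourhood free of one of the two sets; compactness of the
    interval of angles makes its size uniform. *)
Lemma separation (A B : C -> Prop) :
  (~ exists z, Cclosure A z /\ Cclosure B z /\ unit_circle z) ->
  exists del, 0 < del /\ forall xi, Cmod xi = 1 ->
    (forall z, Cmod (z - xi) < del -> ~ A z) \/ (forall z, Cmod (z - xi) < del -> ~ B z).
Proof.
intros Hsep.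
assert (Loc : forall t : R, exists d, 0 < d /\
   ((forall z, Cmod (z - eit t) < d -> ~ A z) \/ (forall z, Cmod (z - eit t) < d -> ~ B z))).
{ intros t. apply NNPP; intros Hn. apply Hsep. exists (eit t). split; [|split; [|exact (Cmod_eit t)]].
  - intros eps He. apply NNPP; intros Hw. apply Hn. exists eps; split; trivial. left. intros z Hz HA. apply Hw. exists z; auto.
  - intros eps He. apply NNPP; intros Hw. apply Hn. exists eps; split; trivial. right. intros z Hz HA. apply Hw. exists z; auto. }
set (dl := fun t => proj1_sig (constructive_indefinite_description _ (Loc t))).
assert (Hdl : forall t, 0 < dl t /\ ((forall z, Cmod (z - eit t) < dl t -> ~ A z) \/ (forall z, Cmod (z - eit t) < dl t -> ~ B z))).
{ intros t; exact (proj2_sig (constructive_indefinite_description _ (Loc t))). }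
(* [eit] has Lipschitz constant at most 2, so a quarter of [dl t] in the angle is at most half of it
   in the plane. *)
assert (Hpos : forall t, 0 < dl t / 4) by (intros t; destruct (Hdl t); lra).
destruct (compactness_value_1d 0 (2 * PI) (fun t => mkposreal _ (Hpos t))) as [d Hd].
exists d; split; [apply cond_pos|]. intros xi Hxi.
destruct (polar 0 xi) as [x [Hx Ex]]. rewrite Hxi, Cmult_1_l in Ex. subst xi.
rewrite Rplus_0_l in Hx.
specialize (Hd x Hx). apply NNPP in Hd. destruct Hd as [t [Ht [H1 H2]]]. simpl in H1, H2.
assert (Sub : forall z, Cmod (z - eit x) < d -> Cmod (z - eit t) < dl t).
{ intros z Hz. pose proof (Cmod_dist_triangle z (eit x) (eit t)). pose proof (eit_lip x t). destruct (Hdl t). lra. }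
destruct (Hdl t) as [_ [HA|HB]]; [left|right]; auto.
Qed.

Lemma Cpow_add (z : C) (m n : nat) : Cpow z (m + n) = (Cpow z m * Cpow z n)%C.
Proof. induction m as [|m IH]; simpl; [ring|rewrite IH; ring]. Qed.

Lemma zero_of_order_nearby (h : C -> C) (a : C) (m : nat) (r : R) : 0 < r -> zero_of_order h a m ->
  exists z, Cmod (z - a) < r /\ h z <> 0%C.
Proof.
intros Hr [g [Hloc Hg]].
apply locally_C_eps in Hloc. destruct Hloc as [d [Hd Hloc]].
assert (Haa : Cmod (a - a) < d) by (now rewrite Cmod_diag).
destruct (Hloc a Haa) as [[l Dg] _]. apply is_Cderive_iff in Dg.
assert (Hm := proj1 (Cmod_gt_0 (g a)) Hg).
destruct (proj1 (ccont_eps g a) (is_Cderive_cont g a l Dg) (Cmod (g a)) Hm) as [e [He Hc]].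
set (x := Rmin r (Rmin d e) / 2).
assert (Hx : 0 < x) by (unfold x; assert (0 < Rmin r (Rmin d e)) by (repeat apply Rmin_pos; trivial); lra).
assert (X1 : x < r) by (unfold x; pose proof (Rmin_l r (Rmin d e)); lra).
assert (X2 : x < Rmin d e) by (unfold x in *; pose proof (Rmin_r r (Rmin d e)); lra).
assert (X3 : x < d) by (eapply Rlt_le_trans; [exact X2|apply Rmin_l]).
assert (X4 : x < e) by (eapply Rlt_le_trans; [exact X2|apply Rmin_r]).
assert (E : Cmod (a + x - a) = x).
{ replace (a + x - a)%C with (RtoC x) by ring. rewrite Cmod_R, Rabs_pos_eq; lra. }
exists (a + x)%C. rewrite E. split; [trivial|].
destruct (Hloc (a + x)%C ltac:(rewrite E; trivial)) as [_ ->].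
replace (a + x - a)%C with (RtoC x) by ring.
apply Cmult_neq_0.
- clear -Hx. induction m as [|m IH]; simpl; [intros E; apply RtoC_inj in E; lra|].
  apply Cmult_neq_0; trivial. intros E; apply RtoC_inj in E; lra.
- intros Z. specialize (Hc (a + x)%C ltac:(rewrite E; trivial)). rewrite Z in Hc.
  replace (0 - g a)%C with (- g a)%C in Hc by ring. rewrite Cmod_opp in Hc. lra.
Qed.

(** * Gluing *)

Lemma cap_shift (xi xi' : C) (d d' : R) (z : C) : Cmod (xi - xi') + d <= d' -> cap xi d z -> cap xi' d' z.
Proof. intros H [H1 H2]; split; trivial. pose proof (Cmod_dist_triangle z xi xi'). lra. Qed.

Lemma stolz_growth_shift (xi xi' p : C) (d d' : R) (L : C -> C) : Cmod (xi - xi') + d <= d' ->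
  stolz_growth xi' d' p L -> stolz_growth xi d p L.
Proof.
intros H G c Hc. destruct (G c Hc) as [K HK]. exists K. intros z q Hz. apply HK. now apply (cap_shift xi xi' d d').
Qed.

(** Starting from equally spaced base points, each division point is shifted slightly to an angle
    that is good for the logarithms of both adjacent arcs. *)
Lemma arc_system (Lf Lf' : C -> C -> C) (del B : R) : 0 < del -> 0 <= B ->
  (forall xi, Cmod xi = 1 -> holo (cap xi del) (Lf xi) (Lf' xi) /\ upper_growth (cap xi del) (Lf xi) B) ->
  exists (N : nat) (th : nat -> R) (xs : nat -> C),
    (forall k, (k < N)%nat -> 0 < th (S k) - th k <= PI / 2) /\ th N = th O + 2 * PI /\
    forall k, (k < N)%nat -> Cmod (xs k) = 1 /\
      Cmod (eit (th k) - xs k) <= del / 32 /\ Cmod (eit (th (S k)) - xs k) <= del / 32 /\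
      stolz_growth (xs k) (del / 8) (eit (th k)) (Lf (xs k)) /\
      stolz_growth (xs k) (del / 8) (eit (th (S k))) (Lf (xs k)).
Proof.
intros Hdel HB HL. pose proof PI_RGT_0 as HPI. pose proof PI2_3_2 as HPI2.
(* The gaps after shifting are at most [3/2 h <= 3/2 < PI / 2]; neighbouring base points are within
   [2 h <= del / 64], so both logarithms live on a common cap. *)
set (h0 := Rmin 1 (del / 128)). assert (Hh0 : 0 < h0) by (apply Rmin_pos; lra).
destruct (INR_unbounded (2 * PI / h0)) as [N HN].
assert (HN0 : 0 < INR N) by (apply Rlt_trans with (2 * PI / h0); trivial; apply Rdiv_lt_0_compat; lra).
set (h := 2 * PI / INR N).
assert (Hh : 0 < h) by (apply Rdiv_lt_0_compat; lra).
assert (HNh : INR N * h = 2 * PI) by (unfold h; field; lra).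
assert (Hhh0 : h <= h0).
{ apply Rmult_le_reg_l with (INR N); trivial. rewrite HNh. apply (Rmult_lt_compat_r h0) in HN; trivial.
  replace (2 * PI / h0 * h0) with (2 * PI) in HN by (field; lra). lra. }
assert (Hh1 : h <= 1) by (eapply Rle_trans; [exact Hhh0|apply Rmin_l]).
assert (Hhd : h <= del / 128) by (eapply Rle_trans; [exact Hhh0|apply Rmin_r]).
set (xs := fun k => eit (INR k * h)).
assert (Hxs : forall k, Cmod (xs k) = 1) by (intros; apply Cmod_eit).
assert (HxsS : forall k, Cmod (xs (S k) - xs k) <= del / 64).
{ intros k. eapply Rle_trans; [apply eit_lip|]. rewrite S_INR. replace ((INR k + 1) * h - INR k * h) with h by ring.
  rewrite Rabs_pos_eq; lra. }
assert (HxN : xs N = xs O).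
{ unfold xs. rewrite HNh. simpl INR. rewrite Rmult_0_l. apply eit_2PI. }
assert (Ex : forall j, exists t, Rabs (t - INR (S j) * h) <= h / 4 /\ Cmod (eit t - xs (S j)) <= del / 64 /\
   stolz_growth (xs (S j)) (del / 4) (eit t) (Lf (xs j)) /\ stolz_growth (xs (S j)) (del / 4) (eit t) (Lf (xs (S j)))).
{ intros j. destruct (near_angle (INR (S j) * h) (h / 4) ltac:(lra)) as [eps [Heps Hang]].
  destruct (HL (xs j) (Hxs j)) as [A1 A2]. destruct (HL (xs (S j)) (Hxs (S j))) as [A3 A4].
  assert (Sub1 : forall z, cap (xs (S j)) (del / 2) z -> cap (xs j) del z).
  { intros z; apply cap_shift. specialize (HxsS j). lra. }
  assert (Sub2 : forall z, cap (xs (S j)) (del / 2) z -> cap (xs (S j)) del z).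
  { intros z [Z1 Z2]; split; trivial; lra. }
  destruct (good_endpoint (xs (S j)) (del / 2) (Hxs (S j)) ltac:(lra) (Lf (xs j)) (Lf' (xs j)) (Lf (xs (S j))) (Lf' (xs (S j))) B (Rmin eps (del / 64)))
    as [p [Hp [Hd [S1 S2]]]]; trivial.
  - apply Rmin_pos; lra.
  - now apply (holo_sub (cap (xs j) del)).
  - now apply (holo_sub (cap (xs (S j)) del)).
  - intros z q Hz; apply A2; auto.
  - intros z q Hz; apply A4; auto.
  - destruct (Hang p Hp) as [t [Ht Et]]; [eapply Rlt_le_trans; [exact Hd|apply Rmin_l]|].
    exists t. rewrite <- Et. replace (del / 4) with (del / 2 / 2) by field. repeat split; trivial.
    left; eapply Rlt_le_trans; [exact Hd|apply Rmin_r]. }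
set (T := fun j => proj1_sig (constructive_indefinite_description _ (Ex j))).
assert (HT : forall j, Rabs (T j - INR (S j) * h) <= h / 4 /\ Cmod (eit (T j) - xs (S j)) <= del / 64 /\
   stolz_growth (xs (S j)) (del / 4) (eit (T j)) (Lf (xs j)) /\ stolz_growth (xs (S j)) (del / 4) (eit (T j)) (Lf (xs (S j)))).
{ intros j. exact (proj2_sig (constructive_indefinite_description _ (Ex j))). }
destruct N as [|N']; [simpl in HN0; lra|].
(* The division point 0 is the last one moved back by a full turn, so that the arcs close up and
   this point too is good for both of its arcs. *)
set (th := fun k => match k with O => T N' - 2 * PI | S j => T j end).
assert (Hth : forall k, Rabs (th k - INR k * h) <= h / 4).
{ intros [|j]; [|apply HT]. unfold th. simpl INR. destruct (HT N') as [A _].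
  replace (T N' - 2 * PI - 0 * h) with (T N' - INR (S N') * h) by (rewrite HNh; ring). exact A. }
exists (S N'), th, xs. split; [|split].
- intros k Hk. pose proof (Hth k) as A. pose proof (Hth (S k)) as A'. rewrite S_INR in A'.
  apply Rabs_le_between in A. apply Rabs_le_between in A'. lra.
- unfold th. ring.
- intros k Hk. destruct (HT k) as [_ [B1 [B2 B3]]].
  assert (Cp := HxsS k).
  assert (HS : Cmod (eit (th k) - xs k) <= del / 64 /\ stolz_growth (xs k) (del / 4) (eit (th k)) (Lf (xs k))).
  { destruct k as [|j]; [|destruct (HT j) as [_ [D1 [D2 D3]]]; auto].
    unfold th. rewrite eit_period, <- HxN. destruct (HT N') as [_ [D1 [D2 D3]]]. auto. }
  destruct HS as [HS1 HS2]. split; [apply Hxs|split; [lra|split]].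
  + unfold th. pose proof (Cmod_dist_triangle (eit (T k)) (xs (S k)) (xs k)). lra.
  + split.
    * apply (stolz_growth_shift (xs k) (xs k) _ _ (del / 4)); trivial.
      rewrite Cmod_diag. lra.
    * apply (stolz_growth_shift (xs k) (xs (S k)) _ _ (del / 4)); trivial. rewrite Cmod_sub_sym. lra.
Qed.

(** Continuity of the derivative, which [holo] demands, is read off from the local factorisation in
    [zero_of_order]. *)
Lemma critical_data (A : disc_sequence) : Hinfty_critical_set A -> exists f f' M, 1 <= M /\
  holo (fun z => Cmod z < 1) f f' /\ (forall z, Cmod z < 1 -> Cmod (f z) <= M) /\
  (forall z, Cmod z < 1 -> zero_of_order f' z (A z)).
Proof.
intros [f [[Hd [M HM]] [_ Hc]]].
exists f, (C_derive f), (Rmax 1 M). split; [apply Rmax_l|split; [|split]].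
- intros z Hz. split.
  + apply is_Cderive_iff, C_derive_correct; [exact z|]. now apply Hd.
  + destruct (Hc z Hz) as [g [Hl Hg]]. apply locally_C_eps in Hl. destruct Hl as [d [Hd0 Hl]].
    assert (Hzz : Cmod (z - z) < d) by (now rewrite Cmod_diag).
    destruct (Hl z Hzz) as [[l Dg] _]. apply is_Cderive_iff in Dg.
    apply (ccont_ext_loc (fun v => Cpow (v - z) (A z) * g v)%C _ z d); trivial.
    * intros v Hv. symmetry. now apply Hl.
    * apply ccont_mult; [|exact (is_Cderive_cont _ _ _ Dg)].
      apply ccont_pow, ccont_minus; [apply ccont_id|apply ccont_const].
- intros z Hz. eapply Rle_trans; [now apply HM|apply Rmax_r].
- exact Hc.
Qed.

Lemma zero_of_order_0 (h : C -> C) (a : C) : zero_of_order h a 0 -> h a <> 0%C.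
Proof.
intros [g [Hl Hg]]. apply locally_C_eps in Hl. destruct Hl as [d [Hd0 Hl]].
destruct (Hl a) as [_ ->]; [now rewrite Cmod_diag|].
simpl. rewrite Cmult_1_l. trivial.
Qed.

Lemma zero_of_order_mult (h1 h2 e e' : C -> C) (a : C) (m n : nat) (r : R) : 0 < r ->
  holo (fun z => Cmod (z - a) < r) e e' -> e a <> 0%C ->
  zero_of_order h1 a m -> zero_of_order h2 a n -> zero_of_order (fun z => h1 z * h2 z * e z)%C a (m + n).
Proof.
intros Hr He Ea [g1 [L1 N1]] [g2 [L2 N2]].
apply locally_C_eps in L1. destruct L1 as [d1 [Hd1 L1]].
apply locally_C_eps in L2. destruct L2 as [d2 [Hd2 L2]].
exists (fun z => g1 z * g2 z * e z)%C. split; [|repeat apply Cmult_neq_0; trivial].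
apply locally_C_eps. exists (Rmin r (Rmin d1 d2)). split; [repeat apply Rmin_pos; trivial|].
intros w Hw.
assert (W0 : Cmod (w - a) < r) by (eapply Rlt_le_trans; [exact Hw|apply Rmin_l]).
assert (W12 : Cmod (w - a) < Rmin d1 d2) by (eapply Rlt_le_trans; [exact Hw|apply Rmin_r]).
destruct (L1 w) as [[l1 D1] E1]; [eapply Rlt_le_trans; [exact W12|apply Rmin_l]|].
destruct (L2 w) as [[l2 D2] E2]; [eapply Rlt_le_trans; [exact W12|apply Rmin_r]|].
split.
- eexists. apply is_Cderive_iff. apply is_Cderive_mult; [apply is_Cderive_mult; apply is_Cderive_iff; eassumption|now apply He].
- rewrite E1, E2, Cpow_add. ring.
Qed.

Definition select (i : bool) (a b : C -> C) : C -> C := if i then a else b.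

Section Main.
Context (f1 f1' f2 f2' : C -> C) (M del : R) (HM1 : 1 <= M) (Hdel : 0 < del).
Let D := fun z : C => Cmod z < 1.
Context (H1 : holo D f1 f1') (H2 : holo D f2 f2').
Context (B1 : forall z, D z -> Cmod (f1 z) <= M) (B2 : forall z, D z -> Cmod (f2 z) <= M).
Context (Hsep : forall xi, Cmod xi = 1 ->
  (forall z, cap xi del z -> f1' z <> 0%C) \/ (forall z, cap xi del z -> f2' z <> 0%C)).

Lemma openC_disc : openC D.
Proof. intros z Hz. exists (1 - Cmod z). unfold D in *. split; [lra|]. intros w Hw. pose proof (Cmod_triangle_rev w z). lra. Qed.

Lemma convexC_disc : convexC D.
Proof.
intros a b t Ha Hb Ht. unfold D in *. eapply Rle_lt_trans; [now apply seg_Cmod|].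
destruct (Req_dec t 0) as [->|]; nra.
Qed.

Lemma select_holo (i : bool) : holo D (select i f1 f2) (select i f1' f2').
Proof. destruct i; trivial. Qed.

Lemma select_bound (i : bool) (z : C) : D z -> Cmod (select i f1 f2 z) <= M.
Proof. destruct i; simpl; auto. Qed.

Lemma local_logs (xi : C) : Cmod xi = 1 -> exists x : bool * (C -> C) * (C -> C),
  holo (cap xi del) (snd (fst x)) (snd x) /\ (forall z, cap xi del z -> Cexp (snd (fst x) z) = select (fst (fst x)) f1' f2' z).
Proof.
intros Hxi.
assert (Hi : exists i, forall z, cap xi del z -> select i f1' f2' z <> 0%C).
{ destruct (Hsep xi Hxi) as [H|H]; [exists true|exists false]; exact H. }
destruct Hi as [i Hi].
(* [(1 - e) xi] merely shows that the cap is nonempty, as the construction of a logarithm needs a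
   base point. *)
set (e := Rmin 1 del / 2). assert (He : 0 < e) by (unfold e; assert (0 < Rmin 1 del) by (apply Rmin_pos; lra); lra).
assert (He1 : e <= 1 / 2) by (unfold e; pose proof (Rmin_l 1 del); lra).
assert (He2 : e < del) by (unfold e; pose proof (Rmin_r 1 del); lra).
assert (Hc : cap xi del ((1 - e)%R * xi)%C).
{ split.
  - rewrite Cmod_mult, Hxi, Cmod_R, Rabs_pos_eq; lra.
  - replace ((1 - e)%R * xi - xi)%C with ((- e)%R * xi)%C by (rewrite RtoC_minus, RtoC_opp; ring).
    rewrite Cmod_mult, Hxi, Cmod_R, Rabs_left; lra. }
destruct (exists_log (cap xi del) (select i f1' f2') (C_derive (select i f1' f2')) _ (openC_cap xi del) (convexC_cap xi del) Hc) as [L [HL HE]].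
- apply (holo_sub D); [intros z [Hz _]; exact Hz|]. apply (holo_derive D (select i f1 f2)); [exact openC_disc|apply select_holo].
- trivial.
- exists (i, L, (fun z => C_derive (select i f1' f2') z * / select i f1' f2' z)%C). simpl. auto.
Qed.

(** [T] is the product of the arc factors. The bound is stated for every primitive, which separates
    it from the existence of one. *)
Lemma glued_derivative : exists T T', holo D T T' /\ (forall z, T z <> 0%C) /\
  forall F, (forall z, D z -> is_Cderive F z (f1' z * f2' z * T z)%C) -> exists K, forall z, D z -> Cmod (F z) <= K.
Proof.
(* Off the circle an arbitrary value makes the choice of logarithms a total function; the same
   device serves in [Fac] for indices beyond [N]. *)
assert (Sel : forall xi : C, exists x : bool * (C -> C) * (C -> C), Cmod xi = 1 ->
  holo (cap xi del) (snd (fst x)) (snd x) /\ (forall z, cap xi del z -> Cexp (snd (fst x) z) = select (fst (fst x)) f1' f2' z)).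
{ intros xi. destruct (Req_dec (Cmod xi) 1) as [H|H].
  - destruct (local_logs xi H) as [x Hx]. exists x; auto.
  - exists (true, f1, f1). intros E; contradiction. }
set (X := fun xi => proj1_sig (constructive_indefinite_description _ (Sel xi))).
assert (HX : forall xi, Cmod xi = 1 -> holo (cap xi del) (snd (fst (X xi))) (snd (X xi)) /\
   (forall z, cap xi del z -> Cexp (snd (fst (X xi)) z) = select (fst (fst (X xi))) f1' f2' z)).
{ intros xi. exact (proj2_sig (constructive_indefinite_description _ (Sel xi))). }
set (Lf := fun xi => snd (fst (X xi))). set (Lf' := fun xi => snd (X xi)).
assert (Hgr : forall i z, D z -> Cmod (select i f1' f2' z) * (1 - Cmod z) <= 16 * M).
{ intros i z Hz. apply (bounded_derive_growth (select i f1 f2)); [apply select_holo|apply select_bound|trivial]. }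
destruct (arc_system Lf Lf' del (ln (16 * M) + 8) Hdel) as [N [th [xs [Hth [HthN Harc]]]]].
{ assert (0 <= ln (16 * M)); [|lra]. rewrite <- ln_1. apply ln_le; lra. }
{ intros xi Hxi. destruct (HX xi Hxi) as [A1 A2]. split; [exact A1|].
  apply (log_growth (Lf xi) (select (fst (fst (X xi))) f1' f2')); [lra|intros z [Hz _]; exact Hz|exact A2|].
  intros z [Hz _]. now apply Hgr. }
set (P := fun k (E E' : C -> C) (K : R) =>
  (forall z, D z -> off_arc th k z -> Cmod (E z) <= K /\ Cmod (E' z) <= K) /\
  (forall z, D z -> off_arc th k z -> in_sector th k z -> Cmod (E z) <= K * (1 - Cmod z) ^ 2) /\
  (forall z, D z -> in_arc th k z -> cap (xs k) (del / 8) z /\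
     Cmod (Cexp (Lf (xs k) z) * E z) <= K /\ Cmod (Cexp (Lf (xs k) z) * (Lf' (xs k) z * E z + E' z)) <= K)).
assert (Fac : forall k, exists E : (C -> C) * (C -> C), (k < N)%nat ->
   holo D (fst E) (snd E) /\ (forall z, fst E z <> 0%C) /\ exists K, P k (fst E) (snd E) K).
{ intros k. destruct (Compare_dec.le_lt_dec N k) as [Hk|Hk]; [exists (f1, f1); lia|].
  destruct (Harc k Hk) as [X1 [X2 [X3 [X4 X5]]]]. destruct (HX (xs k) X1) as [A1 A2].
  rewrite <- (arc_start_eit th k) in X2, X4. rewrite <- (arc_end_eit th k) in X3, X5.
  destruct (arc_factor (arc_dir th k) (arc_sin th k) (arc_cos th k) (arc_dir_unit th k) (arc_sin_pos th N Hth k Hk)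
    (arc_sin_le_cos th N Hth k Hk) (arc_pyth th k) (xs k) (del / 8) (del / 32) X2 X3 ltac:(lra) (Lf (xs k)) (Lf' (xs k)))
    as [E [E' [K [_ [HE [HE0 [Q1 [Q2 Q3]]]]]]]]; trivial.
  - apply (holo_sub (cap (xs k) del)); trivial. intros z [Z1 Z2]; split; trivial; lra.
  - exists (E, E'). intros _. split; [exact HE|split; [exact HE0|]]. exists K. split; [exact Q1|split; [exact Q2|exact Q3]]. }
set (EE := fun k => proj1_sig (constructive_indefinite_description _ (Fac k))).
assert (HEE : forall k, (k < N)%nat -> holo D (fst (EE k)) (snd (EE k)) /\ (forall z, fst (EE k) z <> 0%C) /\ exists K, P k (fst (EE k)) (snd (EE k)) K).
{ intros k. exact (proj2_sig (constructive_indefinite_description _ (Fac k))). }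
destruct (uniform_bound (fun k K => P k (fst (EE k)) (snd (EE k)) K) N) as [K [HK1 HK]].
{ intros k a b Hab [Q1 [Q2 Q3]]. split; [|split].
  - intros z Hz Ho. destruct (Q1 z Hz Ho). split; lra.
  - intros z Hz Ho Hi. pose proof (Q2 z Hz Ho Hi). pose proof (pow2_ge_0 (1 - Cmod z)). nra.
  - intros z Hz Hi. destruct (Q3 z Hz Hi) as [R1 [R2 R3]]. split; [trivial|split; lra]. }
{ intros k Hk. now apply HEE. }
set (G := fun z k => fst (EE k) z). set (G' := fun z k => snd (EE k) z).
set (T := fun z => prodC (G z) N). set (T' := fun z => dprodC (G z) (G' z) N).
assert (HT : holo D T T').
{ apply (holo_prodC D (fun k => fst (EE k)) (fun k => snd (EE k)) N). intros k Hk; now apply HEE. }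
assert (HKN : 0 < K ^ N) by (apply pow_lt; lra).
set (KN := (INR N + 1) * K ^ N).
assert (HKNN : K ^ N <= KN) by (unfold KN; pose proof (pos_INR N); nra).
(* [Cexp L] is absorbed into factor [k]; all other factors are bounded because [z] is off their
   arcs. *)
assert (Damp : forall z k, D z -> (k < N)%nat -> in_arc th k z ->
   Cmod (Cexp (Lf (xs k) z) * T z) <= KN /\ Cmod (Cexp (Lf (xs k) z) * (Lf' (xs k) z * T z + T' z)) <= KN).
{ intros z k Hz Hk Hi. set (a := Cexp (Lf (xs k) z)). set (a' := (a * Lf' (xs k) z)%C).
  destruct (prodC_absorb (G z) (G' z) k a a' N Hk) as [A1 A2].
  destruct (prodC_bound (absorb (G z) k (a * G z k)%C) (absorb (G' z) k (a' * G z k + a * G' z k)%C) K N HK1) as [C1 C2].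
  - intros l Hl. unfold absorb. destruct (Nat.eq_dec l k) as [->|Hlk].
    + destruct (HK k Hk) as [_ [_ Q3]]. destruct (Q3 z Hz Hi) as [_ [R1 R2]]. split; [exact R1|].
      unfold a', a. eapply Rle_trans; [|exact R2]. right. f_equal. unfold G, G'. ring.
    + destruct (HK l Hl) as [Q1 _]. apply Q1; trivial.
      apply (strict_sector_off th N Hth HthN k l); auto. now apply (in_arc_strict th N Hth).
  - rewrite A1 in C1. rewrite A2 in C2. fold (T z) in C1, C2. fold (T' z) in C2. split; [lra|].
    replace (a * (Lf' (xs k) z * T z + T' z))%C with (a' * T z + a * T' z)%C by (unfold a'; ring).
    eapply Rle_trans; [exact C2|]. unfold KN. lra. }
(* Each of [f1'], [f2'] is at most [16 M / (1 - |z|)], and the factor whose sector contains [z]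
   supplies [(1 - |z|)^2]. *)
assert (Outer : forall z, D z -> (forall k, (k < N)%nat -> off_arc th k z) -> Cmod (f1' z * f2' z * T z) <= 256 * M ^ 2 * K ^ N).
{ intros z Hz Ho.
  destruct (polar (th O) z) as [t [Ht Ez]]. destruct (angle_in_some_arc th N Hth HthN t Ht) as [k [Hk Hkt]].
  assert (Hs := sector_of_angle th N Hth k z t Hk Ez Hkt).
  destruct (HK k Hk) as [_ [Q2 _]]. assert (E := Q2 z Hz (Ho k Hk) Hs).
  assert (TT : Cmod (T z) <= K ^ N * (1 - Cmod z) ^ 2).
  { apply (prodC_bound_one (G z) K _ k); trivial; [apply pow2_ge_0|]. intros l Hl. destruct (HK l Hl) as [Q1 _]. apply Q1; auto. }
  assert (g1 := Hgr true z Hz). assert (g2 := Hgr false z Hz). simpl in g1, g2. unfold D in Hz.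
  rewrite !Cmod_mult. pose proof (Cmod_ge_0 (f1' z)). pose proof (Cmod_ge_0 (f2' z)).
  apply Rle_trans with (Cmod (f1' z) * Cmod (f2' z) * (K ^ N * (1 - Cmod z) ^ 2)).
  - apply Rmult_le_compat_l; trivial. now apply Rmult_le_pos.
  - replace (Cmod (f1' z) * Cmod (f2' z) * (K ^ N * (1 - Cmod z) ^ 2)) with
      ((Cmod (f1' z) * (1 - Cmod z)) * (Cmod (f2' z) * (1 - Cmod z)) * K ^ N) by ring.
    replace (256 * M ^ 2 * K ^ N) with ((16 * M) * (16 * M) * K ^ N) by ring.
    apply Rmult_le_compat_r; [lra|]. apply Rmult_le_compat; trivial; apply Rmult_le_pos; lra. }
exists T, T'. split; [trivial|split].
{ intros z. apply prodC_ne0. intros k Hk. now apply HEE. }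
intros F HF.
set (C0 := 256 * M ^ 2 * K ^ N). assert (HC0 : 0 <= C0) by (unfold C0; nra).
(* By [outside_scale] the whole radius to [z] stays off the arcs, so the bound for F' can be
   integrated from 0. *)
assert (Off : forall z, D z -> (forall k, (k < N)%nat -> off_arc th k z) -> Cmod (F z - F 0%C) <= 2 * C0).
{ intros z Hz Ho.
  eapply Rle_trans; [apply (is_Cderive_mvt F (fun v => f1' v * f2' v * T v)%C 0%C z C0)|].
  - intros t Ht. replace (0 + t * (z - 0))%C with (t * z)%C by ring.
    assert (Htz : D (t * z)%C).
    { unfold D in *. rewrite Cmod_mult, Cmod_R, Rabs_pos_eq by lra. pose proof (Cmod_ge_0 z). nra. }
    split; [now apply HF|]. apply Outer; trivial. intros k Hk.
    apply (outside_scale _ _ _ (arc_dir_unit th k) (arc_sin_pos th N Hth k Hk) (arc_sin_le_cos th N Hth k Hk) t z Ht). now apply Ho.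
  - replace (z - 0)%C with z by ring. unfold D in Hz. pose proof (Cmod_ge_0 z). nra. }
(* Of the 6, four come from the mean value estimate over a segment of length at most 2, and one from
   the product [fj b] at each of its ends. *)
exists (Cmod (F 0%C) + 2 * C0 + 6 * M * KN). intros z Hz.
assert (HKN0 : 0 <= M * KN) by nra.
assert (Fz : forall v, Cmod (F v) <= Cmod (F 0%C) + Cmod (F v - F 0%C)).
{ intros v. replace (F v) with (F 0%C + (F v - F 0%C))%C at 1 by ring. apply Cmod_triangle. }
destruct (excluded_middle_informative (exists k, (k < N)%nat /\ in_arc th k z)) as [[k [Hk Hi]]|Hno].
2:{ pose proof (Fz z). assert (Cmod (F z - F 0%C) <= 2 * C0); [|lra]. apply Off; trivial. intros k Hk.
    destruct (off_arc_or_in_arc th k z); trivial. exfalso; apply Hno; now exists k. }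
destruct (in_arc_descent th N Hth HthN k z Hk Hz Hi) as [z0 [Hz0 [Ho Hpath]]].
destruct (Harc k Hk) as [X1 _]. destruct (HX (xs k) X1) as [A1 A2].
set (i := fst (fst (X (xs k)))) in *.
assert (Hcap : forall v, D v -> in_arc th k v -> cap (xs k) del v).
{ intros v Hv Hvi. destruct (HK k Hk) as [_ [_ Q3]]. destruct (Q3 v Hv Hvi) as [[Z1 Z2] _]. split; trivial; lra. }
set (b := fun v => (Cexp (Lf (xs k) v) * T v)%C).
set (b' := fun v => (Cexp (Lf (xs k) v) * (Lf' (xs k) v * T v + T' v))%C).
assert (Hb : forall v, D v -> in_arc th k v -> is_Cderive b v (b' v)).
{ intros v Hv Hvi. eapply is_Cderive_eq; [apply is_Cderive_mult; [apply (is_Cderive_comp Cexp (Lf (xs k))); [apply is_Cderive_Cexp|]|]|].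
  - apply A1, Hcap; trivial.
  - now apply HT.
  - unfold b'. fold (Lf' (xs k)). ring. }
assert (Hprod : forall v, D v -> in_arc th k v -> (f1' v * f2' v * T v)%C = (select (negb i) f1' f2' v * b v)%C).
{ intros v Hv Hvi. unfold b. unfold Lf. rewrite A2 by (apply Hcap; trivial). destruct i; simpl; ring. }
(* [i] marks the derivative that has a logarithm near this arc, so [fj] is the other bounded
   function. *)
set (fj := select (negb i) f1 f2). set (fj' := select (negb i) f1' f2').
assert (Hfj : holo D fj fj') by apply select_holo.
assert (Bfj : forall v, D v -> Cmod (fj v) <= M) by (intros v; apply select_bound).
(* Integration by parts in differential form: F' is [fj' b], so [F - fj b] has derivative [- fj b'],
   which is bounded. *)
assert (HG : Cmod ((F z - fj z * b z) - (F z0 - fj z0 * b z0)) <= 2 * (M * KN) * Cmod (z - z0)).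
{ apply (is_Cderive_mvt (fun v => F v - fj v * b v)%C (fun v => - (fj v * b' v))%C).
  intros t Ht. destruct (Hpath t Ht) as [Hv Hvi]. set (v := (z0 + t * (z - z0))%C) in *.
  split.
  - eapply is_Cderive_eq; [apply (is_Cderive_plus F (fun v => - (fj v * b v))%C); [now apply HF|]|].
    + apply (is_Cderive_ext_loc (fun v => - (1) * (fj v * b v))%C _ _ _ 1); [lra|intros; ring|].
      apply (is_Cderive_mult (fun _ => - (1))%C); [apply is_Cderive_const|]. apply is_Cderive_mult; [now apply Hfj|now apply Hb].
    + rewrite Hprod by trivial. fold fj'. ring.
  - rewrite Cmod_opp, Cmod_mult. apply Rmult_le_compat; try apply Cmod_ge_0; [now apply Bfj|].
    now apply Damp. }
assert (I0 := Hpath 0 ltac:(lra)). replace (z0 + 0 * (z - z0))%C with z0 in I0 by ring.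
assert (Bz : Cmod (fj z * b z) <= M * KN).
{ rewrite Cmod_mult. apply Rmult_le_compat; try apply Cmod_ge_0; [now apply Bfj|now apply Damp]. }
assert (Bz0 : Cmod (fj z0 * b z0) <= M * KN).
{ rewrite Cmod_mult. apply Rmult_le_compat; try apply Cmod_ge_0; [now apply Bfj|apply Damp; trivial; apply I0]. }
assert (Dz : Cmod (z - z0) <= 2) by (pose proof (Cmod_triangle_sub z z0); unfold D in Hz; lra).
assert (O := Off z0 Hz0 Ho). pose proof (Fz z0).
assert (Tr : Cmod (F z) <= Cmod ((F z - fj z * b z) - (F z0 - fj z0 * b z0)) + (Cmod (fj z * b z) + (Cmod (F z0) + Cmod (fj z0 * b z0)))).
{ replace (F z) with (((F z - fj z * b z) - (F z0 - fj z0 * b z0)) + (fj z * b z + (F z0 - fj z0 * b z0)))%C at 1 by ring.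
  eapply Rle_trans; [apply Cmod_triangle|]. apply Rplus_le_compat_l.
  eapply Rle_trans; [apply Cmod_triangle|]. apply Rplus_le_compat_l. apply Cmod_triangle_sub. }
nra.
Qed.
End Main.

Theorem theorem1p6 (C1 C2 : disc_sequence)
  (h1 : Hinfty_critical_set C1) (h2 : Hinfty_critical_set C2)
  (hsep : ~ exists z : C,
      Cclosure (points C1) z /\ Cclosure (points C2) z /\ unit_circle z) :
  Hinfty_critical_set (sequence_union C1 C2).
Proof.
destruct (critical_data C1 h1) as [f1 [f1' [M1 [HM1 [H1 [B1 Z1]]]]]].
destruct (critical_data C2 h2) as [f2 [f2' [M2 [HM2 [H2 [B2 Z2]]]]]].
destruct (separation (points C1) (points C2) hsep) as [del [Hdel Hs]].
assert (HO : openC (fun z => Cmod z < 1)) by exact openC_disc.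
assert (HC : convexC (fun z => Cmod z < 1)) by exact convexC_disc.
destruct (glued_derivative f1 f1' f2 f2' (Rmax M1 M2) del) as [T [T' [HT [HT0 HF]]]]; trivial.
- eapply Rle_trans; [exact HM1|apply Rmax_l].
- intros z Hz. eapply Rle_trans; [now apply B1|apply Rmax_l].
- intros z Hz. eapply Rle_trans; [now apply B2|apply Rmax_r].
(* A cap free of critical points has multiplicity 0 everywhere, and order 0 means that the
   derivative does not vanish. *)
- intros xi Hxi. destruct (Hs xi Hxi) as [H|H]; [left|right]; intros z [Hz Hd]; apply zero_of_order_0.
  + replace 0%nat with (C1 z); [now apply Z1|]. specialize (H z Hd). unfold points in H. lia.
  + replace 0%nat with (C2 z); [now apply Z2|]. specialize (H z Hd). unfold points in H. lia.
- assert (HP := holo_mult _ _ _ _ _ (holo_mult _ _ _ _ _ (holo_derive _ _ _ HO H1) (holo_derive _ _ _ HO H2)) HT).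
  assert (D0 : Cmod 0%C < 1) by (rewrite Cmod_0; lra).
  destruct (primitive_convex _ _ _ 0%C HO HC D0 HP) as [F HFd].
  assert (Ord : forall z, Cmod z < 1 -> zero_of_order (fun z => f1' z * f2' z * T z)%C z (C1 z + C2 z)).
  { intros z Hz. destruct (HO z Hz) as [r [Hr Hb]].
    apply (zero_of_order_mult f1' f2' T T' z _ _ r); auto. now apply (holo_sub (fun z => Cmod z < 1)). }
  assert (EF : forall z, Cmod z < 1 -> C_derive F z = (f1' z * f2' z * T z)%C).
  { intros z Hz. apply is_C_derive_unique, is_Cderive_iff, HFd, Hz. }
  exists F. split; [split|split].
  + intros z Hz. eexists. apply is_Cderive_iff, HFd, Hz.
  + exact (HF F HFd).
  (* A constant F would have zero derivative on the disc, but a zero of finite order at 0 leaves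
     nonzero values nearby. *)
  + intros [c0 Hc0].
    destruct (zero_of_order_nearby _ 0%C _ 1 Rlt_0_1 (Ord 0%C D0)) as [z [Hz Hne]].
    replace (z - 0)%C with z in Hz by ring. apply Hne.
    apply (is_Cderive_unique F z); [now apply HFd|].
    destruct (HO z Hz) as [r [Hr Hb]].
    apply (is_Cderive_ext_loc (fun _ => c0) F z _ r); trivial; [intros w Hw; symmetry; apply Hc0; exact (Hb w Hw)|apply is_Cderive_const].
  + intros z Hz. destruct (Ord z Hz) as [g [Hl Hg]]. exists g. split; trivial.
    apply locally_C_eps in Hl. destruct Hl as [d [Hd Hl]]. destruct (HO z Hz) as [r [Hr Hb]].
    apply locally_C_eps. exists (Rmin d r). split; [now apply Rmin_pos|]. intros w Hw.
    destruct (Hl w) as [L1 L2]; [eapply Rlt_le_trans; [exact Hw|apply Rmin_l]|]. split; trivial.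
    rewrite EF; [exact L2|]. apply Hb. eapply Rlt_le_trans; [exact Hw|apply Rmin_r].
Qed.
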